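(* Let $R\colon \mathcal S_{\mathrm{CaTT}}\to \mathrm{Comp}^{\mathrm{op}}$ be the morphism of categories with families, from the syntactic category of the dependent type theory CaTT to the opposite of the category of computads, defined recursively in the context. Then the functor $R$ is fully faithful, and its essential image is the class of finite computads. Moreover the natural transformations $R^{\mathrm{Ty}}$ and $R^{\mathrm{Tm}}$ are invertible, i.e. for every valid context $\Gamma$ the function $R^{\mathrm{Ty}}_\Gamma\colon \mathrm{Ty}(\Gamma)\to \mathrm{Type}^{\mathrm{Comp}}(R\Gamma)$ is a bijection, and for every valid type $\Gamma\vdash A$ the function $R^{\mathrm{Tm}}_{\Gamma,A}\colon \mathrm{Tm}(\Gamma;A)\to \mathrm{Term}^{\mathrm{Comp}}(R\Gamma;R^{\mathrm{Ty}}_\Gamma A)$ is a bijection.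
   Context: **The type theory CaTT.** Fix a countably infinite set of variables. Contexts are lists of pairs $(x:A)$ with $x$ a variable and $A$ a type (empty list $\emptyset$); substitutions are lists of pairs $x\mapsto t$ with $t$ a term (empty list $\langle\rangle$); types are $\ast$ or $u\to_A v$ with $A$ a type and $u,v$ terms; terms are $\mathrm{var}\,x$ with $x$ a variable, or $\mathrm{coh}_{\Gamma,A}[\gamma]$ with $\Gamma$ a context, $A$ a type and $\gamma$ a substitution (here the brackets are part of the syntax). Substitution acts by: $(\mathrm{var}\,x)[\gamma]$ is the last term associated to $x$ in $\gamma$ if it exists and $\mathrm{var}\,x$ otherwise; $\mathrm{coh}_{\Gamma,A}[\gamma][\delta]=\mathrm{coh}_{\Gamma,A}[\gamma\circ\delta]$; $\ast[\gamma]=\ast$; $(u\to_A v)[\gamma]=u[\gamma]\to_{A[\gamma]}v[\gamma]$; where $\langle\rangle\circ\delta=\langle\rangle$ and $\langle\gamma,x\mapsto t\rangle\circ\delta=\langle\gamma\circ\delta,x\mapsto t[\delta]\rangle$. Variable sets: $\mathrm{Var}(\emptyset)=\emptyset$, $\mathrm{Var}(\Gamma,x:A)=\mathrm{Var}(\Gamma)\cup\{x\}$, $\mathrm{Var}(\langle\rangle)=\emptyset$, $\mathrm{Var}(\langle\gamma,x\mapsto t\rangle)=\mathrm{Var}(\gamma)\cup\mathrm{Var}(t)$, $\mathrm{Var}(\mathrm{var}\,x)=\{x\}$, $\mathrm{Var}(\mathrm{coh}_{\Gamma,A}[\gamma])=\mathrm{Var}(\gamma)$, $\mathrm{Var}(\ast)=\emptyset$,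 $\mathrm{Var}(u\to_A v)=\mathrm{Var}(A)\cup\mathrm{Var}(u)\cup\mathrm{Var}(v)$. Dimensions: $\dim\ast=-1$, $\dim(u\to_A v)=\dim A+1$, $\dim\emptyset=-1$, $\dim(\Gamma,x:A)=\max(\dim\Gamma,\dim A+1)$. Pasting contexts are given by the judgements $\Gamma\vdash_{ps}x:A$ and $\Gamma\vdash_{ps}$ with rules: (pss) $(x:\ast)\vdash_{ps}x:\ast$; (psd) from $\Gamma\vdash_{ps}f:x\to_A y$ infer $\Gamma\vdash_{ps}y:A$; (pse) from $\Gamma\vdash_{ps}x:A$ and distinct $y,f\notin\mathrm{Var}(\Gamma)$ infer $\Gamma,y:A,f:x\to_A y\vdash_{ps}f:x\to_A y$; (ps) from $\Gamma\vdash_{ps}x:\ast$ infer $\Gamma\vdash_{ps}$. $\Gamma$ is a pasting context if $\Gamma\vdash_{ps}$; derivations are unique. For $k\in\mathbb N$, $\epsilon\in\{+,-\}$, the context $\partial^\epsilon_k\Gamma$ is defined by induction on the derivation: (pss) $\partial^\epsilon_k((x:\ast)\vdash_{ps}x:\ast)=(x:\ast)$; (psd) $\partial^\epsilon_k(\Gamma\vdash_{ps}y:A)=\partial^\epsilon_k(\Gamma\vdash_{ps}f:x\to_A y)$; (ps) $\partial^\epsilon_k(\Gamma\vdash_{ps})=\partial^\epsilon_k(\Gamma\vdash_{ps}x:\ast)$; (pse) writing $D^\epsilon=\partial^\epsilon_k(\Gamma\vdash_{ps}x:A)$, the value at $\Gamma,y:A,f:x\to_A y\vdash_{ps}f:x\to_A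 y$ is $D^\epsilon$ if $\dim A+1>k$; $(D^\epsilon,y:A,f:x\to_A y)$ if $\dim A+1\le k-1$; $D^-$ if $\dim A+1=k$, $\epsilon=-$; and $(\mathrm{rm}\,D^+,y:A)$ if $\dim A+1=k$, $\epsilon=+$, where $\mathrm{rm}$ deletes the last entry of a list. These are pasting contexts, and there are substitutions $\Gamma\vdash s^\Gamma_k:\partial_k^-\Gamma$ and $\Gamma\vdash t^\Gamma_k:\partial_k^+\Gamma$ sending each variable to the variable of the same name. Judgements $\Gamma\vdash$, $\Gamma\vdash A$, $\Gamma\vdash t:A$, $\Delta\vdash\gamma:\Gamma$ (valid context, type, term, substitution) are generated by: $\emptyset\vdash$; if $\Gamma\vdash A$ and $x\notin\mathrm{Var}(\Gamma)$ then $(\Gamma,x:A)\vdash$; if $\Gamma\vdash$ and $(x:A)\in\Gamma$ then $\Gamma\vdash\mathrm{var}\,x:A$; if $\Gamma\vdash$ then $\Gamma\vdash\langle\rangle:\emptyset$; if $\Delta\vdash\gamma:\Gamma$, $(\Gamma,x:A)\vdash$ and $\Delta\vdash t:A[\gamma]$ then $\Delta\vdash\langle\gamma,x\mapsto t\rangle:(\Gamma,x:A)$; if $\Gamma\vdash$ then $\Gamma\vdash\ast$; if $\Gamma\vdash A$, $\Gamma\vdash t:A$, $\Gamma\vdash u:A$ then $\Gamma\vdash t\to_A u$; and (coh): if $\Gamma\vdash_{ps}$, $\Gamma\vdash u:A$, $\Gamma\vdash v:A$ and $\Delta\vdash\gamma:\Gamma$ then $\Delta\vdash\mathrm{coh}_{\Gamma,u\to_A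 v}[\gamma]:(u\to_A v)[\gamma]$, provided that either $\dim\Gamma\ge1$, $\mathrm{Var}(s^\Gamma_{\dim\Gamma-1})=\mathrm{Var}(u)\cup\mathrm{Var}(A)$ and $\mathrm{Var}(t^\Gamma_{\dim\Gamma-1})=\mathrm{Var}(v)\cup\mathrm{Var}(A)$; or $\mathrm{Var}(\Gamma)=\mathrm{Var}(u)\cup\mathrm{Var}(A)=\mathrm{Var}(v)\cup\mathrm{Var}(A)$. All syntax is considered up to $\alpha$-renaming of contexts (including the contexts $\Gamma$ in $\mathrm{coh}_{\Gamma,A}$), e.g. by using De Bruijn indices. The syntactic category $\mathcal S_{\mathrm{CaTT}}$ has valid contexts as objects and substitutions $\Delta\vdash\gamma:\Gamma$ as morphisms $\Delta\to\Gamma$. It is a category with families with $\mathrm{Ty}(\Gamma)$ the set of valid types in $\Gamma$, $\mathrm{Tm}(\Gamma;A)$ the set of terms of type $A$ in $\Gamma$, and extension $(\Gamma,x:A)$. **Categories with families.** A category with families is a category with a chosen terminal object, a presheaf $\Gamma\mapsto(\mathrm{Tm}(\Gamma;A))_{A\in\mathrm{Ty}(\Gamma)}$ valued in families of sets, and for each $\Gamma$ and $A\in\mathrm{Ty}(\Gamma)$ an object $\Gamma.A$ with a projection $\pi_{\Gamma,A}\colon\Gamma.A\to\Gamma$ and an element $v_{\Gamma,A}\in\mathrm{Tm}(\Gamma.A;A[\pi_{\Gamma,A}])$ such that for all $\gamma\colon\Delta\to\Gamma$ and $u\in\mathrm{Tm}(\Delta;A[\gamma])$ there is a unique $\langle\gamma,u\rangle\colon\Delta\to\Gamma.A$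 with $\pi_{\Gamma,A}\langle\gamma,u\rangle=\gamma$ and $v_{\Gamma,A}[\langle\gamma,u\rangle]=u$. A morphism of categories with families is a functor $F$ preserving the chosen terminal object together with natural functions $F^{\mathrm{Ty}}_\Gamma\colon\mathrm{Ty}(\Gamma)\to\mathrm{Ty}(F\Gamma)$, $F^{\mathrm{Tm}}_{\Gamma,A}\colon\mathrm{Tm}(\Gamma;A)\to\mathrm{Tm}(F\Gamma;F^{\mathrm{Ty}}_\Gamma A)$ preserving extensions on the nose. **Globular sets and Batanin trees.** A globular set $X$ is a family of sets $X_n$ ($n\in\mathbb N$) with functions $\mathrm{src},\mathrm{tgt}\colon X_{n+1}\to X_n$ with $\mathrm{src}\,\mathrm{src}=\mathrm{src}\,\mathrm{tgt}$, $\mathrm{tgt}\,\mathrm{src}=\mathrm{tgt}\,\mathrm{tgt}$; morphisms commute with $\mathrm{src},\mathrm{tgt}$; $\mathrm{gSet}$ is their category. $\mathbb D^n$ is the globular set represented by $n$, $\mathbb S^{n-1}$ is $\mathbb D^n$ without its unique $n$-cell, and $\iota_n\colon\mathbb S^{n-1}\to\mathbb D^n$ is the inclusion. Batanin trees are inductively generated by $\mathrm{br}\colon\mathrm{List}(\mathrm{Bat})\to\mathrm{Bat}$. $\dim\mathrm{br}[]=0$, $\dim\mathrm{br}[B_1,\dots,B_n]=\max(\dim B_1+1,\dim\mathrm{br}[B_2,\dots,B_n])$; $\partial_0B=\mathrm{br}[]$, $\partial_{k+1}\mathrm{br}[B_1,\dots,B_n]=\mathrm{br}[\partial_kB_1,\dots,\partial_kB_n]$.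 The globular set of positions is $\mathrm{Pos}(\mathrm{br}[B_1,\dots,B_n])=\bigvee_{i=1}^n\Sigma\mathrm{Pos}(B_i)$, where the suspension $\Sigma X$ has two $0$-cells $v_-,v_+$ (its first and second basepoints) and $(\Sigma X)_{n+1}=X_n$ with all $1$-cells going from $v_-$ to $v_+$, and $X\vee Y$ identifies the second basepoint of $X$ with the first of $Y$ (empty wedge: $\mathbb D^0$). The maps $s_k^B,t_k^B\colon\mathrm{Pos}(\partial_kB)\to\mathrm{Pos}(B)$ are: $s_0^B,t_0^B\colon\mathbb D^0\to\mathrm{Pos}(B)$ pick the first and second basepoint respectively, and $s_{k+1}^{\mathrm{br}[B_1,\dots,B_n]}=\bigvee_i\Sigma s_k^{B_i}$, $t_{k+1}^{\mathrm{br}[B_1,\dots,B_n]}=\bigvee_i\Sigma t_k^{B_i}$. **Computads.** By mutual induction on $n$ one defines the category $\mathrm{Comp}_n$ of $n$-computads, functors $\mathrm{Free}_n\colon\mathrm{gSet}\to\mathrm{Comp}_n$, $\mathrm{Cell}_n,\mathrm{Sphere}_n\colon\mathrm{Comp}_n\to\mathrm{Set}$, the truncation $\mathrm{tr}_{n-1}\colon\mathrm{Comp}_n\to\mathrm{Comp}_{n-1}$, a natural transformation $\mathrm{bdry}\colon\mathrm{Cell}_n\Rightarrow\mathrm{Sphere}_{n-1}\mathrm{tr}_{n-1}$, and subsets $\mathrm{Full}_n(B)\subseteq\mathrm{Sphere}_n(\mathrm{Free}_n\mathrm{Pos}(B))$. $\mathrm{Comp}_{-1}$ is terminal and $\mathrm{Sphere}_{-1}$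 picks a one-element set, whose element is full. For $n\ge0$, an $n$-computad $C$ is an $(n-1)$-computad $C_{n-1}$, a set $V_n^C$ of generators and a function $\phi_n^C\colon V_n^C\to\mathrm{Sphere}_{n-1}(C_{n-1})$; a morphism $f\colon C\to D$ is a morphism $f_{n-1}\colon C_{n-1}\to D_{n-1}$ with a function $f_V\colon V_n^C\to\mathrm{Cell}_n(D)$ with $\mathrm{bdry}\circ f_V=\mathrm{Sphere}_{n-1}(f_{n-1})\circ\phi^C_n$. $\mathrm{Cell}_n(C)$ is inductively generated by $\mathrm{var}\,v$ for $v\in V_n^C$ and, when $n>0$, $\mathrm{coh}(B,A,f)$ for $B$ a Batanin tree with $\dim B\le n$, $A\in\mathrm{Full}_{n-1}(B)$ and $f\colon\mathrm{Free}_n\mathrm{Pos}(B)\to C$ a morphism; $\mathrm{bdry}(\mathrm{var}\,v)=\phi_n^C(v)$, $\mathrm{bdry}(\mathrm{coh}(B,A,f))=\mathrm{Sphere}_{n-1}(f_{n-1})(A)$. $\mathrm{Sphere}_n(C)$ is the set of pairs of $n$-cells with equal boundary. Recursively $\mathrm{Cell}_n(g)(\mathrm{var}\,v)=g_V(v)$, $\mathrm{Cell}_n(g)(\mathrm{coh}(B,A,f))=\mathrm{coh}(B,A,g\circ f)$, $g\circ f=(g_{n-1}\circ f_{n-1},\mathrm{Cell}_n(g)\circ f_V)$. $\mathrm{Free}_nX$ consists of $\mathrm{Free}_{n-1}X$, the set $X_n$, and $x\mapsto(\mathrm{var}\,\mathrm{src}\,x,\mathrm{var}\,\mathrm{tgt}\,x)$.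 The support of an $n$-cell is the set of $n$-dimensional generators given by $\mathrm{supp}_n(\mathrm{var}\,v)=\{v\}$, $\mathrm{supp}_n(\mathrm{coh}(B,A,f))=\bigcup_{p\in\mathrm{Pos}_n(B)}\mathrm{supp}_n(f_V(p))$. A sphere $(a,b)\in\mathrm{Sphere}_n(\mathrm{Free}_n\mathrm{Pos}(B))$ is full when $\mathrm{supp}_n(a)$ and $\mathrm{supp}_n(b)$ are precisely the sets of $n$-positions in the images of $s_n^B$ and $t_n^B$ respectively, and the sphere $\mathrm{bdry}(a)$ is full. $\mathrm{Comp}$ is the limit of the categories $\mathrm{Comp}_n$ along the truncations, with induced functor $\mathrm{Free}\colon\mathrm{gSet}\to\mathrm{Comp}$. A computad is finite if the total set of its generators $\coprod_nV_n^C$ is finite. $\mathrm{Comp}^{\mathrm{op}}$ is a category with families: the chosen terminal object is the computad $\emptyset$ without generators; $\mathrm{Type}^{\mathrm{Comp}}(C)=\coprod_{n\in\mathbb N}\mathrm{Comp}(\mathrm{Free}\,\mathbb S^{n-1},C)$; $\mathrm{Term}^{\mathrm{Comp}}(C;(n,A))=\{c\colon\mathrm{Free}\,\mathbb D^n\to C\mid c\circ\mathrm{Free}\,\iota_n=A\}$; and $C.(n,A)$ is the pushout of $A$ along $\mathrm{Free}\,\iota_n$, i.e. $C$ with one new generator of dimension $n$ adjoined with boundary $A$. Morphisms $\mathrm{Free}\,\mathbb D^n\to C$ are identified with $n$-cells of $C$ and morphisms $\mathrm{Free}\,\mathbb S^n\to C$ with $n$-spheres of $C$. **The morphism $R$.**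 For a pasting context $\Gamma$, let $V\Gamma$ be the globular set whose $n$-cells are the variables $x$ with $(x:A)\in\Gamma$ and $\dim A+1=n$, where a variable of type $u\to_A v$ has source $u$ and target $v$. There are a unique Batanin tree $B_\Gamma$ with $V\Gamma\cong\mathrm{Pos}(B_\Gamma)$ and a unique such isomorphism $R^{\mathrm{Bat}}_\Gamma\colon V\Gamma\to\mathrm{Pos}(B_\Gamma)$; the assignment $\Gamma\mapsto B_\Gamma$ is a bijection from pasting contexts to Batanin trees. The morphism $R$ is defined by mutual recursion on the syntax: - $R(\emptyset)=\emptyset$, and $R(\Gamma,x:A)$ is the extension of $R\Gamma$ by $R^{\mathrm{Ty}}_\Gamma(A)$, i.e. the pushout of $R^{\mathrm{Ty}}_\Gamma(A)\colon\mathrm{Free}\,\mathbb S^{\dim A}\to R\Gamma$ along $\mathrm{Free}\,\iota_{\dim A+1}\colon\mathrm{Free}\,\mathbb S^{\dim A}\to\mathrm{Free}\,\mathbb D^{\dim A+1}$, with coprojections $\pi_{\Gamma,A}\colon R\Gamma\to R(\Gamma,x:A)$ and $v_{\Gamma,A}$; - for $\Delta\vdash\gamma:\Gamma$, $R\gamma\colon R\Gamma\to R\Delta$ is the unique map if $\gamma=\langle\rangle$, and $R\langle\gamma,x\mapsto t\rangle=\langle R\gamma,R^{\mathrm{Tm}}(t)\rangle$ is the map induced by the pushout; - $R^{\mathrm{Ty}}_\Gamma(\ast)$ is the unique map $\mathrm{Free}\,\mathbb S^{-1}\to R\Gamma$ (with $n=0$), and $R^{\mathrm{Ty}}_\Gamma(u\to_A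 v)$ is the sphere $(R^{\mathrm{Tm}}_{\Gamma,A}(u),R^{\mathrm{Tm}}_{\Gamma,A}(v))$; - $R^{\mathrm{Tm}}_{(\Gamma,x:A),B}(\mathrm{var}\,y)$ is $v_{\Gamma,A}$ if $y=x$ and $\pi_{\Gamma,A}\circ R^{\mathrm{Tm}}_{\Gamma,B}(\mathrm{var}\,y)$ otherwise; - for $\Delta\vdash\gamma:\Gamma$, $R^{\mathrm{Tm}}_\Delta(\mathrm{coh}_{\Gamma,A}[\gamma])=\mathrm{coh}\big(B_\Gamma,\ \mathrm{Free}\,R^{\mathrm{Bat}}_\Gamma\circ R^{\mathrm{Ty}}_\Gamma(A),\ R(\gamma)\circ(\mathrm{Free}\,R^{\mathrm{Bat}}_\Gamma)^{-1}\big)$, using that $R\Gamma=\mathrm{Free}\,V\Gamma$ for a pasting context $\Gamma$. *)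

(* Defs.v *)
From mathcomp Require Import all_boot.
From Stdlib Require Import FunctionalExtensionality ProofIrrelevance.

Set Implicit Arguments.
Unset Strict Implicit.
Unset Printing Implicit Defensive.

Record gset := GSet {
  gcell :> nat -> Type;
  gsrc : forall n, gcell n.+1 -> gcell n;
  gtgt : forall n, gcell n.+1 -> gcell n;
  gsrcK : forall n (x : gcell n.+2), gsrc (gsrc x) = gsrc (gtgt x);
  gtgtK : forall n (x : gcell n.+2), gtgt (gsrc x) = gtgt (gtgt x) }.

Record gmor (X Y : gset) := GMor {
  gmap :> forall n, X n -> Y n;
  gmap_src : forall n (x : X n.+1), gmap (gsrc x) = gsrc (gmap x);
  gmap_tgt : forall n (x : X n.+1), gmap (gtgt x) = gtgt (gmap x) }.

Definition ginverse X Y (f : gmor X Y) (g : gmor Y X) : Prop :=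
  (forall n, cancel (@f n) (@g n)) /\ (forall n, cancel (@g n) (@f n)).

(** The sphere [S^{n-1}], indexed by [n], and the disk [D^n].  The globular set
    represented by [n] has two cells in each dimension [k < n] (iterated source:
    [false], iterated target: [true]) and a single [n]-cell; the sphere lacks
    the latter. *)
Inductive face (n k : nat) : Type := Face (b : bool) of (k < n)%N.

Definition face_lower n k b (x : face n k.+1) : face n k :=
  let: Face _ lt := x in Face b (ltnW lt).

Lemma face_eq n k b (p q : k < n) : Face b p = Face b q.
Proof. by rewrite (bool_irrelevance p q). Qed.

Lemma face_lowerK n k b c (x : face n k.+2) :
  face_lower b (face_lower c x) = face_lower b (face_lower (~~ c) x).
Proof. by case: x => ? ?; apply: face_eq. Qed.

Definition gsphere (n : nat) : gset :=
  @GSet (face n) (fun k => face_lower false) (fun k => face_lower true)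
    (fun k => face_lowerK false false) (fun k => face_lowerK true false).

Definition disk_cell (n k : nat) : Type := (face n k + is_true (k == n))%type.

Lemma top_lt n k : k.+1 == n -> k < n.
Proof. by move/eqP <-. Qed.

Definition disk_lower n k b (x : disk_cell n k.+1) : disk_cell n k :=
  match x with
  | inl y => inl (face_lower b y)
  | inr e => inl (Face b (top_lt e))
  end.

Lemma disk_lowerK n k b c (x : disk_cell n k.+2) :
  disk_lower b (disk_lower c x) = disk_lower b (disk_lower (~~ c) x).
Proof.
by case: x => [x|e] /=; [rewrite face_lowerK | congr inl; apply: face_eq].
Qed.

Definition gdisk (n : nat) : gset :=
  @GSet (disk_cell n) (fun k => disk_lower false) (fun k => disk_lower true)
    (fun k => disk_lowerK false false) (fun k => disk_lowerK true false).

Definition giota (n : nat) : gmor (gsphere n) (gdisk n) :=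
  @GMor (gsphere n) (gdisk n) (fun k => inl)
    (fun k x => erefl) (fun k x => erefl).

Inductive bat : Type := br of seq bat.

Fixpoint bat_dim (B : bat) : nat :=
  let: br l := B in foldr (fun B d => maxn (bat_dim B).+1 d) 0 l.

Fixpoint bat_bd (k : nat) (B : bat) : bat :=
  match k with
  | 0 => br [::]
  | k.+1 => let: br l := B in br [seq bat_bd k B | B <- l]
  end.

Record bgset := BGSet { bg :> gset; base : bool -> bg 0 }.

(** [D^0] with both basepoints equal to its point. *)
Definition bpoint : bgset :=
  let c n : Type := if n is 0 then unit else void in
  @BGSet
    (@GSet c (fun n (x : void) => match x with end)
       (fun n (x : void) => match x with end)
       (fun n (x : void) => match x with end)
       (fun n (x : void) => match x with end))
    (fun _ => tt).

(** The wedge [(Sigma X) \/ Y]: its [0]-cells are the first basepoint [v_-] of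
    [Sigma X] ([None]) and the [0]-cells of [Y], the second basepoint [v_+] of
    [Sigma X] being identified with the first basepoint of [Y]. *)
Section SuspWedge.
Variables (X : gset) (Y : bgset).

Definition sw_cell (n : nat) : Type :=
  if n is m.+1 then (X m + Y m.+1)%type else option (Y 0).

Definition sw_src n : sw_cell n.+1 -> sw_cell n :=
  match n with
  | 0 => fun c => match c with inl _ => None | inr y => Some (gsrc y) end
  | m.+1 => fun c => match c with
                     | inl x => inl (gsrc x)
                     | inr y => inr (gsrc y)
                     end
  end.

Definition sw_tgt n : sw_cell n.+1 -> sw_cell n :=
  match n with
  | 0 => fun c => match c with
                  | inl _ => Some (base Y false)
                  | inr y => Some (gtgt y)
                  end
  | m.+1 => fun c => match c with
                     | inl x => inl (gtgt x)
                     | inr y => inr (gtgt y)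
                     end
  end.

Lemma sw_srcK n (x : sw_cell n.+2) : sw_src (sw_src x) = sw_src (sw_tgt x).
Proof. by case: n x => [|n] [] x //=; rewrite gsrcK. Qed.

Lemma sw_tgtK n (x : sw_cell n.+2) : sw_tgt (sw_src x) = sw_tgt (sw_tgt x).
Proof. by case: n x => [|n] [] x //=; rewrite gtgtK. Qed.

Definition susp_wedge : bgset :=
  @BGSet (GSet sw_srcK sw_tgtK)
    (fun b => if b then Some (base Y true) else None).

End SuspWedge.

Definition sw_map (X X' : gset) (Y Y' : bgset)
    (f : forall n, X n -> X' n) (g : forall n, Y n -> Y' n) n :
  susp_wedge X Y n -> susp_wedge X' Y' n :=
  match n with
  | 0 => omap (g 0)
  | m.+1 => fun c => match c with
                     | inl x => inl (f m x)
                     | inr y => inr (g m.+1 y)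
                     end
  end.

Fixpoint Pos (B : bat) : bgset :=
  let: br l := B in foldr (fun B Y => susp_wedge (Pos B) Y) bpoint l.

(** The maps [s_k^B] ([e = false]) and [t_k^B] ([e = true]). *)
Fixpoint bat_incl (e : bool) (k : nat) (B : bat) {struct k} :
    forall n, Pos (bat_bd k B) n -> Pos B n :=
  match k with
  | 0 => fun n => match n with
                  | 0 => fun _ => base (Pos B) e
                  | m.+1 => fun x : void => match x with end
                  end
  | k'.+1 =>
    let: br l := B in
    (fix go (l : seq bat) :
         forall n, Pos (br [seq bat_bd k' B | B <- l]) n -> Pos (br l) n :=
       match l with
       | [::] => fun n x => x
       | B :: l => sw_map (@bat_incl e k' B) (go l)
       end) l
  end.

(** The categories [Comp_n] and their limit are presented in all dimensions at
    once: [cell V n] is generated by the two constructors of [Cell_n] with the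
    side conditions left out, these conditions are then imposed by [is_cell],
    and a computad is a sequence of sets of generators with attaching spheres.
    Cells carry no proofs, so that Leibniz equality of cells is equality of the
    generated terms.  In [ccoh B a b f] the pair [(a, b)] is the sphere [A], and
    [f] lists the images of all positions of [B]; since [bat_dim B <= n.+1] is
    imposed by [is_cell], [B] has no positions above dimension [n.+1] and this
    is a morphism out of [Free_{n+1} (Pos B)]. *)

Inductive cell (V : nat -> Type) : nat -> Type :=
| cvar n of V n : cell V n
| ccoh n (B : bat) (a b : cell (Pos B) n) (f : forall k, Pos B k -> cell V k) :
    cell V n.+1.

Fixpoint bind V W (f : forall n, V n -> cell W n) n (c : cell V n) : cell W n :=
  match c with
  | cvar n v => f n v
  | ccoh n B a b g => ccoh a b (fun k p => bind f (g k p))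
  end.

Definition bind2 V W (f : forall n, V n -> cell W n) n
  (s : cell V n * cell V n) := (bind f s.1, bind f s.2).

Fixpoint supp V n (c : cell V n) : V n -> Prop :=
  match c with
  | cvar n v => fun w => w = v
  | ccoh n B a b f => fun w => exists p : Pos B n.+1, supp (f n.+1 p) w
  end.

(** Attaching maps [phi_{n+1}]; [Sphere_{-1}] being a singleton, [phi_0] carries
    no data. *)
Definition attaching (V : nat -> Type) :=
  forall n, V n.+1 -> cell V n * cell V n.

Definition free_att (X : gset) : attaching X :=
  fun n x => (cvar (gsrc x), cvar (gtgt x)).
Arguments free_att X : clear implicits.

Definition bdry_type (V : nat -> Type) (n : nat) : Type :=
  if n is k.+1 then (cell V k * cell V k)%type else unit.

Definition bdry V (phi : attaching V) n (c : cell V n.+1) :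
    cell V n * cell V n :=
  match c in cell _ m return bdry_type V m with
  | cvar m v =>
    match m return V m -> bdry_type V m with
    | 0 => fun _ => tt
    | k.+1 => fun v => phi k v
    end v
  | ccoh m B a b f => (bind f a, bind f b)
  end.

Definition parallel V (phi : attaching V) n : cell V n -> cell V n -> Prop :=
  match n with
  | 0 => fun _ _ => True
  | m.+1 => fun a b => bdry phi a = bdry phi b
  end.

Fixpoint full (B : bat) n : cell (Pos B) n -> cell (Pos B) n -> Prop :=
  let supp_cond m (a b : cell (Pos B) m) :=
    (forall p, supp a p <-> exists q, bat_incl false (k:=m) q = p) /\
    (forall p, supp b p <-> exists q, bat_incl true (k:=m) q = p) in
  match n with
  | 0 => fun a b => supp_cond 0 a b
  | m.+1 => fun a b =>
      supp_cond m.+1 a b /\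
      full (bdry (free_att (Pos B)) a).1 (bdry (free_att (Pos B)) a).2
  end.

Fixpoint is_cell V (phi : attaching V) n (c : cell V n) : Prop :=
  match c with
  | cvar _ _ => True
  | ccoh n B a b f =>
    [/\ bat_dim B <= n.+1,
        [/\ is_cell (free_att (Pos B)) a, is_cell (free_att (Pos B)) b &
            parallel (free_att (Pos B)) a b],
        full a b,
        forall k p, is_cell phi (f k p) &
        forall k p, bdry phi (f k.+1 p) = bind2 f (free_att (Pos B) k p)]
  end.

Definition is_sphere V (phi : attaching V) n (s : cell V n * cell V n) : Prop :=
  [/\ is_cell phi s.1, is_cell phi s.2 & parallel phi s.1 s.2].

Record computad := Computad {
  gen : nat -> Type;
  att : attaching gen;
  attP : forall n (v : gen n.+1), is_sphere att (att v) }.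
Arguments att C [n] v : rename.

Record cmor (C D : computad) := CMor {
  cmap : forall n, gen C n -> cell (gen D) n;
  cmap_cell : forall n (v : gen C n), is_cell (att D) (cmap v);
  cmap_bdry : forall n (v : gen C n.+1),
    bdry (att D) (cmap v) = bind2 cmap (att C v) }.

Lemma cmor_eq C D (f g : cmor C D) :
  (forall n v, cmap f (n:=n) v = cmap g v) -> f = g.
Proof.
case: f g => f f1 f2 [g g1 g2] /= fg.
have {}fg : f = g by do 2![apply: functional_extensionality_dep => ?].
by subst g; congr CMor; apply: proof_irrelevance.
Qed.

Lemma ccoh_eq V n B (a b : cell (Pos B) n) (f g : forall k, Pos B k -> cell V k) :
  (forall k p, f k p = g k p) -> ccoh a b f = ccoh a b g.
Proof.
move=> fg; congr ccoh.
by do 2![apply: functional_extensionality_dep => ?].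
Qed.

Lemma bind_var V n (c : cell V n) : bind (fun k => @cvar V k) c = c.
Proof. by elim: c => //= *; apply: ccoh_eq. Qed.

Lemma bind_bind U V W (f : forall n, U n -> cell V n)
    (g : forall n, V n -> cell W n) n (c : cell U n) :
  bind g (bind f c) = bind (fun k v => bind g (f k v)) c.
Proof. by elim: c f g => //= *; apply: ccoh_eq => *; auto. Qed.

Lemma eq_bind V W (f g : forall n, V n -> cell W n) n (c : cell V n) :
  (forall k v, f k v = g k v) -> bind f c = bind g c.
Proof. by move=> fg; elim: c f g fg => //= *; apply: ccoh_eq => *; auto. Qed.

Lemma bdry_cell V (phi : attaching V) (P : forall n, cell V n.+1 -> Prop) :
  (forall n (v : V n.+1), P n (cvar v)) ->
  (forall n B (a b : cell (Pos B) n) f, P n (ccoh a b f)) ->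
  forall n c, P n c.
Proof.
move=> Pv Pc n c.
pose Q m : cell V m -> Prop := match m with 0 => fun _ => True | k.+1 => P k end.
suff : Q n.+1 c by [].
by case: c => [[|m] v|m B a b f] /=.
Qed.

Lemma bdry_bind C D (f : cmor C D) n (c : cell (gen C) n.+1) :
  bdry (att D) (bind (cmap f) c) = bind2 (cmap f) (bdry (att C) c).
Proof.
elim/(@bdry_cell _ (att C)): n / c => [n v|n B a b g] /=.
  exact: cmap_bdry.
by rewrite /bind2 /= !bind_bind.
Qed.

Lemma is_cell_bind_raw V (phi : attaching V) W (psi : attaching W)
    (f : forall n, V n -> cell W n) n (c : cell V n) :
  (forall n v, is_cell psi (f n v)) ->
  (forall n (c : cell V n.+1),
     bdry psi (bind f c) = bind2 f (bdry phi c)) ->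
  is_cell phi c -> is_cell psi (bind f c).
Proof.
elim: c phi W psi f => [*|{}V {}n B a _ b _ g IH phi W psi f fc fb] /=; first by auto.
case=> ? ? ? gc gb; split=> // k p; first exact: (IH _ _ phi).
by rewrite fb gb.
Qed.

Lemma is_cell_bind C D (f : cmor C D) n (c : cell (gen C) n) :
  is_cell (att C) c -> is_cell (att D) (bind (cmap f) c).
Proof.
by apply: is_cell_bind_raw; [exact: cmap_cell | move=> ?; exact: bdry_bind].
Qed.

Lemma parallel_bind C D (f : cmor C D) n (a b : cell (gen C) n) :
  parallel (att C) a b ->
  parallel (att D) (bind (cmap f) a) (bind (cmap f) b).
Proof. by case: n a b => //= n a b ab; rewrite !bdry_bind ab. Qed.

Definition cid (C : computad) : cmor C C.
Proof.
exists (fun n => @cvar (gen C) n) => // n v.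
by rewrite /bind2 !bind_var -surjective_pairing.
Defined.

Definition ccomp (C D E : computad) (g : cmor D E) (f : cmor C D) : cmor C E.
Proof.
exists (fun n v => bind (cmap g) (cmap f v)) => n v.
  exact/is_cell_bind/cmap_cell.
by rewrite bdry_bind cmap_bdry /bind2 /= !bind_bind.
Defined.

Lemma ccomp1f C D (f : cmor C D) : ccomp (cid D) f = f.
Proof. by apply: cmor_eq => n v /=; rewrite bind_var. Qed.

Lemma ccompf1 C D (f : cmor C D) : ccomp f (cid C) = f.
Proof. exact: cmor_eq. Qed.

Lemma ccompA C D E F (h : cmor E F) (g : cmor D E) (f : cmor C D) :
  ccomp h (ccomp g f) = ccomp (ccomp h g) f.
Proof. by apply: cmor_eq => n v /=; rewrite bind_bind. Qed.

Definition Free (X : gset) : computad.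
Proof.
exists X (free_att X) => n v; split=> //=.
by case: n v => //= n v; rewrite /free_att gsrcK gtgtK.
Defined.

Definition Free_map X Y (f : gmor X Y) : cmor (Free X) (Free Y).
Proof.
exists (fun n x => cvar (f n x)) => //= n v.
by rewrite /free_att /bind2 /= gmap_src gmap_tgt.
Defined.

Definition cempty : computad.
Proof. by exists (fun _ => void) (fun n (v : void) => match v with end). Defined.

Definition cempty_elim (C : computad) : cmor cempty C.
Proof. by exists (fun n (v : void) => match v with end) => n []. Defined.

Definition finite_computad (C : computad) : Prop :=
  exists (k : nat) (f : 'I_k -> {n : nat & gen C n}), bijective f.

Definition ctype (C : computad) : Type :=
  {n : nat & cmor (Free (gsphere n)) C}.

Definition cterm (C : computad) (A : ctype C) : Type :=
  {c : cmor (Free (gdisk (projT1 A))) C |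
    ccomp c (Free_map (giota (projT1 A))) = projT2 A}.

(** The [n]-cell corresponding to a morphism [Free D^n -> C]. *)
Definition top_cell C n (c : cmor (Free (gdisk n)) C) : cell (gen C) n :=
  cmap c (inr (eqxx n) : gdisk n n).

Definition ctype_sub C D (f : cmor C D) (A : ctype C) : ctype D :=
  existT _ (projT1 A) (ccomp f (projT2 A)).

Definition cterm_sub C D (f : cmor C D) (A : ctype C) (c : cterm A) :
  cterm (ctype_sub f A).
Proof.
exists (ccomp f (sval c)).
by rewrite -ccompA (svalP c).
Defined.

Definition ctot C (A : ctype C) (c : cterm A) : {A : ctype C & cterm A} :=
  existT _ A c.

Lemma ctot_eq C n a a' (c : @cterm C (existT _ n a))
    (c' : @cterm C (existT _ n a')) :
  (forall k x, cmap (sval c) (n:=k) x = cmap (sval c') x) -> ctot c = ctot c'.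
Proof.
case: c c' => c + [c' +] /=; move: c c' => /= c c' ca ca' cc'.
have ecc : c = c' by apply: cmor_eq.
by subst c' a a'; congr existT.
Qed.

(** The type [*], i.e. the unique morphism [Free S^{-1} -> C]. *)
Definition cstar (C : computad) : ctype C.
Proof.
exists 0.
by exists (fun k (x : face 0 k) => match x with Face _ lt => match notF lt with end end)
  => k [].
Defined.

Lemma face_top n k : k < n.+1 -> ~ k < n -> k == n.
Proof. by rewrite ltnS leq_eqVlt => /orP[]. Qed.

Definition face_disk n k (x : face n.+1 k) : disk_cell n k :=
  let: Face b lt := x in
  match @idP (k < n) with
  | ReflectT lt' => inl (Face b lt')
  | ReflectF ge => inr (face_top lt ge)
  end.

Definition face_side n k (x : face n k) : bool := let: Face b _ := x in b.

Lemma disk_lower_face n k b (x : face n.+1 k.+1) (lt : k < n) :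
  disk_lower b (face_disk x) = inl (Face b lt).
Proof.
by case: x => c ltc /=; case: {-}_ / idP => ?; congr inl; apply: face_eq.
Qed.

Lemma face_disk_lower n k b (x : face n.+1 k.+1) (lt : k < n) :
  face_disk (face_lower b x) = inl (Face b lt).
Proof.
by case: x => c ltc /=; case: {-}_ / idP => // ?; congr inl; apply: face_eq.
Qed.

(** The sphere [(c, c') : Free S^n -> C] with lower and upper hemispheres
    [c, c' : Free D^n -> C]. *)
Definition carr (C : computad) (A : ctype C) (c c' : cterm A) : ctype C.
Proof.
exists (projT1 A).+1.
pose h b := if b then sval c' else sval c.
exists (fun k x => cmap (h (face_side x)) (face_disk x : gdisk _ k)) => k x.
  exact: cmap_cell.
have lt : k < projT1 A by case: x.
have hE b (y : face (projT1 A) k) :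
    cmap (h b) (inl y : gdisk _ k) = cmap (projT2 A) y.
  by case: b; [rewrite -(svalP c') | rewrite -(svalP c)].
rewrite cmap_bdry /bind2 /= /free_att /=.
by rewrite !(disk_lower_face _ _ lt) !(face_disk_lower _ _ lt) !hE.
Defined.

(** The pushout of [A : Free S^{n-1} -> C] along [Free S^{n-1} -> Free D^n], for
    [n = projT1 A]. *)
Section Extension.
Variables (C : computad) (A : ctype C).

Definition ext_gen (k : nat) : Type := (gen C k + is_true (k == projT1 A))%type.

Definition ext_old k (c : cell (gen C) k) : cell ext_gen k :=
  bind (fun m v => cvar (inl v : ext_gen m)) c.

Definition ext_att : attaching ext_gen := fun k v =>
  match v with
  | inl v => (ext_old (att C v).1, ext_old (att C v).2)
  | inr e => (ext_old (cmap (projT2 A) (Face false (top_lt e))),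
              ext_old (cmap (projT2 A) (Face true (top_lt e))))
  end.

Lemma bdry_ext_old k (c : cell (gen C) k.+1) :
  bdry ext_att (ext_old c) = (ext_old (bdry (att C) c).1, ext_old (bdry (att C) c).2).
Proof.
elim/(@bdry_cell _ (att C)): k / c => [//|k B a b g] /=.
by rewrite /ext_old !bind_bind.
Qed.

Lemma ext_sphere k (s : cell (gen C) k * cell (gen C) k) :
  is_sphere (att C) s -> is_sphere ext_att (ext_old s.1, ext_old s.2).
Proof.
have oldP (c : cell (gen C) k) : is_cell (att C) c -> is_cell ext_att (ext_old c).
  by apply: is_cell_bind_raw => // m d; rewrite bdry_ext_old.
case: s => a b [/= ac bc ab]; split; [exact: oldP | exact: oldP | ].
by case: k a b ab {oldP ac bc} => //= k a b ab; rewrite !bdry_ext_old ab.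
Qed.

Lemma sphere_faces k (lt : k < projT1 A) :
  is_sphere (att C) (cmap (projT2 A) (Face false lt), cmap (projT2 A) (Face true lt)).
Proof.
split; [exact: cmap_cell | exact: cmap_cell | ].
case: k lt => //= k lt.
by rewrite !cmap_bdry.
Qed.

Definition cext : computad.
Proof.
exists ext_gen ext_att => k [v|e].
  exact/ext_sphere/attP.
exact/(ext_sphere (sphere_faces (top_lt e))).
Defined.

Definition ext_proj : cmor C cext.
Proof.
exists (fun k v => cvar (inl v : ext_gen k)) => // k v.
Defined.

Definition ext_var : cterm (ctype_sub ext_proj A).
Proof.
unshelve eexists.
  exists (fun k x => match x with
    | inl y => ext_old (cmap (projT2 A) y)
    | inr e => cvar (inr e : ext_gen k)
    end).
  - move=> k [y|e] //; exact: (is_cell_bind ext_proj (cmap_cell _ _)).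
  - move=> k [y|e] //=.
    by rewrite bdry_ext_old cmap_bdry.
exact: cmor_eq.
Defined.

Lemma cext_univ D (f : cmor C D) (c : cterm (ctype_sub f A)) :
  exists! h : cmor cext D,
    ccomp h ext_proj = f /\ ctot (cterm_sub h ext_var) = ctot c.
Proof.
pose hm k (x : ext_gen k) : cell (gen D) k :=
  match x with inl v => cmap f v | inr e => cmap (sval c) (inr e : gdisk _ k) end.
have hold k (d : cell (gen C) k) : bind hm (ext_old d) = bind (cmap f) d.
  by rewrite /ext_old bind_bind.
have cface k (y : gsphere (projT1 A) k) :
    cmap (sval c) (inl y : gdisk _ k) = bind (cmap f) (cmap (projT2 A) y).
  exact: (congr1 (fun g : cmor (Free (gsphere (projT1 A))) D => cmap g y) (svalP c)).
have hcell k (x : ext_gen k) : is_cell (att D) (hm k x).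
  by case: x => ?; apply: cmap_cell.
have hbd k (x : ext_gen k.+1) :
    bdry (att D) (hm k.+1 x) = bind2 hm (ext_att x).
  case: x => [v|e] /=; rewrite cmap_bdry /bind2 /= !hold //.
  by rewrite !cface.
pose h : cmor cext D := @CMor cext D hm hcell hbd.
exists h; split.
  split; first exact: cmor_eq.
  apply: ctot_eq => k [y|e] //=.
  by rewrite hold cface.
move=> h' [pf vc]; apply: cmor_eq => k [v|e] /=.
  by rewrite -pf.
have := congr1 (fun t : {A : ctype D & cterm A} =>
  existT (fun n => cmor (Free (gdisk n)) D) (projT1 (projT1 t)) (sval (projT2 t))) vc.
rewrite /= => /(inj_pair2 _ _ _ _ _) <- //.
Qed.

End Extension.

Record cwf := CwF {
  ob : Type;
  hom : ob -> ob -> Type;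
  idm : forall Γ, hom Γ Γ;
  cmp : forall Γ Δ Θ, hom Δ Θ -> hom Γ Δ -> hom Γ Θ;
  cmp1f : forall Γ Δ (f : hom Γ Δ), cmp (idm Δ) f = f;
  cmpf1 : forall Γ Δ (f : hom Γ Δ), cmp f (idm Γ) = f;
  cmpA : forall Γ Δ Θ Ξ (h : hom Θ Ξ) (g : hom Δ Θ) (f : hom Γ Δ),
    cmp h (cmp g f) = cmp (cmp h g) f;
  emp : ob;
  emp_terminal : forall Γ, exists! f : hom Γ emp, True;
  Ty : ob -> Type;
  Tm : forall Γ, Ty Γ -> Type;
  tysub : forall Δ Γ, hom Δ Γ -> Ty Γ -> Ty Δ;
  tmsub : forall Δ Γ (γ : hom Δ Γ) (A : Ty Γ), Tm A -> Tm (tysub γ A);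
  tysub1 : forall Γ (A : Ty Γ), tysub (idm Γ) A = A;
  tysubM : forall Θ Δ Γ (γ : hom Δ Γ) (δ : hom Θ Δ) (A : Ty Γ),
    tysub (cmp γ δ) A = tysub δ (tysub γ A);
  tmsub1 : forall Γ (A : Ty Γ) (t : Tm A),
    existT (@Tm Γ) _ (tmsub (idm Γ) t) = existT (@Tm Γ) A t;
  tmsubM : forall Θ Δ Γ (γ : hom Δ Γ) (δ : hom Θ Δ) (A : Ty Γ) (t : Tm A),
    existT (@Tm Θ) _ (tmsub (cmp γ δ) t)
    = existT (@Tm Θ) _ (tmsub δ (tmsub γ t));
  ext : forall Γ, Ty Γ -> ob;
  wk : forall Γ (A : Ty Γ), hom (ext A) Γ;
  vz : forall Γ (A : Ty Γ), Tm (tysub (wk A) A);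
  ext_univ : forall Δ Γ (A : Ty Γ) (γ : hom Δ Γ) (u : Tm (tysub γ A)),
    exists! h : hom Δ (ext A),
      cmp (wk A) h = γ /\
      existT (@Tm Δ) _ (tmsub h (vz A)) = existT (@Tm Δ) _ u }.

Arguments idm {c} Γ.
Arguments emp {c}.
Arguments Tm {c Γ} A.

Definition tot (E : cwf) (Γ : ob E) (A : Ty Γ) (t : Tm A) :
  {A : Ty Γ & Tm A} := existT _ A t.

Record cwf_mor (E F : cwf) := CwFMor {
  fob :> ob E -> ob F;
  fhom : forall Δ Γ, hom Δ Γ -> hom (fob Δ) (fob Γ);
  fhom1 : forall Γ, fhom (idm Γ) = idm (fob Γ);
  fhomM : forall Θ Δ Γ (γ : hom Δ Γ) (δ : hom Θ Δ),
    fhom (cmp γ δ) = cmp (fhom γ) (fhom δ);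
  fob_emp : fob emp = emp;
  fty : forall Γ, Ty Γ -> Ty (fob Γ);
  ftm : forall Γ (A : Ty Γ), Tm A -> Tm (fty A);
  fty_nat : forall Δ Γ (γ : hom Δ Γ) (A : Ty Γ),
    fty (tysub γ A) = tysub (fhom γ) (fty A);
  ftm_nat : forall Δ Γ (γ : hom Δ Γ) (A : Ty Γ) (t : Tm A),
    tot (ftm (tmsub γ t)) = tot (tmsub (fhom γ) (ftm t));
  (* extensions, with their projections and generic terms, are preserved on
     the nose *)
  fob_ext : forall Γ (A : Ty Γ),
    existT (fun Θ : ob F => (hom Θ (fob Γ) * {B : Ty Θ & Tm B})%type)
      (fob (ext A)) (fhom (wk A), tot (ftm (vz A)))
    = existT _ (ext (fty A)) (wk (fty A), tot (vz (fty A))) }.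

Definition inverses (E : cwf) (X Y : ob E) (f : hom X Y) (g : hom Y X) : Prop :=
  cmp g f = idm X /\ cmp f g = idm Y.

Definition fully_faithful (E F : cwf) (R : cwf_mor E F) : Prop :=
  forall Δ Γ : ob E, bijective (@fhom E F R Δ Γ).

Definition in_essential_image (E F : cwf) (R : cwf_mor E F) (X : ob F) : Prop :=
  exists (Γ : ob E) (f : hom (R Γ) X) (g : hom X (R Γ)), inverses f g.

Definition CompOp : cwf.
Proof.
refine (@CwF computad (fun C D => cmor D C) cid
  (fun C D E f g => ccomp g f) _ _ _ cempty _ ctype cterm
  (fun D C f => ctype_sub f) (fun D C f A => @cterm_sub C D f A) _ _ _ _
  cext ext_proj ext_var _).
- by move=> C D f; rewrite ccompf1.
- by move=> C D f; rewrite ccomp1f.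
- by move=> C D E F h g f; rewrite ccompA.
- by move=> C; exists (cempty_elim C); split=> // f _; apply: cmor_eq => n [].
- by move=> C [n a]; rewrite /ctype_sub /= ccomp1f.
- by move=> E D C g f [n a]; rewrite /ctype_sub /= ccompA.
- by move=> C [n a] c; apply: ctot_eq => k x /=; rewrite bind_var.
- by move=> E D C g f [n a] c; apply: ctot_eq => k x /=; rewrite bind_bind.
- by move=> D C A f c; apply: cext_univ.
Defined.

(** Contexts are taken up to renaming by using De Bruijn levels: the variable
    declared by the [x]-th entry of a context (counted from [0]) is named [x],
    and the [x]-th entry of a substitution is the term associated to [x]. *)

Inductive ty : Type :=
| star
| arr (A : ty) (u v : tm)
with tm : Type :=
| var (x : nat)
| coh (Γ : ctx) (A : ty) (γ : sub)
with ctx : Type :=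
| cnil
| ccons (Γ : ctx) (A : ty)
with sub : Type :=
| snil
| scons (γ : sub) (t : tm).

Fixpoint csize (Γ : ctx) : nat := if Γ is ccons Γ _ then (csize Γ).+1 else 0.

Fixpoint ssize (γ : sub) : nat := if γ is scons γ _ then (ssize γ).+1 else 0.

Fixpoint cget (Γ : ctx) (x : nat) : option ty :=
  if Γ is ccons Γ A then (if x == csize Γ then Some A else cget Γ x) else None.

Fixpoint sget (γ : sub) (x : nat) : tm :=
  if γ is scons γ t then (if x == ssize γ then t else sget γ x) else var x.

Fixpoint ty_sub (A : ty) (γ : sub) : ty :=
  match A with
  | star => star
  | arr A u v => arr (ty_sub A γ) (tm_sub u γ) (tm_sub v γ)
  end
with tm_sub (t : tm) (δ : sub) : tm :=
  match t with
  | var x => sget δ x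
  | coh Γ A γ => coh Γ A (sub_comp γ δ)
  end
with sub_comp (γ δ : sub) : sub :=
  match γ with
  | snil => snil
  | scons γ t => scons (sub_comp γ δ) (tm_sub t δ)
  end.

Fixpoint ty_vars (A : ty) : seq nat :=
  match A with
  | star => [::]
  | arr A u v => ty_vars A ++ tm_vars u ++ tm_vars v
  end
with tm_vars (t : tm) : seq nat :=
  match t with
  | var x => [:: x]
  | coh _ _ γ => sub_vars γ
  end
with sub_vars (γ : sub) : seq nat :=
  match γ with
  | snil => [::]
  | scons γ t => sub_vars γ ++ tm_vars t
  end.

Definition ctx_vars (Γ : ctx) : seq nat := iota 0 (csize Γ).

(** [dim A + 1] *)
Fixpoint ty_height (A : ty) : nat :=
  if A is arr A _ _ then (ty_height A).+1 else 0.

(** The dimension of a nonempty context (this is [0] rather than [-1] for the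
    empty one, which does not affect the recursion). *)
Fixpoint ctx_dim (Γ : ctx) : nat :=
  if Γ is ccons Γ A then maxn (ctx_dim Γ) (ty_height A) else 0.

(** The judgement [Γ |-ps x : A].  The fresh variables [y, f] of the third rule
    are the next two levels [csize Γ] and [(csize Γ).+1].  Derivations live in
    [Type] because boundaries are computed from them. *)
Inductive ps : ctx -> nat -> ty -> Type :=
| pss : ps (ccons cnil star) 0 star
| psd Γ f x y A : ps Γ f (arr A (var x) (var y)) -> ps Γ y A
| pse Γ x A : ps Γ x A ->
    ps (ccons (ccons Γ A) (arr A (var x) (var (csize Γ))))
       (csize Γ).+1 (arr A (var x) (var (csize Γ))).

Definition pasting (Γ : ctx) : Type := {x : nat & ps Γ x star}.

(** The entries of [∂_k^ε Γ], for [ε = -] when [e = false] and [ε = +] when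
    [e = true].  The boundary keeps the variable names of [Γ], hence the names
    are recorded in the entries. *)
Fixpoint ps_bd (e : bool) (k : nat) Γ x A (d : ps Γ x A) : seq (nat * ty) :=
  match d with
  | pss => [:: (0, star)]
  | psd _ _ _ _ _ d => ps_bd e k d
  | pse Γ x A d =>
    let D := ps_bd e k d in
    let y := csize Γ in
    if k < ty_height A then D
    else if ty_height A < k then D ++ [:: (y, A); (y.+1, arr A (var x) (var y))]
    else if e then rcons (take (size D).-1 D) (y, A)
    else D
  end.

(** The entries [x |-> var x] of the substitutions [s_k^Γ] and [t_k^Γ], and
    their variables. *)
Definition bd_sub (e : bool) (k : nat) Γ (d : pasting Γ) : seq (nat * tm) :=
  [seq (p.1, var p.1) | p <- ps_bd e k (projT2 d)].

Definition bd_sub_vars (e : bool) (k : nat) Γ (d : pasting Γ) : seq nat :=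
  flatten [seq tm_vars p.2 | p <- bd_sub e k d].

Definition coh_cond Γ (d : pasting Γ) (A : ty) (u v : tm) : Prop :=
  [/\ 1 <= ctx_dim Γ,
      bd_sub_vars false (ctx_dim Γ).-1 d =i tm_vars u ++ ty_vars A &
      bd_sub_vars true (ctx_dim Γ).-1 d =i tm_vars v ++ ty_vars A] \/
  (ctx_vars Γ =i tm_vars u ++ ty_vars A /\
   ctx_vars Γ =i tm_vars v ++ ty_vars A).

Inductive ctx_ok : ctx -> Prop :=
| ok_cnil : ctx_ok cnil
| ok_ccons Γ A : ty_ok Γ A -> ctx_ok (ccons Γ A)
with ty_ok : ctx -> ty -> Prop :=
| ok_star Γ : ctx_ok Γ -> ty_ok Γ star
| ok_arr Γ A t u : ty_ok Γ A -> tm_ok Γ t A -> tm_ok Γ u A ->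
    ty_ok Γ (arr A t u)
with tm_ok : ctx -> tm -> ty -> Prop :=
| ok_var Γ x A : ctx_ok Γ -> cget Γ x = Some A -> tm_ok Γ (var x) A
| ok_coh Γ Δ (d : pasting Γ) A u v γ :
    tm_ok Γ u A -> tm_ok Γ v A -> sub_ok Δ γ Γ -> coh_cond d A u v ->
    tm_ok Δ (coh Γ (arr A u v) γ) (ty_sub (arr A u v) γ)
with sub_ok : ctx -> sub -> ctx -> Prop :=
| ok_snil Γ : ctx_ok Γ -> sub_ok Γ snil cnil
| ok_scons Δ Γ γ A t :
    sub_ok Δ γ Γ -> ctx_ok (ccons Γ A) -> tm_ok Δ t (ty_sub A γ) ->
    sub_ok Δ (scons γ t) (ccons Γ A).

Scheme ctx_ok_mind := Minimality for ctx_ok Sort Prop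
with ty_ok_mind := Minimality for ty_ok Sort Prop
with tm_ok_mind := Minimality for tm_ok Sort Prop
with sub_ok_mind := Minimality for sub_ok Sort Prop.
Combined Scheme judgement_ind
  from ctx_ok_mind, ty_ok_mind, tm_ok_mind, sub_ok_mind.

Scheme ty_mind := Induction for ty Sort Prop
with tm_mind := Induction for tm Sort Prop
with ctx_mind := Induction for ctx Sort Prop
with sub_mind := Induction for sub Sort Prop.
Combined Scheme syntax_ind from ty_mind, tm_mind, ctx_mind, sub_mind.

Lemma ty_ok_ctx Γ A : ty_ok Γ A -> ctx_ok Γ.
Proof. by elim. Qed.

Lemma sub_ok_ctx Δ γ Γ : sub_ok Δ γ Γ -> ctx_ok Δ /\ ctx_ok Γ.
Proof. by elim=> [*|? ? ? ? ? ? [? _] *]; split=> //; constructor. Qed.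

Lemma cget_lt Γ x A : cget Γ x = Some A -> x < csize Γ.
Proof.
elim: Γ => //= Γ IH B; case: eqP => [-> //|_ /IH]; exact: ltnW.
Qed.

Lemma vars_sub (p : pred nat) γ : all p (sub_vars γ) ->
  (forall A, all (fun y => y < ssize γ) (ty_vars A) ->
     all p (ty_vars (ty_sub A γ))) /\
  (forall t, all (fun y => y < ssize γ) (tm_vars t) ->
     all p (tm_vars (tm_sub t γ))) /\
  (forall Γ : ctx, True) /\
  (forall σ, all (fun y => y < ssize γ) (sub_vars σ) ->
     all p (sub_vars (sub_comp σ γ))).
Proof.
move=> pg; apply: syntax_ind => //=.
- move=> A IA u Iu v Iv; rewrite !all_cat => /and3P[? ? ?].
  by rewrite IA ?Iu ?Iv.
- move=> x; rewrite andbT.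
  elim: γ pg => //= γ IH t; rewrite all_cat ltnS leq_eqVlt => /andP[pg pt].
  by case: eqP => //= _; apply: IH.
- by move=> σ IH t It; rewrite !all_cat => /andP[? ?]; rewrite IH ?It.
Qed.

Lemma ok_vars :
  (forall Γ, ctx_ok Γ -> forall x A, cget Γ x = Some A ->
     all (fun y => y < x) (ty_vars A)) /\
  (forall Γ A, ty_ok Γ A -> all (fun y => y < csize Γ) (ty_vars A)) /\
  (forall Γ t A, tm_ok Γ t A ->
     all (fun y => y < csize Γ) (tm_vars t) /\
     all (fun y => y < csize Γ) (ty_vars A)) /\
  (forall Δ γ Γ, sub_ok Δ γ Γ ->
     all (fun y => y < csize Δ) (sub_vars γ) /\ ssize γ = csize Γ).
Proof.
pose P Γ := forall x B, cget Γ x = Some B -> all (fun y => y < x) (ty_vars B).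
have H :
  (forall Γ, ctx_ok Γ -> P Γ) /\
  (forall Γ A, ty_ok Γ A ->
     P Γ /\ all (fun y => y < csize Γ) (ty_vars A)) /\
  (forall Γ t A, tm_ok Γ t A ->
     all (fun y => y < csize Γ) (tm_vars t) /\
     all (fun y => y < csize Γ) (ty_vars A)) /\
  (forall Δ γ Γ, sub_ok Δ γ Γ ->
     all (fun y => y < csize Δ) (sub_vars γ) /\ ssize γ = csize Γ).
  apply: judgement_ind => //=.
  - move=> Γ A _ [IH vA] x B /=; case: eqP => [-> [<-] //|_]; exact: IH.
  - by move=> Γ A t u _ [IH vA] _ [vt _] _ [vu _]; rewrite !all_cat vA vt vu.
  - move=> Γ x A _ H gx; have lt := cget_lt gx; rewrite lt; split=> //.
    by apply: sub_all (H _ _ gx) => y /ltn_trans; apply.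
  - move=> Γ Δ _ A u v γ _ [vu vA] _ [vv _] _ [vg sg] _; split=> //.
    apply: (vars_sub vg).1 (arr A u v) _.
    by rewrite sg /= !all_cat vA vu vv.
  - by move=> Δ Γ γ A t _ [vg ->] _ _ _ [vt _]; rewrite all_cat vg vt.
by case: H => H1 [H2 H34]; split=> //; split=> // Γ A /H2[].
Qed.

Lemma sget_comp γ δ x : x < ssize γ -> sget (sub_comp γ δ) x = tm_sub (sget γ x) δ.
Proof.
have size_comp g : ssize (sub_comp g δ) = ssize g.
  by elim: g => //= g ->.
elim: γ => //= γ IH t; rewrite size_comp ltnS leq_eqVlt.
by case: eqP => //= _ /IH.
Qed.

Lemma sub_compA γ δ :
  (forall A, all (fun y => y < ssize γ) (ty_vars A) ->
     ty_sub A (sub_comp γ δ) = ty_sub (ty_sub A γ) δ) /\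
  (forall t, all (fun y => y < ssize γ) (tm_vars t) ->
     tm_sub t (sub_comp γ δ) = tm_sub (tm_sub t γ) δ) /\
  (forall Γ : ctx, True) /\
  (forall σ, all (fun y => y < ssize γ) (sub_vars σ) ->
     sub_comp σ (sub_comp γ δ) = sub_comp (sub_comp σ γ) δ).
Proof.
apply: syntax_ind => //=.
- by move=> A IA u Iu v Iv; rewrite !all_cat => /and3P[/IA-> /Iu-> /Iv->].
- by move=> x; rewrite andbT => /sget_comp->.
- by move=> Γ _ A _ σ IH /IH->.
- by move=> σ IH t It; rewrite all_cat => /andP[/IH-> /It->].
Qed.

Lemma sub_wk γ s :
  (forall A, all (fun y => y < ssize γ) (ty_vars A) ->
     ty_sub A (scons γ s) = ty_sub A γ) /\
  (forall t, all (fun y => y < ssize γ) (tm_vars t) ->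
     tm_sub t (scons γ s) = tm_sub t γ) /\
  (forall Γ : ctx, True) /\
  (forall σ, all (fun y => y < ssize γ) (sub_vars σ) ->
     sub_comp σ (scons γ s) = sub_comp σ γ).
Proof.
apply: syntax_ind => //=.
- by move=> A IA u Iu v Iv; rewrite !all_cat => /and3P[/IA-> /Iu-> /Iv->].
- by move=> x; rewrite andbT => /ltn_eqF->.
- by move=> Γ _ A _ σ IH /IH->.
- by move=> σ IH t It; rewrite all_cat => /andP[/IH-> /It->].
Qed.

Fixpoint sid (Γ : ctx) : sub :=
  if Γ is ccons Γ _ then scons (sid Γ) (var (csize Γ)) else snil.

Lemma size_sid Γ : ssize (sid Γ) = csize Γ.
Proof. by elim: Γ => //= Γ ->. Qed.

Lemma sget_sid Γ x : sget (sid Γ) x = var x.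
Proof. by elim: Γ => //= Γ IH _; rewrite size_sid; case: eqP => [->|]. Qed.

Lemma sub_sid Γ :
  (forall A, ty_sub A (sid Γ) = A) /\
  (forall t, tm_sub t (sid Γ) = t) /\
  (forall Γ : ctx, True) /\
  (forall σ, sub_comp σ (sid Γ) = σ).
Proof.
apply: syntax_ind => //=.
- by move=> A -> u -> v ->.
- by move=> x; rewrite sget_sid.
- by move=> ? _ A _ σ ->.
- by move=> σ -> t ->.
Qed.

Lemma weaken B :
  (forall Γ, ctx_ok Γ -> True) /\
  (forall Γ A, ty_ok Γ A -> ctx_ok (ccons Γ B) -> ty_ok (ccons Γ B) A) /\
  (forall Γ t A, tm_ok Γ t A -> ctx_ok (ccons Γ B) -> tm_ok (ccons Γ B) t A) /\
  (forall Δ γ Γ, sub_ok Δ γ Γ -> ctx_ok (ccons Δ B) -> sub_ok (ccons Δ B) γ Γ).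
Proof.
apply: judgement_ind => //.
- by constructor.
- by constructor; auto.
- move=> Γ x A _ _ gx okB; constructor=> //=.
  by rewrite (ltn_eqF (cget_lt gx)).
- by move=> Γ Δ d A u v γ ? _ ? _ _ IH c okB; apply: (ok_coh (d := d)); auto.
- by constructor.
- by constructor; auto.
Qed.

Lemma sub_ok_sid Γ : ctx_ok Γ -> sub_ok Γ (sid Γ) Γ.
Proof.
elim: Γ => [|Γ IH A] ok /=; first by constructor.
have okA : ty_ok Γ A by inversion ok.
constructor=> //; first by apply: (weaken A).2.2.2 => //; apply/IH/ty_ok_ctx/okA.
by rewrite (sub_sid Γ).1; constructor=> //=; rewrite eqxx.
Qed.

Lemma sub_ok_wk Γ A : ctx_ok (ccons Γ A) -> sub_ok (ccons Γ A) (sid Γ) Γ.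
Proof. by move/sub_ok_sid => s; inversion s. Qed.

Lemma tm_ok_sget Δ γ Γ x A : sub_ok Δ γ Γ -> cget Γ x = Some A ->
  tm_ok Δ (sget γ x) (ty_sub A γ).
Proof.
elim=> {Δ γ Γ} // Δ Γ γ B t gok IH okB tok /= gx.
have [_ size_g] := ok_vars.2.2.2 _ _ _ gok.
rewrite size_g; case: eqP gx => [_ [<-]|_ gx].
  rewrite (sub_wk γ t).1 // size_g; apply: ok_vars.2.1.
  by inversion okB.
rewrite (sub_wk γ t).1; first exact: IH.
have okG : ctx_ok Γ by case: (sub_ok_ctx gok).
have := ok_vars.1 _ okG _ _ gx; rewrite size_g => /allP H.
by apply/allP => y /H yx; apply: ltn_trans yx (cget_lt gx).
Qed.

Lemma sub_typed :
  (forall Γ, ctx_ok Γ -> True) /\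
  (forall Γ A, ty_ok Γ A -> forall Δ γ, sub_ok Δ γ Γ ->
     ty_ok Δ (ty_sub A γ)) /\
  (forall Γ t A, tm_ok Γ t A -> forall Δ γ, sub_ok Δ γ Γ ->
     tm_ok Δ (tm_sub t γ) (ty_sub A γ)) /\
  (forall Γ θ Θ, sub_ok Γ θ Θ -> forall Δ γ, sub_ok Δ γ Γ ->
     sub_ok Δ (sub_comp θ γ) Θ).
Proof.
apply: judgement_ind => //=.
- by move=> Γ _ _ Δ γ /sub_ok_ctx[? _]; constructor.
- by move=> Γ A t u _ IA _ It _ Iu Δ γ gok; constructor; auto.
- by move=> Γ x A _ _ gx Δ γ gok; apply: tm_ok_sget gx.
- move=> Θ Γ d A u v θ uok _ vok _ tok IH cond Δ γ gok.
  have [_ size_t] := ok_vars.2.2.2 _ _ _ tok.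
  have := ok_coh uok vok (IH _ _ gok) cond.
  have [vu vA] := ok_vars.2.2.1 _ _ _ uok.
  have [vv _] := ok_vars.2.2.1 _ _ _ vok.
  have := (sub_compA θ γ).1 (arr A u v); rewrite size_t => /= <- //.
  by rewrite !all_cat vA vu vv.
- by move=> Γ _ _ Δ γ /sub_ok_ctx[? _]; constructor.
- move=> Γ Θ θ A t tok IH okA _ ttok It Δ γ gok; constructor; auto.
  rewrite (sub_compA θ γ).1; first exact: It.
  have [_ ->] := ok_vars.2.2.2 _ _ _ tok.
  by apply: ok_vars.2.1; inversion okA.
Qed.

Lemma ok_vz Γ A : ty_ok Γ A ->
  tm_ok (ccons Γ A) (var (csize Γ)) (ty_sub A (sid Γ)).
Proof.
move=> okA; rewrite (sub_sid Γ).1.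
by apply: ok_var; [constructor | rewrite /= eqxx].
Qed.

Lemma sid_vars Γ : all (fun y => y < csize Γ) (sub_vars (sid Γ)).
Proof.
elim: Γ => //= Γ IH _; rewrite all_cat /= ltnSn !andbT.
by apply: sub_all IH => y /leq_trans; apply.
Qed.

Lemma sid_comp_scons Γ γ t : ssize γ = csize Γ ->
  sub_comp (sid Γ) (scons γ t) = sub_comp (sid Γ) γ.
Proof. by move=> sg; apply: (sub_wk γ t).2.2.2; rewrite sg sid_vars. Qed.

Lemma sid_comp Δ γ Γ : sub_ok Δ γ Γ -> sub_comp (sid Γ) γ = γ.
Proof.
elim=> //= {}Δ {}Γ {}γ A t gok IH _ _.
have [_ sg] := ok_vars.2.2.2 _ _ _ gok.
by rewrite sid_comp_scons // IH sg eqxx.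
Qed.

Lemma sig_eq (T : Type) (P : T -> Prop) (x y : sig P) :
  sval x = sval y -> x = y.
Proof. by apply: eq_sig_hprop => *; apply: proof_irrelevance. Qed.

Lemma tm_tot_eq Γ (A A' : {A : ty | ty_ok Γ A})
    (t : {t : tm | tm_ok Γ t (sval A)}) (t' : {t : tm | tm_ok Γ t (sval A')}) :
  sval A = sval A' -> sval t = sval t' ->
  existT (fun A : {A : ty | ty_ok Γ A} => {t : tm | tm_ok Γ t (sval A)}) A t
  = existT _ A' t'.
Proof. by move=> /sig_eq eA; subst A' => /sig_eq ->. Qed.

Definition SCaTT : cwf.
Proof.
refine (@CwF {Γ : ctx | ctx_ok Γ}
  (fun Δ Γ => {γ : sub | sub_ok (sval Δ) γ (sval Γ)})
  (fun Γ => exist _ (sid (sval Γ)) (sub_ok_sid (svalP Γ)))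
  (fun Δ Γ Θ θ γ => exist _ (sub_comp (sval θ) (sval γ))
     (sub_typed.2.2.2 _ _ _ (svalP θ) _ _ (svalP γ)))
  _ _ _
  (exist _ cnil ok_cnil) _
  (fun Γ => {A : ty | ty_ok (sval Γ) A})
  (fun Γ A => {t : tm | tm_ok (sval Γ) t (sval A)})
  (fun Δ Γ γ A => exist _ (ty_sub (sval A) (sval γ))
     (sub_typed.2.1 _ _ (svalP A) _ _ (svalP γ)))
  (fun Δ Γ γ A t => exist _ (tm_sub (sval t) (sval γ))
     (sub_typed.2.2.1 _ _ _ (svalP t) _ _ (svalP γ)))
  _ _ _ _
  (fun Γ A => exist _ (ccons (sval Γ) (sval A)) (ok_ccons (svalP A)))
  (fun Γ A => exist _ (sid (sval Γ)) (sub_ok_wk (ok_ccons (svalP A))))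
  (fun Γ A => exist _ (var (csize (sval Γ))) (ok_vz (svalP A))) _).
- by move=> Γ Δ [γ g]; apply: sig_eq; apply: sid_comp g.
- by move=> Γ Δ [γ g]; apply: sig_eq; apply: (sub_sid _).2.2.2.
- move=> Γ Δ Θ Ξ [h hh] [g gg] [f ff]; apply: sig_eq => /=.
  apply: (sub_compA _ _).2.2.2.
  rewrite (ok_vars.2.2.2 _ _ _ gg).2; exact: (ok_vars.2.2.2 _ _ _ hh).1.
- move=> Γ; exists (exist _ snil (ok_snil (svalP Γ))); split=> // -[γ g] _.
  by apply: sig_eq; inversion g.
- by move=> Γ A; apply: sig_eq; apply: (sub_sid _).1.
- move=> Θ Δ Γ [γ g] δ [A a]; apply: sig_eq; apply: (sub_compA _ _).1.
  by rewrite (ok_vars.2.2.2 _ _ _ g).2; apply: ok_vars.2.1.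
- by move=> Γ A t; apply: tm_tot_eq; [apply: (sub_sid _).1 | apply: (sub_sid _).2.1].
- move=> Θ Δ Γ [γ g] δ [A a] [t tA]; have sg := (ok_vars.2.2.2 _ _ _ g).2.
  have [vt vA] := ok_vars.2.2.1 _ _ _ tA.
  by apply: tm_tot_eq; [apply: (sub_compA _ _).1 | apply: (sub_compA _ _).2.1];
     rewrite sg.
- move=> Δ Γ A [γ g] [u uA]; have sg := (ok_vars.2.2.2 _ _ _ g).2.
  exists (exist _ (scons γ u) (ok_scons g (ok_ccons (svalP A)) uA)); split.
    have wkE : sub_comp (sid (sval Γ)) (scons γ u) = γ.
      by rewrite sid_comp_scons ?(sid_comp g).
    split; first exact: sig_eq.
    apply: tm_tot_eq => /=; last by rewrite sg eqxx.
    by rewrite -[in RHS]wkE (sub_compA _ _).1 // size_sid; apply: ok_vars.2.1 (svalP A).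
  move=> [h hh] [/(congr1 sval) /= hp hv]; apply: sig_eq => /=.
  inversion hh as [|? ? γ' ? t' g' _ _]; subst.
  have [_ sg'] := ok_vars.2.2.2 _ _ _ g'.
  rewrite sid_comp_scons // (sid_comp g').
  have /= := congr1 (fun p => sval (projT2 p)) hv.
  by rewrite sg' eqxx => ->.
Defined.

Definition has_dim (Γ : ctx) (n x : nat) : bool :=
  if cget Γ x is Some A then ty_height A == n else false.

Definition tm_var (t : tm) : nat := if t is var x then x else 0.

(** The source and target of a variable [x] of type [u -> v], for variables
    [u] and [v]. *)
Definition var_src (Γ : ctx) (x : nat) : nat :=
  if cget Γ x is Some (arr _ u _) then tm_var u else 0.

Definition var_tgt (Γ : ctx) (x : nat) : nat :=
  if cget Γ x is Some (arr _ _ v) then tm_var v else 0.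

Definition globular_ctx (Γ : ctx) : Prop :=
  forall x A u v, cget Γ x = Some (arr A u v) ->
  exists i j, [/\ u = var i, v = var j, cget Γ i = Some A & cget Γ j = Some A].

Lemma ps_globular Γ x A : ps Γ x A -> cget Γ x = Some A /\ globular_ctx Γ.
Proof.
elim=> {Γ x A} [|Γ f x y A _ [fE gG]|Γ x A _ [xE gG]].
- by split=> // x A u v /=; case: eqP.
- by split=> //; have [i [j [_ [<-] _ ]]] := gG _ _ _ _ fE.
have wkE i B : cget Γ i = Some B -> forall C,
    cget (ccons (ccons Γ A) C) i = Some B.
  by move=> iE C /=; rewrite !ltn_eqF ?ltnS ?(cget_lt iE) // ltnW ?(cget_lt iE).
split=> /=; first by rewrite eqxx.
move=> z B u v /=; case: eqP => [_ [<- <- <-]|_].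
  exists x, (csize Γ); split=> //; first exact: wkE.
  by rewrite eqxx ltn_eqF.
case: eqP => [_ [eA]|_ zE].
  rewrite eA in xE; have [i [j [? ? ? ?]]] := gG _ _ _ _ xE.
  by exists i, j; split=> //; apply: wkE.
have [i [j [? ? ? ?]]] := gG _ _ _ _ zE.
by exists i, j; split=> //; apply: wkE.
Qed.

Section PastingGlobularSet.
Variables (Γ : ctx) (d : pasting Γ).

Lemma ps_var_bd n x : has_dim Γ n.+1 x ->
  exists A i j, [/\ cget Γ x = Some (arr A (var i) (var j)),
    cget Γ i = Some A, cget Γ j = Some A & ty_height A == n].
Proof.
rewrite /has_dim; case xE: (cget Γ x) => [[|A u v]|] //= h.
have [_ gG] := ps_globular (projT2 d).
have [i [j [-> -> iA jA]]] := gG _ _ _ _ xE.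
by exists A, i, j.
Qed.

Lemma has_dim_src n x : has_dim Γ n.+1 x -> has_dim Γ n (var_src Γ x).
Proof.
by move/ps_var_bd => [A [i [j [xE iA jA h]]]]; rewrite /has_dim /var_src xE /= iA.
Qed.

Lemma has_dim_tgt n x : has_dim Γ n.+1 x -> has_dim Γ n (var_tgt Γ x).
Proof.
by move/ps_var_bd => [A [i [j [xE iA jA h]]]]; rewrite /has_dim /var_tgt xE /= jA.
Qed.

(** The globular set [V Γ] of the variables of [Γ] *)
Definition ps_gset : gset.
Proof.
refine (@GSet (fun n => {x : nat | has_dim Γ n x})
  (fun n x => exist _ (var_src Γ (sval x)) (has_dim_src (svalP x)))
  (fun n x => exist _ (var_tgt Γ (sval x)) (has_dim_tgt (svalP x))) _ _).
- move=> n [x hx]; apply: sig_eq => /=.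
  have [A [i [j [xE iA jA _]]]] := ps_var_bd hx.
  by rewrite /var_src /var_tgt xE /= iA jA.
- move=> n [x hx]; apply: sig_eq => /=.
  have [A [i [j [xE iA jA _]]]] := ps_var_bd hx.
  by rewrite /var_src /var_tgt xE /= iA jA.
Defined.

End PastingGlobularSet.

(** The clauses of the recursion for contexts, substitutions and variables hold
    for every morphism of categories with families, as it preserves the empty
    context and the extensions on the nose; [is_R] consists of the remaining
    clauses. *)

Definition cterm_cell C (A : ctype C) (c : cterm A) :
    {n : nat & cell (gen C) n} :=
  existT _ (projT1 A) (top_cell (sval c)).

(** [k : Free (V Θ) -> R Θ] sends each variable [x] to the cell [R x]; it is
    the identification [R Θ = Free (V Θ)] of a pasting context [Θ].  The tree
    [B] and the isomorphism [r] are [B_Θ] and [R^Bat_Θ], which are unique. *)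
Definition R_coh_clause (R : cwf_mor SCaTT CompOp) (Δ Θ : ob SCaTT)
    (d : pasting (sval Θ)) (A : Ty Θ) (u v : Tm A) (γ : hom Δ Θ)
    (T : Ty Δ) (t : Tm T) : Prop :=
  exists (k : cmor (Free (ps_gset d)) (R Θ)) (k' : cmor (R Θ) (Free (ps_gset d)))
         (B : bat) (r : gmor (ps_gset d) (Pos B)) (r' : gmor (Pos B) (ps_gset d)),
  [/\ ccomp k' k = cid _ /\ ccomp k k' = cid _,
      forall n (x : ps_gset d n) (X : Ty Θ) (y : Tm X), sval y = var (sval x) ->
        cterm_cell (ftm R y) = existT _ n (cmap k x),
      ginverse r r' &
      let f := ccomp (Free_map r) k' in
      let g := ccomp (fhom R γ) (ccomp k (Free_map r')) in
      cterm_cell (ftm R t) =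
        existT _ _ (ccoh (B := B) (bind (cmap f) (top_cell (sval (ftm R u))))
                                  (bind (cmap f) (top_cell (sval (ftm R v))))
                                  (cmap g))].

Record is_R (R : cwf_mor SCaTT CompOp) : Prop := {
  R_star : forall (Γ : ob SCaTT) (T : Ty Γ), sval T = star ->
    fty R T = cstar (R Γ);
  R_arr : forall (Γ : ob SCaTT) (A : Ty Γ) (u v : Tm A) (T : Ty Γ),
    sval T = arr (sval A) (sval u) (sval v) ->
    fty R T = carr (ftm R u) (ftm R v);
  R_coh : forall (Δ Θ : ob SCaTT) (d : pasting (sval Θ)) (A : Ty Θ)
      (u v : Tm A) (γ : hom Δ Θ) (T : Ty Δ) (t : Tm T),
    sval t = coh (sval Θ) (arr (sval A) (sval u) (sval v)) (sval γ) ->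
    R_coh_clause R d u v γ t }.

(* Main.v *)
(** [R] is inverted by an explicit decoding.  Every cell over generators named by
    variables is read back as a term: [var v] becomes the name of [v], and
    [coh (B, A, f)] becomes the coherence over the pasting context whose variables
    are the positions of [B] in their order of declaration.  This decoding is
    total on raw cells and injective, because a pasting context determines its
    tree and trees have no nontrivial automorphisms.  It sends cells to valid
    terms and reaches every valid term, as soon as the side condition of the
    rule (coh) is known to be equivalent to fullness together with the bound on
    the dimension of [B].

    For that equivalence, observe that the elements of [Pos B] parallel to a given
    one form a chain, consecutive members being the source and target of a
    position one dimension up.  The [n]-dimensional source of [B] consists, in
    dimension [n], of the starts of the chains and its target of their ends.  The
    support of a cell contains at most one element of each chain, while every
    start of a chain which occurs anywhere in a cell or its type lies in the
    support of an iterated source; so if all variables occur, these supports are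
    exactly the starts of the chains.

    Any morphism satisfying the clauses of [R] is then a section of the decoding,
    by induction on derivations, hence bijective on types, terms and morphisms;
    conversely the clauses are satisfied by choosing preimages under the
    decoding. *)

Require Import Defs.
From mathcomp Require Import all_boot zify.
From Stdlib Require Import ProofIrrelevance ClassicalEpsilon.

Set Implicit Arguments.
Unset Strict Implicit.
Unset Printing Implicit Defensive.

(** * Chains of positions *)

(** Since [bat] is nested in [seq], trees are decomposed here as a first branch [B] and a remaining
    tree [br l], which matches the recursion of [Pos] through [susp_wedge]. *)
Fixpoint bat_cons_rect (P : bat -> Type) (Pnil : P (br [::]))
    (Pcons : forall B l, P B -> P (br l) -> P (br (B :: l))) (B : bat) : P B :=
  let: br l := B in
  (fix go l : P (br l) :=
     match l with
     | [::] => Pnil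
     | B :: l => Pcons B l (bat_cons_rect Pnil Pcons B) (go l)
     end) l.

Definition gbd (e : bool) (X : gset) n (x : X n.+1) : X n :=
  if e then gtgt x else gsrc x.
Arguments gbd e [X n] x.

Definition gpar (X : gset) n : X n -> X n -> Prop :=
  match n with
  | 0 => fun _ _ => True
  | m.+1 => fun x y => gsrc x = gsrc y /\ gtgt x = gtgt y
  end.

Lemma gpar_refl (X : gset) n (x : X n) : gpar x x.
Proof. by case: n x. Qed.

Lemma gpar_sym (X : gset) n (x y : X n) : gpar x y -> gpar y x.
Proof. by case: n x y => //= n x y []. Qed.

Lemma gpar_trans (X : gset) n (y x z : X n) : gpar x y -> gpar y z -> gpar x z.
Proof. by case: n x y z => //= n x y z [-> ->]. Qed.

Lemma gpar_bd (X : gset) n (x : X n.+1) e e' : gpar (gbd e x) (gbd e' x).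
Proof.
case: n x => //= n x; split.
  by case: e; case: e'; rewrite /= ?gsrcK.
by case: e; case: e'; rewrite /= ?gtgtK.
Qed.

(** The points of the wedge form the chain of the points of [Y] preceded by [None], which is
    therefore one step further from the end than the first basepoint of [Y]. In higher dimensions
    the two summands share no chain. *)
Definition sw_rank e (X : gset) (Y : bgset)
    (rX : forall n, X n -> nat) (rY : forall n, Y n -> nat) n :
  susp_wedge X Y n -> nat :=
  match n with
  | 0 => fun c => match c with
      | Some y => if e then rY 0 y else (rY 0 y).+1
      | None => if e then (rY 0 (base Y false)).+1 else 0
      end
  | m.+1 => fun c => match c with inl x => rX m x | inr y => rY m.+1 y end
  end.

(** The elements parallel to a position form a chain, consecutive ones being
    the source and target of a position one dimension up; [rank false] is the
    distance to the start of that chain and [rank true] the distance to its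
    end. *)
Definition rank e (B : bat) : forall n, Pos B n -> nat :=
  @bat_cons_rect (fun B => forall n, Pos B n -> nat) (fun _ _ => 0)
    (fun B l rX rY => @sw_rank e (Pos B) (Pos (br l)) rX rY) B.
Arguments rank e [B n] p : simpl never.
Arguments Pos B : simpl never.

Lemma rank_cons e B l n (p : Pos (br (B :: l)) n) :
  rank e p = @sw_rank e (Pos B) (Pos (br l)) (@rank e B) (@rank e (br l)) n p.
Proof. by []. Qed.

Lemma rank_base e B : rank e (base (Pos B) e) = 0.
Proof. by case: e; elim/bat_cons_rect: B => // B l _ r; rewrite rank_cons /= ?r. Qed.

Lemma rank_bd e B n (x : Pos B n.+1) :
  rank e (gbd (~~ e) x) = (rank e (gbd e x)).+1.
Proof.
elim/bat_cons_rect: B n x => [|B l IB Il] n; first by case: n.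
have b0 := rank_base false (br l).
case: n => [|n] [x|y]; rewrite !rank_cons /=.
- by case: e {IB Il} => //=; rewrite b0.
- by move: (Il 0 y); case: e {IB Il} => //= ->.
- by move: (IB n x); case: e {IB Il} => //= ->.
- by move: (Il n.+1 y); case: e {IB Il} => //= ->.
Qed.

Lemma sw_par_inl B l n (x y : Pos B n) :
  @gpar (Pos (br (B :: l))) n.+1 (inl x) (inl y) -> gpar x y.
Proof. by case: n x y => //= n x y [[->] [->]]. Qed.

Lemma sw_par_inr B l n (x y : Pos (br l) n.+1) :
  @gpar (Pos (br (B :: l))) n.+1 (inr x) (inr y) -> gpar x y.
Proof. by case: n x y => [|n] x y [[sxy] [txy]] /=. Qed.

Lemma sw_par_lr B l n (x : Pos B n) (y : Pos (br l) n.+1) :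
  ~ @gpar (Pos (br (B :: l))) n.+1 (inl x) (inr y).
Proof. by case: n x y => [|n] x y []. Qed.

(** Both sums are the length of the common chain. This exchanges statements about starts with
    statements about ends. *)
Lemma rank_sum B n (p q : Pos B n) : gpar p q ->
  rank false p + rank true p = rank false q + rank true q.
Proof.
elim/bat_cons_rect: B n p q => [|B l IB Il] n p q; first by case: n p q.
rewrite !rank_cons; case: n p q => [|n] p q.
  have b0 := rank_base false (br l).
  have H (y : Pos (br l) 0) : rank false y + rank true y
      = rank true (base (Pos (br l)) false).
    by rewrite (Il 0 y (base (Pos (br l)) false) I) b0.
  by case: p => [p|]; case: q => [q|] _ //=; rewrite ?addSn ?H ?add0n.
case: p => p; case: q => q pq /=.
- exact/IB/(sw_par_inl pq).
- by case: (sw_par_lr pq).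
- by case: (sw_par_lr (gpar_sym pq)).
- exact/Il/(sw_par_inr pq).
Qed.

Lemma rank_inj_src B n (p q : Pos B n) : gpar p q ->
  rank false p = rank false q -> p = q.
Proof.
elim/bat_cons_rect: B n p q => [|B l IB Il] n p q.
  by case: n p q => [[] []|].
rewrite !rank_cons; case: n p q => [|n] p q.
  by case: p => [p|]; case: q => [q|] //= _ [] /Il ->.
case: p => p; case: q => q pq /= e.
- by rewrite (IB _ _ _ (sw_par_inl pq) e).
- by case: (sw_par_lr pq).
- by case: (sw_par_lr (gpar_sym pq)).
- by rewrite (Il _ _ _ (sw_par_inr pq) e).
Qed.

Lemma rank_inj e B n (p q : Pos B n) : gpar p q -> rank e p = rank e q -> p = q.
Proof.
move=> pq; have := rank_sum pq; case: e => s r; apply: rank_inj_src => //; lia.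
Qed.

Lemma rank_gt0 e B n (p : Pos B n) : 0 < rank e p ->
  exists x : Pos B n.+1, gbd (~~ e) x = p.
Proof.
elim/bat_cons_rect: B n p => [|B l IB Il] n p //; rewrite rank_cons.
case: n p => [|n]; [case=> [y|] r | case=> [y|y] r].
- have [y0|/Il[x xy]] := posnP (@rank e (br l) 0 y).
    case: e {IB Il} r y0 => /= [r y0|_ y0]; first by rewrite y0 in r.
    (* Here [e] is [false] and [y] is the first basepoint of the remaining wedge, hence the target
       of every 1-cell of the suspension; the basepoint of [Pos B] provides one. *)
    exists (inl (base (Pos B) false)).
    have -> // : y = base (Pos (br l)) false.
    by apply: (@rank_inj_src (br l) 0) => //; rewrite rank_base.
  by exists (inr x); case: e {IB Il r} xy => /= ->.
- by case: e {IB Il} r => //= _; exists (inl (base (Pos B) false)).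
- have [z zy] := IB _ _ r; exists (inl z).
  by case: e {IB Il r} zy => /= ->.
- have [z zy] := Il _ _ r; exists (inr z).
  by case: e {IB Il r} zy => /= ->.
Qed.

(** As the two ranks have a constant sum along the chain, [rank (~~ e) p] is positive. *)
Lemma rank_lt e B n (p q : Pos B n) : gpar p q -> rank e p < rank e q ->
  exists x : Pos B n.+1, gbd e x = p.
Proof.
move=> pq lt; have [|x] := @rank_gt0 (~~ e) B n p; last by rewrite negbK; exists x.
have := rank_sum pq; case: e lt => /=; lia.
Qed.

Lemma rank_min e B n (p : Pos B n) : exists2 q, gpar q p & rank e q = 0.
Proof.
move: {2}(rank e p) (leqnn (rank e p)) => m; elim: m p => [|m IH] p.
  by rewrite leqn0 => /eqP; exists p => //; apply: gpar_refl.
move=> le; have [r0|/rank_gt0[x xp]] := posnP (rank e p).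
  by exists p => //; apply: gpar_refl.
have [|q qx q0] := IH (gbd e x); first by move: le; rewrite -xp rank_bd.
by exists q => //; rewrite -xp; apply: gpar_trans qx (gpar_bd _ _ _).
Qed.

(** This converts the support conditions in [full], phrased with the inclusions of boundaries, into
    conditions on ranks. *)
Lemma bat_incl_top e k B (p : Pos B k) :
  (exists q, bat_incl e (k := k) (B := B) q = p) <-> rank e p = 0.
Proof.
elim: k B p => [|k IH] B p.
  split=> [[q <-]|r]; first exact: rank_base.
  by exists tt; apply: (@rank_inj e) => //; rewrite rank_base.
elim/bat_cons_rect: B p => [|B l _ Il] //= [x|y].
  rewrite -(IH B x); split=> [[[q|q] //= [<-]]|[q <-]]; first by exists q.
  by exists (inl q).
rewrite -(Il y); split=> [[[q|q] //= [<-]]|[q <-]]; first by exists q.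
by exists (inr q).
Qed.

Lemma pos_dim B n (p : Pos B n) : n <= bat_dim B.
Proof.
elim/bat_cons_rect: B n p => [|B l IB Il] [|n] //=.
by rewrite leq_max ltnS => -[/IB -> //|/Il /= ->]; rewrite orbT.
Qed.

Lemma pos_ex B : inhabited (Pos B (bat_dim B)).
Proof.
elim/bat_cons_rect: B => [|B l [p] [q]] /=; first by constructor; exact: tt.
rewrite -/(bat_dim (br l)); case: leqP => _; last by constructor; exact: (inl p).
move: (bat_dim (br l)) q => [|n] q; constructor; first exact: (Some q).
exact: (inr q).
Qed.

(** * Pasting contexts as trees *)

Definition posn (B : bat) : Type := {n : nat & Pos B n}.

Definition posn_inl B l (p : posn B) : posn (br (B :: l)) :=
  existT _ (projT1 p).+1 (inl (projT2 p)).

Definition sw_inr B l n : Pos (br l) n -> Pos (br (B :: l)) n :=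
  match n with 0 => fun y => Some y | m.+1 => fun y => inr y end.
Arguments sw_inr B [l n] p.

Definition posn_inr B l (p : posn (br l)) : posn (br (B :: l)) :=
  existT _ (projT1 p) (sw_inr B (projT2 p)).

Definition pos_base B : posn B := existT _ 0 (base (Pos B) false).

(** The positions other than the first basepoint, in the order in which the
    variables of the corresponding pasting context are declared. *)
Definition pos_tail : forall B, seq (posn B) :=
  @bat_cons_rect (fun B => seq (posn B)) [::] (fun B l sB sl =>
    posn_inr B (pos_base (br l)) :: posn_inl l (pos_base B) ::
      [seq posn_inl l p | p <- sB] ++ [seq posn_inr B p | p <- sl]).

Definition pos_list B : seq (posn B) := pos_base B :: pos_tail B.

(** The numbering follows rule (pse): [off] is the new point, the first basepoint of [Y]; [off.+1]
    is the arrow towards it, the first basepoint of [X]; then come the [sX] other positions of [X],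
    and finally those of [Y]. *)
Definition sw_name (X : gset) (Y : bgset) (sX : nat)
    (nX : nat -> nat -> forall n, X n -> nat)
    (nY : nat -> nat -> forall n, Y n -> nat) (x off : nat) n :
  susp_wedge X Y n -> nat :=
  match n with
  | 0 => fun c => if c is Some y then nY off (off.+2 + sX) 0 y else x
  | m.+1 => fun c => match c with
      | inl p => nX off.+1 off.+2 m p
      | inr y => nY off (off.+2 + sX) m.+1 y
      end
  end.

(** Names of the positions, where [x] is the name of the first basepoint and
    the first fresh name is [off]. *)
Definition name : forall (B : bat) (x off n : nat), Pos B n -> nat :=
  @bat_cons_rect (fun B => nat -> nat -> forall n, Pos B n -> nat) (fun x _ _ _ => x)
    (fun B l nB nl => @sw_name (Pos B) (Pos (br l)) (size (pos_tail B)) nB nl).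
Arguments name [B] x off [n] p : simpl never.

Lemma name_cons B l x off n (p : Pos (br (B :: l)) n) :
  name x off p = @sw_name (Pos B) (Pos (br l)) (size (pos_tail B))
    (@name B) (@name (br l)) x off n p.
Proof. by []. Qed.

Lemma name_inr B l x off n (p : Pos (br l) n) :
  name x off (sw_inr B p) = name off (off.+2 + size (pos_tail B)) p.
Proof. by case: n p. Qed.

Lemma name_base B x off : name x off (base (Pos B) false) = x.
Proof. by elim/bat_cons_rect: B x off. Qed.

Definition namep B x off (p : posn B) : nat := name x off (projT2 p).

(** Names are computed by recursion on the tree, so as to be compatible with wedges; this identifies
    them with indices in the order of declaration. *)
Lemma name_tail B x off :
  [seq namep x off p | p <- pos_tail B] = iota off (size (pos_tail B)).
Proof.
elim/bat_cons_rect: B x off => [//|B l IB Il] x off.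
have E : pos_tail (br (B :: l)) = posn_inr B (pos_base (br l)) ::
  posn_inl l (pos_base B) :: [seq posn_inl l p | p <- pos_tail B] ++
  [seq posn_inr B p | p <- pos_tail (br l)] by [].
rewrite E /= size_cat !size_map map_cat -!map_comp iotaD.
rewrite {1}/namep name_inr name_base; congr cons.
rewrite {1}/namep name_cons /= name_base; congr cons; congr cat.
  by rewrite -(IB off.+1); apply: eq_map.
rewrite -(Il off); apply: eq_map => -[n p].
by rewrite /= /namep /= name_inr.
Qed.

Definition pname B : forall n, Pos B n -> nat := @name B 0 1.
Arguments pname [B n] p : simpl never.

Lemma name_pos_list B :
  [seq pname (projT2 p) | p <- pos_list B] = iota 0 (size (pos_list B)).
Proof. by rewrite /= /pname name_base -(name_tail B 0). Qed.

Lemma In_pos_list B (p : posn B) : List.In p (pos_list B).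
Proof.
elim/bat_cons_rect: B p => [|B l IB Il].
  by case=> -[|n] [] //=; left.
case=> -[[p|]|n [p|p]].
- right; case: (Il (existT _ 0 p)) => [E|H].
    by left; exact: (congr1 (@posn_inr B l) E).
  right; right; apply/List.in_app_iff; right.
  exact: (List.in_map (@posn_inr B l) _ _ H).
- by left.
- right; right; case: (IB (existT _ n p)) => [E|H].
    by left; exact: (congr1 (@posn_inl B l) E).
  right; apply/List.in_app_iff; left.
  exact: (List.in_map (@posn_inl B l) _ _ H).
- right; case: (Il (existT _ n.+1 p)) => [//|H].
  right; right; apply/List.in_app_iff; right.
  exact: (List.in_map (@posn_inr B l) _ _ H).
Qed.

Lemma In_nth (T : Type) (x0 x : T) (s : seq T) : List.In x s ->
  exists2 i, i < size s & nth x0 s i = x.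
Proof.
elim: s => //= y s IH [->|/IH[i lt e]]; first by exists 0.
by exists i.+1.
Qed.

Lemma pname_nth B (p : posn B) p0 :
  pname (projT2 p) < size (pos_list B) /\
  nth p0 (pos_list B) (pname (projT2 p)) = p.
Proof.
have [i lt <-] := In_nth p0 (In_pos_list p).
have -> : pname (projT2 (nth p0 (pos_list B) i)) = i; last by [].
have := congr1 (fun s => nth 0 s i) (name_pos_list B).
by rewrite (nth_map p0) // nth_iota.
Qed.

Lemma pname_inj B n m (p : Pos B n) (q : Pos B m) : pname p = pname q ->
  existT (Pos B) n p = existT (Pos B) m q.
Proof.
move=> e; have [_ <-] := pname_nth (existT _ n p) (pos_base B).
by have [_ <-] := pname_nth (existT _ m q) (pos_base B); rewrite /= e.
Qed.

Lemma pname_inj_dim B n : injective (@pname B n).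
Proof. by move=> p q e; apply: inj_pair2 (pname_inj e). Qed.

Lemma pname_surj B i : i < size (pos_list B) ->
  exists n (p : Pos B n), pname p = i.
Proof.
move=> lt; have := congr1 (fun s => nth 0 s i) (name_pos_list B).
rewrite (nth_map (pos_base B)) // nth_iota // add0n.
by move: (nth _ _ _) => [n p] /= <-; exists n, p.
Qed.

(** The type of [p] in a context where its boundary is declared as prescribed
    by [nm], the points having type [A]. *)
Fixpoint gty (X : gset) (nm : forall n, X n -> nat) (A : ty) n : X n -> ty :=
  match n with
  | 0 => fun _ => A
  | m.+1 => fun p => arr (gty nm A (gsrc p)) (var (nm m (gsrc p))) (var (nm m (gtgt p)))
  end.

Lemma height_gty (X : gset) nm n (p : X n) : ty_height (gty nm star p) = n.
Proof. by elim: n p => //= n IH p; rewrite IH. Qed.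

Lemma gty_inl B l A x off n (p : Pos B n) :
  gty (@name (br (B :: l)) x off) A (inl p : Pos (br (B :: l)) n.+1) =
  gty (@name B off.+1 off.+2) (arr A (var x) (var off)) p.
Proof.
elim: n p => [|n IH] p.
  rewrite /= !name_cons /=; congr (arr _ _ (var _)); exact: name_base.
by rewrite [RHS]/= -IH.
Qed.

Lemma gty_inr B l A x off n (p : Pos (br l) n) :
  gty (@name (br (B :: l)) x off) A (sw_inr B p) =
  gty (@name (br l) off (off.+2 + size (pos_tail B))) A p.
Proof.
elim: n p => [|n IH] p //.
rewrite [RHS]/= -IH -!(name_inr B x).
by case: n p {IH}.
Qed.

Definition gtyp B A x off (p : posn B) : ty := gty (@name B x off) A (projT2 p).

Definition ctx_of (B : bat) : ctx :=
  foldl ccons cnil [seq gty (@pname B) star (projT2 p) | p <- pos_list B].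

Lemma csize_foldl Γ s : csize (foldl ccons Γ s) = csize Γ + size s.
Proof. by elim: s Γ => [|A s IH] Γ /=; rewrite ?addn0 // IH addSnnS. Qed.

Lemma cget_foldl Γ s x : csize Γ <= x ->
  cget (foldl ccons Γ s) x = onth s (x - csize Γ).
Proof.
elim/last_ind: s => [|s A IH] le /=.
  rewrite onthE /= nth_nil; elim: Γ le => //= Γ IH A lt.
  by rewrite gtn_eqF ?IH // ltnW.
rewrite foldl_rcons /= csize_foldl onthE map_rcons nth_rcons size_map -onthE.
case: eqP => [->|ne]; first by rewrite addKn ltnn eqxx.
rewrite IH //; case: ltnP => // ge; rewrite onth_default //.
by case: eqP => // e; case: ne; rewrite -e subnKC.
Qed.

Lemma size_ctx_of B : csize (ctx_of B) = size (pos_list B).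
Proof. by rewrite csize_foldl size_map. Qed.

Lemma cget_ctx_of B n (p : Pos B n) :
  cget (ctx_of B) (pname p) = Some (gty (@pname B) star p).
Proof.
rewrite cget_foldl // [_ - _]subn0.
have [lt nE] := pname_nth (existT _ n p) (pos_base B).
by rewrite onthE -map_comp (nth_map (pos_base B)) ?nE.
Qed.

(** Continues a derivation of [ps Γ x A] by a tree attached at [x], returning the new context and
    the variable of type [A] reached. Each branch is one use of (pse), the branch itself, and one
    use of (psd). *)
Definition grow : bat -> ctx -> nat -> ty -> ctx * nat :=
  @bat_cons_rect (fun _ => ctx -> nat -> ty -> ctx * nat) (fun Γ x A => (Γ, x))
    (fun B l rB rl Γ x A =>
       let y := csize Γ in
       let T := arr A (var x) (var y) in
       rl (rB (ccons (ccons Γ A) T) y.+1 T).1 y A).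

Arguments grow : simpl never.

Lemma grow_cons B l Γ x A : grow (br (B :: l)) Γ x A =
  let y := csize Γ in let T := arr A (var x) (var y) in
  grow (br l) (grow B (ccons (ccons Γ A) T) y.+1 T).1 y A.
Proof. by []. Qed.

Lemma growE B Γ x A :
  (grow B Γ x A).1 = foldl ccons Γ [seq gtyp A x (csize Γ) p | p <- pos_tail B].
Proof.
elim/bat_cons_rect: B Γ x A => [//|B l IB Il] Γ x A.
have E : pos_tail (br (B :: l)) = posn_inr B (pos_base (br l)) ::
  posn_inl l (pos_base B) :: [seq posn_inl l p | p <- pos_tail B] ++
  [seq posn_inr B p | p <- pos_tail (br l)] by [].
rewrite E grow_cons /= {}Il {}IB /= map_cat foldl_cat -!map_comp.
rewrite csize_foldl /= size_map; congr foldl; first congr foldl.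
- congr (ccons _ (arr A (var x) (var _))); exact: esym (name_base (br l) _ _).
- by apply: eq_map => -[n p]; exact: esym (@gty_inl B l A x _ n p).
- by apply: eq_map => -[n p]; exact: esym (@gty_inr B l A x _ n p).
Qed.

Lemma ps_grow B Γ x A : ps Γ x A -> ps (grow B Γ x A).1 (grow B Γ x A).2 A.
Proof.
elim/bat_cons_rect: B Γ x A => [//|B l IB Il] Γ x A d.
by rewrite grow_cons /=; apply/Il/psd/IB/pse.
Qed.

Lemma ctx_of_grow B : ctx_of B = (grow B (ccons cnil star) 0 star).1.
Proof. by rewrite growE. Qed.

Lemma pasting_ctx_of B : pasting (ctx_of B).
Proof. by rewrite ctx_of_grow; exists (grow B (ccons cnil star) 0 star).2; apply/ps_grow/pss. Qed.

Lemma grow_rcons l B Γ x A : grow (br (rcons l B)) Γ x A =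
  let s := grow (br l) Γ x A in grow (br [:: B]) s.1 s.2 A.
Proof. by elim: l Γ x => // C l IH Γ x; rewrite rcons_cons !(grow_cons C) /= IH. Qed.

(** A derivation ending at a variable of type [A] corresponds to a tree with a
    path of length [dim A + 1] to its rightmost open node. *)
Inductive zipper := Ztop of seq bat | Zsub of zipper & seq bat.

Fixpoint zstate (z : zipper) : ctx * nat * ty :=
  match z with
  | Ztop l => (grow (br l) (ccons cnil star) 0 star, star)
  | Zsub z l =>
    let: (Γ, x, A) := zstate z in
    let T := arr A (var x) (var (csize Γ)) in
    (grow (br l) (ccons (ccons Γ A) T) (csize Γ).+1 T, T)
  end.

Definition zpush (z : zipper) (B : bat) : zipper :=
  match z with Ztop l => Ztop (rcons l B) | Zsub z l => Zsub z (rcons l B) end.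

(** This is rule (psd): closing the open node makes it the last branch of its parent, leaves the
    context unchanged and moves to the target of the arrow. *)
Lemma zstate_push z l : zstate (zpush z (br l)) =
  ((zstate (Zsub z l)).1.1, csize (zstate z).1.1, (zstate z).2).
Proof.
case: z => [l1|z l1] /=.
  by rewrite grow_rcons /= grow_cons /=; case: (grow (br l1)).
case: (zstate z) => -[Γ x] A; rewrite grow_rcons /= grow_cons /=.
by case: (grow (br l1)).
Qed.

Lemma ps_zipper Γ x A : ps Γ x A -> exists z, zstate z = (Γ, x, A).
Proof.
elim=> {Γ x A} [|Γ f x y A _ [z]|Γ x A _ [z zE]].
- by exists (Ztop [::]).
- case: z => [l //|z l] zE; exists (zpush z (br l)); rewrite zstate_push zE.
  by move: zE => /=; case: (zstate z) => -[Γ0 x0] A0 [_ -> _ ->].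
- by exists (Zsub z [::]); rewrite /= zE.
Qed.

(** A derivation ending at type [star] has a zipper with no open node besides the root, which is
    just a tree. *)
Lemma pasting_ctx Γ : pasting Γ -> exists B, Γ = ctx_of B.
Proof.
case=> x /ps_zipper[[l|z l]] /=; last by case: (zstate z) => -[].
by case=> zE; exists (br l); rewrite ctx_of_grow zE.
Qed.

(** * Rigidity of trees *)

(** Isomorphisms are encoded as relations, which restrict to the summands of a wedge without any map
    having to be constructed. *)
Record grel_iso (X Y : gset) (E : forall n, X n -> Y n -> Prop) : Prop := {
  iso_tot : forall n p, exists q, E n p q;
  iso_onto : forall n q, exists p, E n p q;
  iso_fun : forall n p q q', E n p q -> E n p q' -> q = q';
  iso_inj : forall n p p' q, E n p q -> E n p' q -> p = p';
  iso_bd : forall e n p q, E n.+1 p q -> E n (gbd e p) (gbd e q) }.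

(** Among the points only [None] counts as left, so that taking sources never changes the side. *)
Definition sw_isl B l n : Pos (br (B :: l)) n -> bool :=
  match n with
  | 0 => fun c => if c is Some _ then false else true
  | _.+1 => fun c => if c is inl _ then true else false
  end.
Arguments sw_isl [B l n] c.

Lemma sw_isl_src B l n (c : Pos (br (B :: l)) n.+1) : sw_isl (gsrc c) = sw_isl c.
Proof. by case: n c => [|n] []. Qed.

Lemma sw_islP B l n (c : Pos (br (B :: l)) n.+1) : sw_isl c ->
  exists p : Pos B n, c = inl p.
Proof. by case: c => // p _; exists p. Qed.

Lemma sw_isrP B l n (c : Pos (br (B :: l)) n) : sw_isl c = false ->
  exists p : Pos (br l) n, c = sw_inr B p.
Proof.
case: n c => [|n] c; first by case: c => // p _; exists p.
by case: c => // p _; exists p.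
Qed.

Lemma sw_isl_inr B l n (c : Pos (br l) n) : sw_isl (sw_inr B c) = false.
Proof. by case: n c. Qed.

Lemma sw_inr_inj B l n (p q : Pos (br l) n) : sw_inr B p = sw_inr B q -> p = q.
Proof. by case: n p q => [|n] p q []. Qed.

Lemma gbd_inl e B l n (p : Pos B n.+1) :
  gbd e (inl p : Pos (br (B :: l)) n.+2) = inl (gbd e p).
Proof. by case: e. Qed.

Lemma gbd_inr e B l n (p : Pos (br l) n.+1) :
  gbd e (sw_inr B p) = sw_inr B (gbd e p).
Proof. by case: n p => [|n] p; case: e. Qed.

Section Rigid.
Variables (B C : bat) (l m : seq bat).
Variable (E : forall n, Pos (br (B :: l)) n -> Pos (br (C :: m)) n -> Prop).
Hypothesis isoE : grel_iso (@E).

(** The first basepoint is the only point that is not a target, a property which isomorphisms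
    preserve. *)
Lemma iso_None q : @E 0 None q -> q = None.
Proof.
move=> Eq; have [q0|/rank_gt0[x' xq]] := posnP (rank false q).
  exact: (@rank_inj false).
have [x Ex] := iso_onto isoE x'.
have := iso_inj isoE (iso_bd isoE true Ex); rewrite [gbd true x']xq => /(_ _ Eq) xN.
have := rank_bd false x; by rewrite [gbd _ x]xN.
Qed.

Lemma iso_isl n p q : @E n p q -> sw_isl p = sw_isl q.
Proof.
elim: n p q => [|n IH] p q Epq; last first.
  by rewrite -!sw_isl_src; apply: IH; apply: (iso_bd isoE false) Epq.
have [q0 E0] := iso_tot isoE (None : Pos (br (B :: l)) 0).
have q0N := iso_None E0; subst q0.
case: p Epq => [p|] Epq.
  case: q Epq => // Epq.
  by have := iso_inj isoE Epq E0.
by rewrite (iso_fun isoE Epq E0).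
Qed.

Lemma iso_left : grel_iso (fun n p q => @E n.+1 (inl p) (inl q)).
Proof.
split.
- move=> n p; have [q Eq] := iso_tot isoE (inl p : Pos (br (B :: l)) n.+1).
  have [|q' qE] := @sw_islP _ _ _ q; first by rewrite -(iso_isl Eq).
  by exists q'; rewrite -qE.
- move=> n q; have [p Ep] := iso_onto isoE (inl q : Pos (br (C :: m)) n.+1).
  have [|p' pE] := @sw_islP _ _ _ p; first by rewrite (iso_isl Ep).
  by exists p'; rewrite -pE.
- by move=> n p q q' Eq /(iso_fun isoE Eq)[].
- by move=> n p p' q Eq /(iso_inj isoE Eq)[].
- by move=> e n p q /(iso_bd isoE e); rewrite !gbd_inl.
Qed.

Lemma iso_right : grel_iso (fun n p q => @E n (sw_inr B p) (sw_inr C q)).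
Proof.
split.
- move=> n p; have [q Eq] := iso_tot isoE (sw_inr B p).
  have [|q' qE] := @sw_isrP _ _ _ q; first by rewrite -(iso_isl Eq) sw_isl_inr.
  by exists q'; rewrite -qE.
- move=> n q; have [p Ep] := iso_onto isoE (sw_inr C q).
  have [|p' pE] := @sw_isrP _ _ _ p; first by rewrite (iso_isl Ep) sw_isl_inr.
  by exists p'; rewrite -pE.
- by move=> n p q q' Eq /(iso_fun isoE Eq)/sw_inr_inj.
- by move=> n p p' q Eq /(iso_inj isoE Eq)/sw_inr_inj.
- by move=> e n p q /(iso_bd isoE e); rewrite !gbd_inr.
Qed.

End Rigid.

(** Sides being preserved, an isomorphism restricts to the first branches and to the remaining
    trees. Its uniqueness is expressed through names, which make sense before the two trees are
    identified. *)
Lemma pos_rigid B B' (E : forall n, Pos B n -> Pos B' n -> Prop) :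
  grel_iso E -> B = B' /\
  forall n p q, E n p q -> forall x off, name x off p = name x off q.
Proof.
elim/bat_cons_rect: B B' E => [|B l IB Il] [[|C m]] E isoE.
- by [].
- by have [[]] := iso_onto isoE (inl (base (Pos C) false) : Pos (br (C :: m)) 1).
- by have [[]] := iso_tot isoE (inl (base (Pos B) false) : Pos (br (B :: l)) 1).
have [eB nB] := IB _ _ (iso_left isoE); have [[el] nl] := Il _ _ (iso_right isoE).
subst C m; split=> // n p q Epq x off; have := iso_isl isoE Epq.
case pl: (sw_isl p) => /esym ql; last first.
  have [p' pE] := sw_isrP pl; have [q' qE] := sw_isrP ql; subst p q.
  by rewrite !name_inr; apply: nl Epq _ _.
case: n p q Epq pl ql => [|n] p q Epq pl ql; first by case: p q {Epq} pl ql => [//|] [].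
have [p' pE] := sw_islP pl; have [q' qE] := sw_islP ql; subst p q.
by rewrite !name_cons; apply: nB Epq _ _.
Qed.

(** Having the same name is an isomorphism between the positions, because the declared type of a
    name determines its dimension and its boundary. *)
Lemma ctx_of_inj B B' : ctx_of B = ctx_of B' -> B = B'.
Proof.
move=> eB; have sB : size (pos_list B) = size (pos_list B').
  by rewrite -!size_ctx_of eB.
have dimE n m (p : Pos B n) (q : Pos B' m) : pname p = pname q -> n = m.
  move=> e; have := cget_ctx_of p; rewrite eB e cget_ctx_of => -[] /(congr1 ty_height).
  by rewrite !height_gty.
have [//|//] := @pos_rigid B B' (fun n p q => pname p = pname q); split.
- move=> n p; have [lt _] := pname_nth (existT _ n p) (pos_base B).
  rewrite sB in lt; have [m [q qp]] := pname_surj lt.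
  by have e := dimE _ _ _ _ (esym qp); subst m; exists q.
- move=> n p; have [lt _] := pname_nth (existT _ n p) (pos_base B').
  rewrite -sB in lt; have [m [q qp]] := pname_surj lt.
  by have e := dimE _ _ _ _ qp; subst m; exists q.
- move=> n p q q' e1 e2; exact: pname_inj_dim (etrans (esym e1) e2).
- move=> n p p' q e1 e2; exact: pname_inj_dim (etrans e1 (esym e2)).
- move=> e n p q pq; have := cget_ctx_of p; rewrite eB pq cget_ctx_of.
  by case: e => /= -[].
Qed.

(** * Boundaries of pasting contexts *)

Definition is_face (e : bool) (Γ : ctx) (y : nat) : Prop :=
  exists z A u v, cget Γ z = Some (arr A u v) /\ (if e then v else u) = var y.

(** A description of the variables of ∂_k^ε Γ which does not refer to the derivation;
    [bd_names_spec] proves it correct. *)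
Definition bd_var (e : bool) (k : nat) (Γ : ctx) (y : nat) : Prop :=
  exists2 T, cget Γ y = Some T &
    ty_height T < k \/ ty_height T = k /\ ~ is_face (~~ e) Γ y.

(** The [k]-dimensional iterated target of a variable [x] of type [A]. *)
Fixpoint ktgt (k x : nat) (A : ty) : nat :=
  if k == ty_height A then x else
  if A is arr A _ v then ktgt k (tm_var v) A else x.

Lemma ktgt_lt k x y A : k < ty_height A -> ktgt k x A = ktgt k y A.
Proof. by case: A => //= A u v lt; rewrite ltn_eqF. Qed.

Lemma ktgt_id x A : ktgt (ty_height A) x A = x.
Proof. by case: A => //= A u v; rewrite eqxx. Qed.

Lemma cget_cons2 Γ A T z : cget (ccons (ccons Γ A) T) z =
  if z == (csize Γ).+1 then Some T else if z == csize Γ then Some A else cget Γ z.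
Proof. by []. Qed.

Lemma cget_old Γ A T z U : cget Γ z = Some U ->
  cget (ccons (ccons Γ A) T) z = Some U.
Proof.
by move=> zU; have lt := cget_lt zU; rewrite cget_cons2 !ltn_eqF // ltnW.
Qed.

Lemma is_face_lt e Γ y : globular_ctx Γ -> is_face e Γ y -> y < csize Γ.
Proof.
move=> gG [z [A [u [v [zE]]]]]; have [i [j [-> -> iE jE]]] := gG _ _ _ _ zE.
by case: e => -[<-]; [apply: cget_lt jE|apply: cget_lt iE].
Qed.

Lemma is_face_cons2 e Γ A x w : cget Γ x = Some A ->
  is_face e (ccons (ccons Γ A) (arr A (var x) (var (csize Γ)))) w <->
  is_face e Γ w \/ w = (if e then csize Γ else x).
Proof.
move=> xA; split=> [[z [B [u [v []]]]]|[[z [B [u [v [zE uvE]]]]]|->]].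
- rewrite cget_cons2; case: eqP => [_ [_ <- <-]|_].
    by case: e => -[<-]; right.
  case: eqP => [_ [AE]|_ zE] uvE; left; last by exists z, B, u, v.
  by exists x, B, u, v; rewrite xA AE.
- by exists z, B, u, v; rewrite (cget_old _ _ zE).
exists (csize Γ).+1, A, (var x), (var (csize Γ)).
by rewrite cget_cons2 eqxx; case: e.
Qed.

(** Under (pse) the variable [x] becomes a source, so in the target boundary of its own dimension it
    gives way to the new variable. *)
Lemma bd_var_cons2 e k Γ x A y : globular_ctx Γ -> cget Γ x = Some A ->
  bd_var e k (ccons (ccons Γ A) (arr A (var x) (var (csize Γ)))) y <->
  [\/ y = (csize Γ).+1 /\ ty_height A < k,
      y = csize Γ /\ (ty_height A < k \/ ty_height A = k /\ e) |
      bd_var e k Γ y /\ ~ [/\ e, ty_height A = k & y = x]].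
Proof.
move=> gG xA; have xlt := cget_lt xA.
have fresh e' : ~ is_face e' Γ (csize Γ).
  by move/(is_face_lt gG); rewrite ltnn.
have fresh1 e' : ~ is_face e' Γ (csize Γ).+1.
  by move/(is_face_lt gG); rewrite ltnNge leqnSn.
split.
  case=> T; rewrite cget_cons2; case: eqP => [-> [<-] /= H|_].
    apply: Or31; split=> //; case: H => [/ltnW //|[<-]]; lia.
  case: eqP => [-> [<-] H|_ yT H].
    apply: Or32; split=> //; case: H => [|[hA nf]]; [by left|right; split=> //].
    by case: e nf => // -[]; apply/(is_face_cons2 _ _ xA); right.
  apply: Or33; split.
    exists T => //; case: H => [|[hT nf]]; [by left|right; split=> // f; apply: nf].
    by apply/(is_face_cons2 _ _ xA); left.
  case=> ee hA yx; subst y; move: yT; rewrite xA => -[TA]; subst T.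
  case: H => [|[_]]; first by rewrite hA ltnn.
  by case; apply/(is_face_cons2 _ _ xA); right; rewrite ee.
case=> [[-> lt]|[-> H]|[[T yT H] ne]].
- exists (arr A (var x) (var (csize Γ))); first by rewrite cget_cons2 eqxx.
  move: lt; rewrite /= leq_eqVlt => /orP[/eqP<-|]; last by left.
  right; split=> // /(is_face_cons2 _ _ xA)[/fresh1 //|]; case: (~~ e); lia.
- exists A; first by rewrite cget_cons2 eqxx ltn_eqF.
  case: H => [|[hA ee]]; [by left|right; split=> // /(is_face_cons2 _ _ xA)[/fresh //|]].
  by rewrite ee /=; lia.
- exists T; first exact: cget_old yT.
  case: H => [|[hT nf]]; [by left|right; split=> // /(is_face_cons2 _ _ xA)[//|yE]].
  have ylt := cget_lt yT.
  case: e ne nf yE => /= ne nf yE; last by lia.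
  by apply: ne; split=> //; move: yT; rewrite yE xA => -[->].
Qed.

Definition bd_names e k Γ x A (d : ps Γ x A) : seq nat :=
  [seq p.1 | p <- ps_bd e k d].

Lemma bd_names_pse e k Γ x A (d : ps Γ x A) : bd_names e k (pse d) =
  let D := bd_names e k d in
  if k < ty_height A then D
  else if ty_height A < k then D ++ [:: csize Γ; (csize Γ).+1]
  else if e then rcons (take (size D).-1 D) (csize Γ)
  else D.
Proof.
rewrite /bd_names /=; case: ltngtP => // _; first by rewrite map_cat.
by case: e; rewrite // map_rcons map_take size_map.
Qed.

(** The last clause of ∂_k^+ deletes the last entry of a list. The induction therefore also records
    which variable stands last, and that names are not repeated. *)
Lemma bd_names_spec Γ x A (d : ps Γ x A) : forall k,
  (forall e, uniq (bd_names e k d) /\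
     forall y, y \in bd_names e k d <-> bd_var e k Γ y) /\
  (k <= ty_height A -> exists s, bd_names true k d = rcons s (ktgt k x A)).
Proof.
elim: d => {Γ x A} [|Γ f x y A d IH|Γ x A d IH] k.
- split=> [e|]; last by rewrite leqn0 => /eqP ->; exists [::].
  split=> // y; rewrite inE; split=> [/eqP->|[T]] /=; last by case: eqP.
  exists star => //=; case: k => [|k]; last by left.
  by right; split=> // -[z [A [u [v]]]] /=; case: eqP => _ [].
- have [H1 H2] := IH k; split=> // le.
  by have [|s sE] := H2; [rewrite leqW|exists s; rewrite [LHS]sE /= ltn_eqF].
have [H1 H2] := IH k; have [xA gG] := ps_globular d.
have bdlt e y : bd_var e k Γ y -> y < csize Γ by case=> T /cget_lt.
have pseE e := bd_names_pse e k d.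
case: (ltngtP k (ty_height A)) pseE => [lt|gt|kA] /= pseE.
- split=> [e|_]; rewrite pseE; last first.
    have [|s sE] := H2; first exact: ltnW.
    by exists s; rewrite sE ltn_eqF 1?ltnW // (@ktgt_lt _ (csize Γ) x).
  have [u mE] := H1 e; split=> // y; rewrite mE bd_var_cons2 //.
  split=> [H|[[_ lt']|[_ [lt'|[E _]]]|[]]]; [apply: Or33; split=> // -[_ E]| | | |]; lia || by [].
- split=> [e|]; rewrite pseE; last first.
    move=> le; have -> : k = (ty_height A).+1 by lia.
    by exists (bd_names true (ty_height A).+1 d ++ [:: csize Γ]); rewrite eqxx -cats1 -catA.
  have [u mE] := H1 e; split.
    rewrite cat_uniq u /= !inE orbF andbT; apply/andP; split; last by lia.
    by apply/negP => /orP[]/mE/bdlt; lia.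
  move=> y; rewrite mem_cat bd_var_cons2 // !inE; split.
    case/or3P => [/mE H|/eqP->|/eqP->]; [apply: Or33|apply: Or32|apply: Or31]; split=> //.
    + by case; lia.
    + by left.
  by case=> [[-> _]|[-> _]|[/mE -> _]]; rewrite ?eqxx ?orbT.
- split=> [[]|_]; rewrite pseE; last first.
  + exists (take (size (bd_names true k d)).-1 (bd_names true k d)).
    by rewrite ltn_eqF ?kA ?ktgt_id.
  + have [u mE] := H1 false; split=> // y; rewrite mE bd_var_cons2 //.
    split=> [H|[[_ lt']|[_ [lt'|[_ //]]]|[]]]; [apply: Or33; split=> // -[] //| | |]; lia || by [].
  (* The dimension of [x] is [k], so the deleted entry is [x] itself; by uniqueness no other
     occurrence of it remains. *)
  + have [s sE] := H2 (eq_leq kA); have [u mE] := H1 true.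
    rewrite {2}kA ktgt_id in sE; rewrite sE size_rcons /= -cats1 take_size_cat // in u mE *.
    move: u; rewrite cats1 !rcons_uniq => /andP[xs us].
    have smem y : y \in s -> bd_var true k Γ y.
      by move=> ys; apply/mE; rewrite mem_cat ys.
    split; first by rewrite us andbT; apply/negP => /smem/bdlt; rewrite ltnn.
    move=> y; rewrite mem_rcons inE bd_var_cons2 //; split.
      case/orP => [/eqP->|ys]; [apply: Or32|apply: Or33]; split=> //.
        by right.
      exact: smem.
      by case=> _ _ yx; rewrite -yx ys in xs.
    case=> [[_]|[-> _]|[/mE + ne]]; [lia|by rewrite eqxx|].
    rewrite mem_cat inE => /orP[->|/eqP yx]; first by rewrite orbT.
    by case: ne.
Qed.

Lemma bd_sub_varsE e k Γ (d : pasting Γ) y :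
  y \in bd_sub_vars e k d <-> bd_var e k Γ y.
Proof.
rewrite -((bd_names_spec (projT2 d) k).1 e).2 /bd_sub_vars /bd_sub -map_comp.
by rewrite /bd_names; elim: (ps_bd _ _ _) => //= p s IH;
  rewrite !inE; split=> /orP[->//|/IH->]; rewrite orbT.
Qed.

(** * Supports *)

(** Unlike [cell_ind], this keeps [V] fixed and has no induction hypotheses for
    the cells [a] and [b], which live over another family. *)
Lemma cell_ind1 V (P : forall n, cell V n -> Prop) :
  (forall n v, P n (cvar v)) ->
  (forall n B (a b : cell (Pos B) n) (f : forall k, Pos B k -> cell V k),
     (forall k p, P k (f k p)) -> P n.+1 (ccoh a b f)) ->
  forall n c, P n c.
Proof.
move=> Pv Pc n c.
elim: c P Pv Pc => [{}V {}n v P Pv Pc|{}V {}n B a _ b _ f IH P Pv Pc]; first exact: Pv.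
by apply: (Pc) => k p; apply: (IH k p P Pv Pc).
Qed.

Definition bdc e V (phi : attaching V) n (c : cell V n.+1) : cell V n :=
  if e then (bdry phi c).2 else (bdry phi c).1.

Arguments bdc : simpl never.

Lemma bdc_coh e V (phi : attaching V) n B (a b : cell (Pos B) n)
    (f : forall k, Pos B k -> cell V k) :
  bdc e phi (ccoh a b f) = bind f (if e then b else a).
Proof. by case: e. Qed.

(** For [phi] the attaching map of [Free (Pos B)] this is the last condition of [is_cell] on a
    coherence, so results about it apply to raw families without building a morphism. *)
Definition compat V W (phi : attaching V) (psi : attaching W)
    (f : forall k, V k -> cell W k) : Prop :=
  forall k p, bdry psi (f k.+1 p) = bind2 f (phi k p).

Section Support.
Variable V : nat -> Type.

(** All the generators occurring in a cell, in contrast with [supp]. *)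
Fixpoint avar n (c : cell V n) : {k & V k} -> Prop :=
  match c with
  | cvar n v => fun z => z = existT _ n v
  | ccoh n B a b f => fun z => exists k p, avar (f k p) z
  end.

Variable phi : attaching V.

(** The counterpart of Var(u) ∪ Var(A) in the side condition of (coh). *)
Fixpoint avar_bd n : cell V n -> {k & V k} -> Prop :=
  match n with
  | 0 => fun c z => avar c z
  | m.+1 => fun c z => avar c z \/ exists e, avar_bd (bdc e phi c) z
  end.

(** The supports of the cell and of its iterated sources or targets, which are the sets constrained
    by [full]. *)
Fixpoint supp_bd e n : cell V n -> {k & V k} -> Prop :=
  match n with
  | 0 => fun c z => exists2 w, supp c w & z = existT _ _ w
  | m.+1 => fun c z => (exists2 w, supp c w & z = existT _ _ w) \/
      supp_bd e (bdc e phi c) z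
  end.

Lemma supp_bd_top e n (c : cell V n) w : supp c w -> supp_bd e c (existT _ n w).
Proof. by case: n c w => [|n] c w cw /=; [exists w|left; exists w]. Qed.

Lemma avar_bd_avar n (c : cell V n) z : avar c z -> avar_bd c z.
Proof. by case: n c => //= n c; left. Qed.

Lemma supp_avar n (c : cell V n) w : supp c w -> avar c (existT _ n w).
Proof.
elim/cell_ind1: n / c w => [n v w ->|n B a b f IH w [p /IH H]] //=.
by exists n.+1, p.
Qed.

Lemma supp_bd_avar_bd e n (c : cell V n) z : supp_bd e c z -> avar_bd c z.
Proof.
elim: n c => [|n IH] c /=; first by case=> w /supp_avar H ->.
by case=> [[w /supp_avar H ->]|/IH H]; [left|right; exists e].
Qed.

Lemma avar_dim n (c : cell V n) z : is_cell phi c -> avar c z -> projT1 z <= n.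
Proof.
elim/cell_ind1: n / c => [n v _ ->|n B a b f IH] //= [dimB _ _ fc _] [k [p H]].
exact: leq_trans (IH _ _ (fc _ _) H) (leq_trans (pos_dim p) dimB).
Qed.

(** A generator of top dimension can only occur in the image of a position of that dimension, by
    [avar_dim] and the bound on the dimension of [B]. *)
Lemma avar_supp n (c : cell V n) w :
  is_cell phi c -> avar c (existT _ n w) -> supp c w.
Proof.
elim/cell_ind1: n / c w => [n v w _ /= H|n B a b f IH w /= [dimB _ _ fc _] [k [p H]]].
  exact: inj_pair2 H.
have := avar_dim (fc _ _) H; have := leq_trans (pos_dim p) dimB => /= ? ?.
have ek : k = n.+1 by lia.
by subst k; exists p; apply: IH.
Qed.

End Support.

Lemma supp_bind V W (f : forall k, V k -> cell W k) n (c : cell V n) w :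
  supp (bind f c) w <-> exists2 v, supp c v & supp (f n v) w.
Proof.
elim/cell_ind1: n / c w => [n v w|n B a b g IH w] /=.
  by split=> [H|[_ -> //]]; exists v.
split=> [[p /IH[v H1 H2]]|[v [p H1] H2]]; first by exists v => //; exists p.
by exists p; apply/IH; exists v.
Qed.

Lemma bdry_bind_raw V W (phi : attaching V) (psi : attaching W)
    (f : forall k, V k -> cell W k) : compat phi psi f ->
  forall n (c : cell V n.+1), bdry psi (bind f c) = bind2 f (bdry phi c).
Proof.
move=> fP n c; elim/(@bdry_cell _ phi): n / c => [n v|n B a b g] //=.
by rewrite /bind2 /= !bind_bind.
Qed.

Lemma bdc_bind e V W (phi : attaching V) (psi : attaching W)
    (f : forall k, V k -> cell W k) : compat phi psi f ->
  forall n (c : cell V n.+1), bdc e psi (bind f c) = bind f (bdc e phi c).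
Proof. by move=> fP n c; rewrite /bdc (bdry_bind_raw fP); case: e. Qed.

Lemma is_cell_bdc e V (phi : attaching V) (phiP : forall n v, is_sphere phi (phi n v))
    n (c : cell V n.+1) : is_cell phi c -> is_cell phi (bdc e phi c).
Proof.
elim/(@bdry_cell _ phi): n / c => [n v|n B a b g] /=.
  by have [] := phiP _ v; case: e.
case=> dimB [ac bc ab] fab gc gb.
have H x : is_cell (free_att (Pos B)) x -> is_cell phi (bind g x).
  apply: is_cell_bind_raw gc _ => m d; exact: (bdry_bind_raw gb).
by rewrite /bdc; case: e => /=; apply: H.
Qed.

Section Faces.
Variables (B : bat) (V : nat -> Type) (psi : attaching V).
Variable (f : forall k, Pos B k -> cell V k).
Arguments f [k].
Hypothesis fP : compat (free_att (Pos B)) psi (@f).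

Lemma bdc_face e k (p : Pos B k.+1) : bdc e psi (f p) = f (gbd e p).
Proof. by rewrite /bdc fP; case: e. Qed.

Lemma supp_bd_face e k (p : Pos B k) z : supp_bd psi e (f p) z ->
  exists j (q : Pos B j) w, supp (f q) w /\ z = existT _ j w.
Proof.
elim: k p => [|k IH] p /=; first by case=> w fw zE; exists 0, p, w.
by case=> [[w fw zE]|]; [exists k.+1, p, w|rewrite bdc_face; apply: IH].
Qed.

Lemma avar_bd_face k (p : Pos B k) z : avar_bd psi (f p) z ->
  exists j (q : Pos B j), avar (f q) z.
Proof.
elim: k p => [|k IH] p /=; first by exists 0, p.
by case=> [H|[e]]; [exists k.+1, p|rewrite bdc_face; apply: IH].
Qed.

End Faces.

(** The order along the chain for [e = false], and the reverse order for [e = true]. *)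
Definition precedes e B n (p q : Pos B n) : Prop := gpar p q /\ rank e p <= rank e q.

Lemma precedes_refl e B n (p : Pos B n) : precedes e p p.
Proof. by split; first exact: gpar_refl. Qed.

Lemma precedes_trans e B n (q p r : Pos B n) : precedes e p q -> precedes e q r -> precedes e p r.
Proof. by move=> [pq lpq] [qr lqr]; split; [apply: gpar_trans pq qr|apply: leq_trans lpq lqr]. Qed.

Lemma precedes_neg e B n (p q : Pos B n) : precedes (~~ e) p q <-> precedes e q p.
Proof.
split=> -[pq le]; (split; first exact: gpar_sym);
  by have := rank_sum pq; case: e le => /=; lia.
Qed.

(** * Supports meet each chain at most once *)

Section Columns.
Variable C : bat.
Let X := Pos C.
Let phi : attaching (Pos C) := free_att (Pos C).

Lemma bdc_var e n (v : Pos C n.+1) : bdc e phi (cvar v) = cvar (gbd e v).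
Proof. by case: e. Qed.

(** The support of a cell meets each chain of parallel positions at most once;
    this is established along with the fact that the cell lies between its
    source and its target, in order for the induction to go through. *)
Definition supp_sep n (c : cell (Pos C) n) : Prop :=
  forall z z', supp c z -> supp c z' -> gpar z z' -> z = z'.

Definition supp_within n (c : cell (Pos C) n.+1) : Prop :=
  forall e z, supp c z -> exists2 w, supp (bdc e phi c) w & precedes e w (gbd e z).

Definition supp_mono n (c : cell (Pos C) n.+1) : Prop :=
  forall e w, supp (bdc (~~ e) phi c) w ->
  exists2 w', supp (bdc e phi c) w' & precedes e w' w.

Definition columnar n : cell (Pos C) n -> Prop :=
  match n with
  | 0 => fun c => supp_sep c
  | m.+1 => fun c => [/\ supp_sep c, supp_within c & supp_mono c]
  end.

Lemma columnar_sep n (c : cell (Pos C) n) : columnar c -> supp_sep c.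
Proof. by case: n c => // n c []. Qed.

Lemma full_supp B n (a b : cell (Pos B) n) (e : bool) p :
  full a b -> supp (if e then b else a) p <-> rank e p = 0.
Proof.
move=> ab; rewrite -bat_incl_top.
case: n a b p ab => [|n] a b p /= => [[sa sb]|[[sa sb] _]];
  by case: e; [apply: sb|apply: sa].
Qed.

Section Morphism.
Variables (B : bat) (f : forall k, Pos B k -> cell (Pos C) k).
Arguments f [k].
Hypothesis fP : compat (free_att (Pos B)) phi (@f).
Hypothesis fcol : forall k p, columnar (@f k p).

(** Consecutive members of the chain are the two faces of some [x], and [supp_mono] for the cell
    [f x] moves the support by one step; the induction is on the number of steps. *)
Lemma mor_mono e k (p q : Pos B k) W : precedes e p q -> supp (f q) W ->
  exists2 W', supp (f p) W' & precedes e W' W.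
Proof.
move=> [pq le]; move: {2}(rank e q - rank e p) (erefl (rank e q - rank e p)) => m.
elim: m p pq le => [|m IH] p pq le mE fqW.
  have -> : p = q by apply: (rank_inj (e := e)) => //; lia.
  by exists W => //; apply: precedes_refl.
have [|x xp] := rank_lt (e := e) pq; first lia.
have rE := rank_bd e x; rewrite xp in rE.
have [|||//|W1 fW1 oW1] := IH (gbd (~~ e) x); [|lia|lia|].
  by apply: gpar_trans pq; rewrite -xp; apply: gpar_bd.
have [_ _ /(_ e W1)] := fcol x; rewrite !(bdc_face fP) xp => /(_ fW1)[W2 fW2 oW2].
by exists W2 => //; apply: precedes_trans oW2 oW1.
Qed.

(** If the sources of [p] and [q] are distinct in one chain, [supp_mono] places
    the image of one of [p] and [q] before that of the other along the chains of
    [C]; hence these images cannot contain parallel elements. *)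
Lemma mor_par k (p q : Pos B k) z z' :
  supp (f p) z -> supp (f q) z' -> gpar z z' -> gpar p q.
Proof.
elim: k p q z z' => // k IH p q z z' pz qz' zz'.
have [_ Wp _] := fcol p; have [_ Wq _] := fcol q.
have zz e : gbd e z = gbd e z' by case: zz' e => ? ? [].
have src_par : gpar (gsrc p) (gsrc q).
  have [w] := Wp false z pz; have [w'] := Wq false z' qz'; rewrite !(bdc_face fP).
  move=> fw' [par' _] fw [par _]; apply: IH fw fw' _.
  by apply: gpar_trans par _; rewrite zz; apply: gpar_sym.
have tgt_par : gpar (gtgt p) (gtgt q).
  apply: gpar_trans (gpar_trans src_par (gpar_bd q false true)).
  exact: (gpar_bd p true false).
(* In the order of the chain, the target of [z1] is at most [W], which is at most [W2 = w'], which
   is at most the common source of [z2] and [z1]. But this source lies strictly before the target of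
   [z1]. *)
have no_lt (p1 q1 : Pos B k.+1) z1 z2 : supp (f p1) z1 -> supp (f q1) z2 ->
    gsrc z1 = gsrc z2 -> gpar (gsrc p1) (gsrc q1) ->
    rank false (gsrc p1) < rank false (gsrc q1) -> False.
  move=> s1 s2 sz par lt.
  have [_ /(_ true _ s1) [W]] := fcol p1; rewrite (bdc_face fP) => fW [Wpar Wle] _.
  have [_ /(_ false _ s2) [w']] := fcol q1; rewrite (bdc_face fP) => fw' [wpar wle] _.
  have o : precedes true (gbd false q1) (gbd true p1).
    apply/(precedes_neg false); split.
      exact: gpar_trans (gpar_bd p1 true false) par.
    by rewrite (rank_bd false p1).
  have [W2 fW2 [W2par W2le]] := mor_mono o fW.
  have e : W2 = w'.
    apply: columnar_sep (fcol _) _ _ fW2 fw' _.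
    apply: gpar_trans W2par (gpar_trans Wpar _).
    apply: gpar_trans (gpar_bd z1 true false) _; rewrite /= sz; exact: gpar_sym.
  subst W2.
  have [_ le1] : precedes false (gbd true z1) w'.
    by apply/(precedes_neg true); apply: (precedes_trans (q := W)); split.
  have := rank_bd false z1; move: le1 wle; rewrite /= sz; lia.
have srcE : gsrc p = gsrc q.
  apply: (@rank_inj false _ _ _ _ src_par).
  case: (ltngtP (rank false (gsrc p)) (rank false (gsrc q))) => // lt.
    by case: (no_lt p q z z' pz qz' (zz false) src_par lt).
  by case: (no_lt q p z' z qz' pz (esym (zz false)) (gpar_sym src_par) lt).
split=> //; apply: (@rank_inj false _ _ _ _ tgt_par).
by have := rank_bd false p; have := rank_bd false q; rewrite /= srcE => -> ->.
Qed.

End Morphism.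

(** For a coherence, separation reduces to [mor_par], as positions of top dimension have trivial
    chains. The other properties use that, by fullness, the start or end of every chain of [B] in
    the dimension of the sphere lies in the support of its source or target. *)
Lemma cell_columnar n (c : cell (Pos C) n) : is_cell phi c -> columnar c.
Proof.
elim/cell_ind1: n / c => [n v _|n B a b f IH /= [dimB _ ab fc fP]].
  have sep : supp_sep (cvar v) by move=> z z' -> ->.
  case: n v sep => //= n v sep; split=> // e z; rewrite !bdc_var.
    by move=> ->; exists (gbd e v) => //; apply: precedes_refl.
  move=> ->; exists (gbd e v) => //; split; first exact: gpar_bd.
  by rewrite rank_bd.
have col k p : columnar (f k p) by apply: IH.
split.
- move=> z z' [p pz] [q qz'] zz'; have pq := mor_par fP col pz qz' zz'.
  have epq : p = q.
    have nolt (p1 q1 : Pos B n.+1) : gpar p1 q1 -> rank false p1 < rank false q1 -> False.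
      by move=> par /(rank_lt par)[x _]; have := leq_trans (pos_dim x) dimB; rewrite ltnn.
    apply: (rank_inj (e := false)) => //; case: (ltngtP (rank false p) (rank false q)) => //.
      by move/(nolt _ _ pq).
    by move/(nolt _ _ (gpar_sym pq)).
  by subst q; apply: columnar_sep (col _ p) _ _ pz qz' zz'.
- move=> e z [p pz]; rewrite bdc_coh.
  have [_ /(_ e z pz)[w]] := col _ p; rewrite (bdc_face fP) => fw ow _.
  have [p0 par p00] := rank_min e (gbd e p).
  have [|w0 fw0 ow0] := mor_mono fP col (e := e) (p := p0) _ fw; first by split=> //; rewrite p00.
  exists w0; last exact: precedes_trans ow0 ow.
  by apply/supp_bind; exists p0 => //; apply/(full_supp e p0 ab).
- move=> e W; rewrite !bdc_coh => /supp_bind[p _ fW].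
  have [p0 par p00] := rank_min e p.
  have [|w0 fw0 ow0] := mor_mono fP col (e := e) (p := p0) _ fW; first by split=> //; rewrite p00.
  exists w0 => //.
  by apply/supp_bind; exists p0 => //; apply/(full_supp e p0 ab).
Qed.

End Columns.

Lemma free_attP (Y : gset) n (v : Y n.+1) : is_sphere (free_att Y) (free_att Y n v).
Proof. exact: (attP (c := Free Y) v). Qed.

Lemma bdry_parallel V (psi : attaching V)
    (psiP : forall n v, is_sphere psi (psi n v)) n (c : cell V n.+1) e :
  is_cell psi c -> parallel psi (bdc e psi c) (bdc (~~ e) psi c).
Proof.
have sym m (x y : cell V m) : parallel psi x y -> parallel psi y x by case: m x y.
suff H : is_cell psi c -> parallel psi (bdc false psi c) (bdc true psi c).
  by case: e => /H //; apply: sym.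
elim/(@bdry_cell _ psi): n / c => [n v _|n B a b g] /=; first by have [] := psiP _ v.
case=> dimB [ac bc ab] fab gc gb; rewrite /bdc /=.
by case: n a b ab {ac bc fab dimB} => //= n a b ab; rewrite !(bdry_bind_raw gb) ab.
Qed.

Section SuppBd.
Variables (V : nat -> Type) (psi : attaching V).

Lemma supp_bd_dim e n (c : cell V n) z : supp_bd psi e c z -> projT1 z <= n.
Proof.
elim: n c => [|n IH] c /=; first by case=> w _ ->.
by case=> [[w _ ->]//|/IH/leqW].
Qed.

Lemma supp_bd_topE e n (c : cell V n) w : supp_bd psi e c (existT _ n w) <-> supp c w.
Proof.
split; last exact: supp_bd_top.
case: n c w => [|n] c w /=; first by case=> w' H e0; rewrite (inj_pair2 _ _ _ _ _ e0).
case=> [[w' H e0]|/supp_bd_dim]; last by rewrite /= ltnn.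
by rewrite (inj_pair2 _ _ _ _ _ e0).
Qed.

Lemma supp_bd_lower e n (c : cell V n.+1) z : projT1 z <= n ->
  supp_bd psi e c z <-> supp_bd psi e (bdc e psi c) z.
Proof.
by move=> le; split=> [[[w _ zE]|//]|]; [move: le; rewrite zE /= ltnn|right].
Qed.

Hypothesis psiP : forall n (v : V n.+1), is_sphere psi (psi v).

(** The cell [c'] is the iterated source or target of [c] in dimension [k]. *)
Lemma supp_bd_cell e n (c : cell V n) k : is_cell psi c -> k <= n ->
  exists2 c' : cell V k, is_cell psi c' &
    forall w, supp_bd psi e c (existT _ k w) <-> supp c' w.
Proof.
elim: n c => [|n IH] c cc.
  rewrite leqn0 => /eqP k0; subst k; exists c => // w; exact: supp_bd_topE.
rewrite leq_eqVlt => /orP[/eqP k0|lt].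
  subst k; exists c => // w; exact: supp_bd_topE.
have [c' cc' H] := IH _ (is_cell_bdc e psiP cc) lt.
by exists c' => // w; rewrite supp_bd_lower.
Qed.

Lemma avar_bd_dim n (c : cell V n) z : is_cell psi c -> avar_bd psi c z -> projT1 z <= n.
Proof.
elim: n c => [|n IH] c cc /=; first exact: avar_dim cc.
case=> [H|[e H]]; first exact: avar_dim cc H.
exact: leqW (IH _ (is_cell_bdc _ psiP cc) H).
Qed.

Lemma avar_bd_top n (c : cell V n) w : is_cell psi c ->
  avar_bd psi c (existT _ n w) -> supp c w.
Proof.
move=> cc; case: n c w cc => [|n] c w cc /=; first exact: avar_supp cc.
case=> [H|[e H]]; first exact: avar_supp cc H.
by have := avar_bd_dim (is_cell_bdc _ psiP cc) H; rewrite /= ltnn.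
Qed.

End SuppBd.

Lemma supp_bd_bind e V W (phi : attaching V) (psi : attaching W)
    (f : forall k, V k -> cell W k) : compat phi psi f ->
  forall n (c : cell V n) k (p : V k) w, supp_bd phi e c (existT _ k p) ->
  supp (f k p) w -> supp_bd psi e (bind f c) (existT _ k w).
Proof.
move=> fP; elim=> [|n IH] c k p w /=.
  case=> v cv kE; have k0 : k = 0 := congr1 (@projT1 _ _) kE.
  subst k; have pE := inj_pair2 _ _ _ _ _ kE; subst v => fw.
  by exists w => //; apply/supp_bind; exists p.
case=> [[v cv kE] fw|H fw]; last by right; rewrite (bdc_bind e fP); apply: IH H fw.
have k0 : k = n.+1 := congr1 (@projT1 _ _) kE.
subst k; have pE := inj_pair2 _ _ _ _ _ kE; subst v; left.
by exists w => //; apply/supp_bind; exists p.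
Qed.

(** * Fullness in terms of supports and of occurring variables *)

Section Full.
Variable B : bat.
Let phi : attaching (Pos B) := free_att (Pos B).

(** The recursion in [full] descends through the boundary of the first cell only; by parallelism
    this is the boundary of the second one as well. *)
Lemma fullP n (s : bool -> cell (Pos B) n) :
  is_cell phi (s false) -> is_cell phi (s true) -> parallel phi (s false) (s true) ->
  full (s false) (s true) <->
  forall e k (p : Pos B k), k <= n ->
    supp_bd phi e (s e) (existT _ k p) <-> rank e p = 0.
Proof.
elim: n s => [|n IH] s s0 s1 s01.
  split=> [H e k p|H /=].
    rewrite leqn0 => /eqP k0; subst k; rewrite supp_bd_topE -(full_supp e p H).
    by case: e.
  split=> p; apply: iff_trans (iff_sym (bat_incl_top _ p));
    by rewrite -(H _ _ _ (leqnn _)) supp_bd_topE.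
have sE e : bdc e phi (s false) = bdc e phi (s e).
  by case: e => //; rewrite /bdc; have /= -> := s01.
have := IH (fun e => bdc e phi (s false)) (is_cell_bdc _ (@free_attP _) s0)
  (is_cell_bdc _ (@free_attP _) s0) (bdry_parallel (@free_attP _) false s0).
move=> {}IH; split=> [H e k p|H /=].
  rewrite leq_eqVlt => /orP[/eqP k0|lt].
    subst k; rewrite supp_bd_topE -(full_supp e p H); by case: e.
  case: H => _ /IH H; by rewrite supp_bd_lower // -sE; apply: H.
split.
  split=> p; apply: iff_trans (iff_sym (bat_incl_top _ p));
    by rewrite -(H _ _ _ (leqnn _)) supp_bd_topE.
by apply/IH => e k p le; rewrite -(H _ _ _ (leqW le)) supp_bd_lower // sE.
Qed.

End Full.

Section FullVars.
Variable C : bat.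
Let phi : attaching (Pos C) := free_att (Pos C).
Let phiP := @free_attP (Pos C).

(** By induction [z] lies in the support of the image of some position [p']. Moving [p'] to the
    start [p0] of its chain can only move [z] towards the start of its own chain, where it already
    is. So [z] lies in the image of [p0], which has top dimension or is supplied by fullness. *)
Lemma avar_extremal e n (c : cell (Pos C) n) z : is_cell phi c ->
  avar c z -> rank e (projT2 z) = 0 -> supp_bd phi e c z.
Proof.
elim/cell_ind1: n / c z => [n v z _ -> _|n B a b f IH z cc [l [p H]] z0].
  exact: supp_bd_top.
have [/= dimB [ac bc ab] fab fc fP] := cc.
have col k q : columnar (f k q) := cell_columnar (fc k q).
have [k [p' [w [fw zE]]]] := supp_bd_face fP (IH _ _ _ (fc _ _) H z0); subst z.
have [p0 par p00] := rank_min e p'.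
have [|w0 fw0 [w0par le]] := mor_mono fP col (e := e) (p := p0) _ fw.
  by split=> //; rewrite p00.
have e0 : w0 = w by apply: (@rank_inj e _ _ _ _ w0par); move: z0 le => /= ->; rewrite leqn0 => /eqP.
subst w0; have kle := leq_trans (pos_dim p') dimB.
move: kle; rewrite leq_eqVlt => /orP[/eqP kn|lt].
  by subst k; left; exists w => //; exists p0.
right; rewrite bdc_coh.
apply: (supp_bd_bind fP) fw0.
have := (fullP (s := fun e => if e then b else a) ac bc ab).1 fab e k p0 lt.
by move=> ->.
Qed.

Lemma avar_bd_extremal e n (c : cell (Pos C) n) z : is_cell phi c ->
  avar_bd phi c z -> rank e (projT2 z) = 0 -> supp_bd phi e c z.
Proof.
elim: n c => [|n IH] c cc H z0; first exact: (@avar_extremal e 0).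
case: H => [H|[e' H]]; first exact: avar_extremal cc H z0.
right; have := IH _ (is_cell_bdc e' phiP cc) H z0.
have [-> //|ne] := eqVneq e' e; have {ne}-> : e' = ~~ e by move: ne; case: (e); case: (e').
(* The occurrence lies on the opposite side of the boundary. In dimension [n] the property
   [supp_mono] transfers an extremal element to the side [e]; below it, the two sides have the same
   boundary. *)
move=> {IH} {}H; have := supp_bd_dim H; rewrite leq_eqVlt => /orP[/eqP dz|lt].
  case: z dz z0 H => k w /= dz z0 H; subst k; move/supp_bd_topE: H => H.
  apply: supp_bd_top.
  have [_ _ /(_ e w H)[w' H' [par le]]] := cell_columnar cc.
  by have -> : w = w' by apply: (rank_inj (e := e)); [exact: gpar_sym|lia].
case: n c cc H lt => // n c cc H lt.
rewrite supp_bd_lower //; move: H; rewrite supp_bd_lower //.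
by have /= par := bdry_parallel phiP e cc; rewrite /bdc in par *; rewrite par.
Qed.

Lemma avar_closed n (c : cell (Pos C) n) k (x : Pos C k.+1) e : is_cell phi c ->
  avar c (existT _ _ x) -> avar_bd phi c (existT _ _ (gbd e x)).
Proof.
elim/cell_ind1: n / c => [n v _ H|n B a b f IH cc [l [p H]]].
  have k0 : k.+1 = n := congr1 (@projT1 _ _) H; subst n.
  have vx := inj_pair2 _ _ _ _ _ H; subst v.
  by right; exists e; rewrite bdc_var; apply: avar_bd_avar.
have [/= dimB [ac bc ab] fab fc fP] := cc.
left; apply: (avar_bd_face fP (p := p)). exact: IH (fc _ _) H.
Qed.

Lemma avar_bd_closed n (c : cell (Pos C) n) k (x : Pos C k.+1) e : is_cell phi c ->
  avar_bd phi c (existT _ _ x) -> avar_bd phi c (existT _ _ (gbd e x)).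
Proof.
elim: n c => [|n IH] c cc; first exact: (@avar_closed 0).
case=> [H|[e' H]]; first exact: avar_closed cc H.
by right; exists e'; apply: IH H; apply: is_cell_bdc.
Qed.

(** The positions of the [n]-dimensional source or target of [C]. *)
Definition bd_pos e n (z : posn C) : Prop :=
  projT1 z < n \/ projT1 z = n /\ rank e (projT2 z) = 0.

(** From fullness, all lower positions occur because occurrences are closed under boundaries.
    Conversely [avar_bd_extremal] puts all extremal positions into the supports, and separation
    leaves no room for others. *)
Lemma full_avar n (s : bool -> cell (Pos C) n) :
  is_cell phi (s false) -> is_cell phi (s true) -> parallel phi (s false) (s true) ->
  full (s false) (s true) <-> forall e z, avar_bd phi (s e) z <-> bd_pos e n z.
Proof.
move=> s0 s1 s01; have sc e : is_cell phi (s e) by case: e.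
rewrite fullP //; split=> [H e|H e k p le].
  case=> k p; split=> [zs|].
    have le := avar_bd_dim phiP (sc e) zs.
    move: (le); rewrite leq_eqVlt => /orP[/eqP kn|lt]; last by left.
    rewrite /= in kn; subst k; right; split=> //; apply/(H e _ p le).
    by apply/supp_bd_topE/(avar_bd_top phiP).
  move: {2}(n - k) (erefl (n - k)) => j; elim: j k p => [|j IH] k p jE [] /=.
  - lia.
  - case=> kn; subst k => p0; apply: (supp_bd_avar_bd (e := e)).
    by apply/(H e _ p).
  - move=> lt; have [p0|/rank_gt0[x xp]] := posnP (rank e p).
      by apply: (supp_bd_avar_bd (e := e)); apply/(H e _ p) => //; apply: ltnW.
    (* The position [x] itself need not satisfy [bd_pos] when its dimension is [n]; the extremal
       member of its chain does, and has the same boundary. *)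
    have [x0 par x00] := rank_min e x.
    have <- : gbd (~~ e) x0 = p by rewrite -xp; case: par; case: (e).
    apply: avar_bd_closed => //; apply: IH; first lia.
    by rewrite /bd_pos /= x00; lia.
  - lia.
have low q : rank e q = 0 -> supp_bd phi e (s e) (existT _ k q).
  move=> q0; apply: avar_bd_extremal => //; apply/H; rewrite /bd_pos /=.
  by move: le; rewrite leq_eqVlt => /orP[/eqP kn|]; [right|left].
split=> [zs|]; last exact: low.
have [c' cc' c'E] := supp_bd_cell phiP e (sc e) le.
have [p0 par p00] := rank_min e p.
suff <- : p0 = p by [].
by apply: (columnar_sep (cell_columnar cc')) => //; apply/c'E => //; apply: low.
Qed.

Lemma bd_pos_all e n z : bat_dim C <= n -> bd_pos e n z.
Proof.
case: z => k p le; have := leq_trans (pos_dim p) le.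
rewrite leq_eqVlt => /orP[/eqP kn|]; last by left.
right; split=> //; case: (posnP (rank e p)) => // /rank_gt0[x _].
have lt := leq_trans (pos_dim x) le; by rewrite kn ltnn in lt.
Qed.

(** In the first case of [coh_cond] the dimension of the cells is not prescribed;
    were it at least [bat_dim C], then [s false] and [s true] would have a common
    source in dimension [(bat_dim C).-1], containing the start of a nontrivial
    chain, which is not a variable of the target. *)
Lemma coh_cond_avar n (s : bool -> cell (Pos C) n) :
  is_cell phi (s false) -> is_cell phi (s true) -> parallel phi (s false) (s true) ->
  (1 <= bat_dim C /\
     (forall e z, avar_bd phi (s e) z <-> bd_pos e (bat_dim C).-1 z) \/
   forall e z, avar_bd phi (s e) z) <->
  bat_dim C <= n.+1 /\ full (s false) (s true).
Proof.
move=> s0 s1 s01; rewrite full_avar //; split; last first.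
  case=> le H; move: le; rewrite leq_eqVlt => /orP[/eqP NE|lt].
    by left; rewrite NE.
  by right=> e z; apply/H/bd_pos_all.
have [xN] := pos_ex C; case=> [[N1 H]|H]; last first.
  have le : bat_dim C <= n := avar_bd_dim phiP s0 (H false (existT _ _ xN)).
  split=> [|e z]; first exact: leqW.
  by split=> // _; apply: bd_pos_all.
case: (bat_dim C) xN N1 H => // N x _ H.
have [z zpar z0] := rank_min false (gsrc x).
have Hz : avar_bd phi (s false) (existT _ N z) by apply/H; right.
have Nn : N <= n := avar_bd_dim phiP s0 Hz.
suff NE : n <= N.
  have e : n = N by lia.
  by subst n; split.
rewrite leqNgt; apply/negP => lt.
have : bd_pos true N (existT _ N z).
  apply/H; case: n s s0 s1 s01 H Hz lt {Nn} => // n s s0 s1 /= s01 H Hz lt.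
  have := avar_bd_extremal s0 Hz z0; rewrite supp_bd_lower // => Hb.
  right; exists false; apply: (supp_bd_avar_bd (e := false)).
  by move: Hb; rewrite /bdc s01.
rewrite /bd_pos /= ltnn => -[//|[_ z1]].
have := rank_sum zpar; have := rank_bd true x; rewrite /= z0 z1; lia.
Qed.

End FullVars.

(** * The side condition of (coh) and fullness *)

Lemma ctx_dim_le Γ m :
  ctx_dim Γ <= m <-> forall x T, cget Γ x = Some T -> ty_height T <= m.
Proof.
elim: Γ => //= Γ IH A; rewrite geq_max; split=> [/andP[/IH H le] x T|H].
  by case: eqP => [_ [<-]|_ /H].
apply/andP; split; last by apply: (H (csize Γ)); rewrite eqxx.
by apply/IH => x T xT; apply: (H x); rewrite ltn_eqF ?(cget_lt xT).
Qed.

Lemma cget_ctx_of_inv B x T : cget (ctx_of B) x = Some T ->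
  exists n (p : Pos B n), x = pname p /\ T = gty (@pname B) star p.
Proof.
move=> xT; have := cget_lt xT; rewrite size_ctx_of => /pname_surj[n [p px]].
exists n, p; split=> //; have := cget_ctx_of p.
by rewrite px xT => -[].
Qed.

Lemma ctx_dim_ctx_of B : ctx_dim (ctx_of B) = bat_dim B.
Proof.
apply/eqP; rewrite eqn_leq; apply/andP; split.
  apply/ctx_dim_le => x T /cget_ctx_of_inv[n [p [_ ->]]].
  by rewrite height_gty pos_dim.
have [p] := pos_ex B; have /ctx_dim_le H := leqnn (ctx_dim (ctx_of B)).
by rewrite -(height_gty (@pname B) p); apply: (H (pname p)); apply: cget_ctx_of.
Qed.

Lemma is_face_ctx_of e B n (p : Pos B n) :
  is_face e (ctx_of B) (pname p) <-> exists x : Pos B n.+1, gbd e x = p.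
Proof.
split=> [[z [A [u [v [zE uvE]]]]]|[x <-]]; last first.
  exists (pname x); do 3!eexists; split; first exact: cget_ctx_of.
  by case: e.
have [m [q [_]]] := cget_ctx_of_inv zE.
case: m q => // m q /= [_ uE vE]; subst u v.
have /pname_inj E : pname (gbd e q) = pname p by case: e uvE => -[].
have mn : m = n := congr1 (@projT1 _ _) E.
by subst m; exists q; exact: inj_pair2 E.
Qed.

Lemma bd_var_ctx_of e k B n (p : Pos B n) :
  bd_var e k (ctx_of B) (pname p) <-> bd_pos e k (existT _ n p).
Proof.
rewrite /bd_var /bd_pos /=; split=> [[T]|H].
  rewrite cget_ctx_of => -[<-]; rewrite height_gty => -[|[nk nf]]; [by left|right].
  split=> //; case: (posnP (rank e p)) => // /rank_gt0 H; case: nf.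
  exact/is_face_ctx_of.
exists (gty (@pname B) star p); first exact: cget_ctx_of.
rewrite height_gty; case: H => [|[nk r0]]; [by left|right; split=> //].
by move/is_face_ctx_of => [x xp]; have := rank_bd e x; rewrite xp r0.
Qed.

(** This is [coh_cond_avar] read through [pname]: names being injective, sets of variables agree
    exactly when the sets of positions do. *)
Lemma coh_cond_full B (d : pasting (ctx_of B)) n (a b : cell (Pos B) n) A u v :
  let phi := free_att (Pos B) in
  is_cell phi a -> is_cell phi b -> parallel phi a b ->
  (forall y, y \in tm_vars u ++ ty_vars A <->
     exists2 z, avar_bd phi a z & y = pname (projT2 z)) ->
  (forall y, y \in tm_vars v ++ ty_vars A <->
     exists2 z, avar_bd phi b z & y = pname (projT2 z)) ->
  coh_cond d A u v <-> bat_dim B <= n.+1 /\ full a b.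
Proof.
move=> phi ac bc ab uA vA.
rewrite -(coh_cond_avar (s := fun e => if e then b else a)) //.
have memE (s : seq nat) n' (c : cell (Pos B) n') (Q : posn B -> Prop) (t : seq nat) :
    (forall y, y \in t <-> exists2 z, avar_bd phi c z & y = pname (projT2 z)) ->
    (forall y, y \in s <-> exists2 z, Q z & y = pname (projT2 z)) ->
    s =i t <-> forall z, avar_bd phi c z <-> Q z.
  move=> tE sE; have mem (Q' : posn B -> Prop) z :
      (exists2 z', Q' z' & pname (projT2 z) = pname (projT2 z')) <-> Q' z.
    split=> [[z' Qz' /pname_inj]|]; last by exists z.
    by case: z z' Qz' => [k p] [k' p'] /= Qz ->.
  split=> [st z|H y].
    by rewrite -(mem Q) -sE st tE mem.
  by apply/idP/idP => [/sE[z /H Hz ->]|/tE[z /H Hz ->]]; [apply/tE|apply/sE]; exists z.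
have bdE e k y : y \in bd_sub_vars e k d <->
    exists2 z : posn B, bd_pos e k z & y = pname (projT2 z).
  rewrite bd_sub_varsE; split=> [H|[[m p] H ->]]; last exact: (bd_var_ctx_of e k p).2 H.
  have [T /cget_ctx_of_inv[m [p [yE _]]] _] := H; subst y.
  by exists (existT _ m p) => //; exact: (bd_var_ctx_of e k p).1 H.
have allE y : y \in ctx_vars (ctx_of B) <-> exists2 z : posn B, True & y = pname (projT2 z).
  rewrite mem_iota add0n size_ctx_of /=; split=> [/pname_surj[m [p py]]|[[m p] _ ->]].
    by exists (existT _ m p).
  by have [] := pname_nth (existT _ m p) (pos_base B).
rewrite /coh_cond ctx_dim_ctx_of.
split=> [[[N1 H0 H1]|[H0 H1]]|[[N1 H]|H]].
- left; split=> // -[]; [exact/(memE _ _ _ _ _ vA (bdE _ _))|exact/(memE _ _ _ _ _ uA (bdE _ _))].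
- right=> -[] z; [apply/((memE _ _ _ _ _ vA allE).1 H1)
    |apply/((memE _ _ _ _ _ uA allE).1 H0)] => //.
- left; split=> //; [apply/(memE _ _ _ _ _ uA (bdE _ _)); apply: (H false)
    |apply/(memE _ _ _ _ _ vA (bdE _ _)); apply: (H true)].
- right; split; [apply/(memE _ _ _ _ _ uA allE) => z|apply/(memE _ _ _ _ _ vA allE) => z].
    by split=> // _; apply: (H false).
  by split=> // _; apply: (H true).
Qed.

(** * Decoding cells *)

Definition mksub (ts : seq tm) : sub := foldl scons snil ts.

Lemma mksub_rcons ts t : mksub (rcons ts t) = scons (mksub ts) t.
Proof. exact: foldl_rcons. Qed.

Lemma ssize_mksub ts : ssize (mksub ts) = size ts.
Proof. by elim/last_ind: ts => // ts t IH; rewrite mksub_rcons size_rcons /= IH. Qed.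

Lemma sget_mksub ts x : sget (mksub ts) x = nth (var x) ts x.
Proof.
elim/last_ind: ts => [|ts t IH]; first by rewrite nth_nil.
rewrite mksub_rcons /= nth_rcons ssize_mksub IH.
by case: ltngtP => // lt; rewrite nth_default // ltnW.
Qed.

Lemma mksub_comp ts δ : sub_comp (mksub ts) δ = mksub [seq tm_sub t δ | t <- ts].
Proof.
elim/last_ind: ts => // ts t IH.
by rewrite map_rcons !mksub_rcons /= IH.
Qed.

Lemma vars_mksub ts : sub_vars (mksub ts) = flatten [seq tm_vars t | t <- ts].
Proof.
elim/last_ind: ts => // ts t IH.
by rewrite map_rcons mksub_rcons flatten_rcons /= IH.
Qed.

(** Raw cells carry no types, so [dec] recovers the type of a decoded term from the term itself. The
    default [star] is never reached on valid terms. *)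
Definition infer (Γ : ctx) (t : tm) : ty :=
  match t with
  | var x => odflt star (cget Γ x)
  | coh _ A γ => ty_sub A γ
  end.

Lemma inferE Γ t A : tm_ok Γ t A -> infer Γ t = A.
Proof. by case=> {Γ t A} //= Γ x A _ ->. Qed.

Definition pos_sub B (g : forall k, Pos B k -> tm) : sub :=
  mksub [seq g (projT1 p) (projT2 p) | p <- pos_list B].

Lemma ssize_pos_sub B (g : forall k, Pos B k -> tm) :
  ssize (pos_sub g) = csize (ctx_of B).
Proof. by rewrite ssize_mksub size_map size_ctx_of. Qed.

Lemma sget_pos_sub B (g : forall k, Pos B k -> tm) k (p : Pos B k) :
  sget (pos_sub g) (pname p) = g k p.
Proof.
have [lt E] := pname_nth (existT _ k p) (pos_base B).
by rewrite sget_mksub (nth_map (pos_base B)) // E.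
Qed.

Lemma pos_sub_comp B (g : forall k, Pos B k -> tm) δ :
  sub_comp (pos_sub g) δ = pos_sub (fun k p => tm_sub (g k p) δ).
Proof. by rewrite /pos_sub mksub_comp -map_comp. Qed.

Lemma eq_pos_sub B (g h : forall k, Pos B k -> tm) :
  (forall k p, g k p = h k p) -> pos_sub g = pos_sub h.
Proof. by move=> gh; congr mksub; apply: eq_map => p; apply: gh. Qed.

Lemma vars_pos_sub B (g : forall k, Pos B k -> tm) y :
  y \in sub_vars (pos_sub g) <-> exists k (p : Pos B k), y \in tm_vars (g k p).
Proof.
rewrite vars_mksub -map_comp; split.
  by elim: (pos_list B) => //= -[k p] s IH; rewrite mem_cat => /orP[H|/IH //]; exists k, p.
case=> k [p]; have := In_pos_list (existT _ k p).
elim: (pos_list B) => //= q s IH [->|/IH H]; rewrite mem_cat.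
  by move=> /= ->.
by move/H=> ->; rewrite orbT.
Qed.

(** The inverse of [R] on terms, generators being named by [nm]. *)
Fixpoint dec V (nm : forall n, V n -> nat) n (c : cell V n) : tm :=
  match c with
  | cvar n v => var (nm n v)
  | ccoh n B a b f =>
    let u := dec (@pname B) a in
    coh (ctx_of B) (arr (infer (ctx_of B) u) u (dec (@pname B) b))
      (pos_sub (fun k p => dec nm (f k p)))
  end.

Section Decode.
Variables (V : nat -> Type) (phi : attaching V) (nm : forall n, V n -> nat).

(** The type of [dec nm c], read off the iterated boundary of [c]. Unlike [dec] it depends on the
    attaching maps. *)
Fixpoint cty n : cell V n -> ty :=
  match n with
  | 0 => fun _ => star
  | m.+1 => fun c => arr (cty (bdc false phi c))
      (dec nm (bdc false phi c)) (dec nm (bdc true phi c))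
  end.

Lemma height_cty n (c : cell V n) : ty_height (cty c) = n.
Proof. by elim: n c => //= n IH c; rewrite IH. Qed.

Lemma cty_parallel n (a b : cell V n) : parallel phi a b -> cty a = cty b.
Proof. by case: n a b => //= n a b; rewrite /bdc => ->. Qed.

Lemma vars_dec n (c : cell V n) y :
  y \in tm_vars (dec nm c) <-> exists2 z, avar c z & y = nm (projT2 z).
Proof.
elim/cell_ind1: n / c => [n v|n B a b f IH].
  by rewrite inE; split=> [/eqP->|[_ -> ->//]]; exists (existT _ n v).
rewrite [tm_vars _]/= vars_pos_sub; split.
  case=> k [p H]; have [z Hz ->] := (IH k p).1 H.
  by exists z => //; exists k, p.
by case=> z [k [p H]] yz; exists k, p; apply: (IH k p).2; exists z.
Qed.

(** Whereas [avar_bd] follows both faces at every level, [cty] includes the type of the source only;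
    the target has the same type by parallelism. *)
Lemma vars_cty (phiP : forall n (v : V n.+1), is_sphere phi (phi v)) n (c : cell V n) y :
  is_cell phi c -> y \in tm_vars (dec nm c) ++ ty_vars (cty c) <->
  exists2 z, avar_bd phi c z & y = nm (projT2 z).
Proof.
elim: n c => [|n IH] c cc; first by rewrite cats0 vars_dec.
have par := cty_parallel (bdry_parallel phiP false cc).
have IHf := IH _ (is_cell_bdc false phiP cc).
have IHt := IH _ (is_cell_bdc true phiP cc).
rewrite mem_cat /= !mem_cat; split.
  case/or4P => [/vars_dec[z H yz]|H|H|H]; first by exists z => //; left.
  - by have [|z Hz yz] := IHf.1; [rewrite mem_cat H orbT|exists z => //; right; exists false].
  - by have [|z Hz yz] := IHf.1; [rewrite mem_cat H|exists z => //; right; exists false].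
  - by have [|z Hz yz] := IHt.1; [rewrite mem_cat H|exists z => //; right; exists true].
case=> z [H|[[] H]] yz.
- by have -> : y \in tm_vars (dec nm c) by apply/vars_dec; exists z.
- have : y \in tm_vars (dec nm (bdc true phi c)) ++ ty_vars (cty (bdc true phi c)).
    by apply/IHt; exists z.
  by rewrite mem_cat -[cty (bdc true _ _)]par => /orP[->|->]; rewrite !orbT.
- have : y \in tm_vars (dec nm (bdc false phi c)) ++ ty_vars (cty (bdc false phi c)).
    by apply/IHf; exists z.
  by rewrite mem_cat => /orP[->|->]; rewrite !orbT.
Qed.

End Decode.

Lemma dec_bind U V (nmU : forall n, U n -> nat) (nmV : forall n, V n -> nat)
    (f : forall n, U n -> cell V n) (γ : sub) :
  (forall n v, sget γ (nmU n v) = dec nmV (f n v)) ->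
  forall n (c : cell U n), dec nmV (bind f c) = tm_sub (dec nmU c) γ.
Proof.
move=> fE n c; elim/cell_ind1: n / c => [n v|n B a b g IH] /=; first by rewrite fE.
by rewrite pos_sub_comp; congr coh; apply: eq_pos_sub.
Qed.

Lemma cty_bind U V (phi : attaching U) (psi : attaching V)
    (nmU : forall n, U n -> nat) (nmV : forall n, V n -> nat)
    (f : forall n, U n -> cell V n) (γ : sub) :
  compat phi psi f -> (forall n v, sget γ (nmU n v) = dec nmV (f n v)) ->
  forall n (c : cell U n), cty psi nmV (bind f c) = ty_sub (cty phi nmU c) γ.
Proof.
move=> fP fE; elim=> //= n IH c.
by rewrite !(bdc_bind _ fP) IH !(dec_bind fE).
Qed.

Lemma cty_pos B n (p : Pos B n) :
  cty (free_att (Pos B)) (@pname B) (cvar p) = gty (@pname B) star p.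
Proof. by elim: n p => //= n IH p; rewrite IH. Qed.

Lemma ps_ok Γ x A : ps Γ x A -> ctx_ok Γ /\ ty_ok Γ A.
Proof.
elim=> {Γ x A} [|Γ f x y A _ [okG okT]|Γ x A d [okG okA]].
- by have ok1 := ok_ccons (ok_star ok_cnil); split=> //; apply: ok_star.
- by split=> //; inversion okT.
have [xA _] := ps_globular d.
have ok1 : ctx_ok (ccons Γ A) by constructor.
have okA1 := (weaken A).2.1 _ _ okA ok1.
have okT : ty_ok (ccons Γ A) (arr A (var x) (var (csize Γ))).
  constructor=> //; last by constructor; rewrite //= eqxx.
  by apply: (weaken A).2.2.1 => //; constructor.
have ok2 : ctx_ok (ccons (ccons Γ A) (arr A (var x) (var (csize Γ)))) by constructor.
by split=> //; apply: (weaken _).2.1.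
Qed.

Lemma ctx_of_ok B : ctx_ok (ctx_of B).
Proof. by have [x /ps_ok[]] := pasting_ctx_of B. Qed.

Lemma sub_ok_intro Δ Γ γ : ctx_ok Δ -> ctx_ok Γ -> ssize γ = csize Γ ->
  (forall x A, cget Γ x = Some A -> tm_ok Δ (sget γ x) (ty_sub A γ)) ->
  sub_ok Δ γ Γ.
Proof.
move=> okD; elim: Γ γ => [|Γ IH A] [|γ t] //= okG; first by constructor.
case=> sz H; have okA : ty_ok Γ A by inversion okG.
have varsA := ok_vars.2.1 _ _ okA.
constructor=> //; last first.
  by have := H (csize Γ) A; rewrite eqxx sz eqxx (sub_wk γ t).1 ?sz //; apply.
apply: IH => // [|x B xB]; first exact: ty_ok_ctx okA.
have lt := cget_lt xB; have := H x B; rewrite sz !ltn_eqF // => /(_ xB).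
rewrite (sub_wk γ t).1 // sz; have := ok_vars.1 _ (ty_ok_ctx okA) _ _ xB.
by apply: sub_all => y /ltn_trans; apply.
Qed.

(** Dimensions are bounded in order to apply this to contexts declaring only
    part of the generators. *)
Definition declares (N : nat) Γ V (phi : attaching V) (nm : forall n, V n -> nat) :=
  forall n (v : V n), n <= N -> cget Γ (nm n v) = Some (cty phi nm (cvar v)).

Lemma declares_pos N B : declares N (ctx_of B) (free_att (Pos B)) (@pname B).
Proof. by move=> n p _; rewrite cget_ctx_of cty_pos. Qed.

Lemma cty_face B V (psi : attaching V) (f : forall k, Pos B k -> cell V k) nm k p :
  compat (free_att (Pos B)) psi f ->
  cty psi nm (f k p) =
  ty_sub (gty (@pname B) star p) (pos_sub (fun k p => dec nm (f k p))).
Proof.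
move=> fP; rewrite -cty_pos -(cty_bind (f := f) (nmV := nm) fP) // => l q.
by rewrite sget_pos_sub.
Qed.

Lemma dec_ok V n (c : cell V n) (phi : attaching V)
    (phiP : forall n v, is_sphere phi (phi n v)) nm Γ :
  ctx_ok Γ -> declares n Γ phi nm -> is_cell phi c ->
  tm_ok Γ (dec nm c) (cty phi nm c).
Proof.
elim: c phi phiP nm Γ => [{}V {}n v|{}V {}n B a IHa b IHb f IHf] phi phiP nm Γ okG decl.
  by move=> _; constructor=> //; apply: decl.
case=> dimB [ac bc ab] fab fc fP.
have phiB := @free_attP (Pos B).
have okB := ctx_of_ok B.
have aok := IHa _ phiB _ _ okB (@declares_pos n B) ac.
have bok := IHb _ phiB _ _ okB (@declares_pos n B) bc.
rewrite -(cty_parallel _ ab) in bok.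
have fok k p : tm_ok Γ (dec nm (f k p)) (cty phi nm (f k p)).
  apply: (IHf k p phi phiP nm Γ okG _ (fc k p)) => m v le; apply: decl.
  exact: leq_trans le (leq_trans (pos_dim p) dimB).
set γ := pos_sub (fun k p => dec nm (f k p)).
have γok : sub_ok Γ γ (ctx_of B).
  apply: sub_ok_intro => //; first exact: ssize_pos_sub.
  move=> x A /cget_ctx_of_inv[k [p [-> ->]]]; rewrite sget_pos_sub -(cty_face nm p fP).
  exact: fok.
have cond : coh_cond (pasting_ctx_of B) (cty (free_att (Pos B)) (@pname B) a)
    (dec (@pname B) a) (dec (@pname B) b).
  apply/(coh_cond_full _ ac bc ab) => // y; first exact: vars_cty.
  by rewrite (cty_parallel _ ab); apply: vars_cty.
have γE l (q : Pos B l) : sget γ (pname q) = dec nm (f l q) by rewrite sget_pos_sub.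
have := ok_coh aok bok γok cond.
rewrite /= (inferE aok) -(cty_bind fP γE) -!(dec_bind γE).
by [].
Qed.

(** In contrast to [bdry_cell], the predicate is given in a single dimension. *)
Lemma cell_caseS V n (P : cell V n.+1 -> Prop) :
  (forall v, P (cvar v)) -> (forall B (a b : cell (Pos B) n) f, P (ccoh a b f)) ->
  forall c, P c.
Proof.
move=> Pv Pc c; move: P Pv Pc.
pose Q m : cell V m -> Prop := match m with
  | 0 => fun _ => True
  | m.+1 => fun c => forall P : cell V m.+1 -> Prop, (forall v, P (cvar v)) ->
      (forall B (a b : cell (Pos B) m) f, P (ccoh a b f)) -> P c
  end.
suff : Q n.+1 c by [].
by case: c => [[|m] v|m B a b f] //= P Pv Pc.
Qed.

(** Equal coherence terms have equal contexts, hence equal trees by [ctx_of_inj]; the image of a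
    position is then the entry of the substitution at its name. *)
Lemma dec_inj V n (c c' : cell V n) (nm : forall n, V n -> nat) :
  (forall n, injective (nm n)) -> dec nm c = dec nm c' -> c = c'.
Proof.
elim: c c' nm => [{}V {}n v|{}V {}n B a IHa b IHb f IHf] c' nm inj.
  by case: c' v => //= m w v [/inj->].
elim/cell_caseS: c' => //= B' a' b' f' [/ctx_of_inj eB].
subst B' => _ ea eb ef.
have injB := @pname_inj_dim B.
rewrite (IHa _ _ injB ea) (IHb _ _ injB eb); apply: ccoh_eq => k p.
apply: IHf inj _; have := congr1 (fun γ => sget γ (pname p)) ef.
by rewrite !sget_pos_sub.
Qed.

Lemma sub_ext γ δ : ssize γ = ssize δ ->
  (forall x, x < ssize γ -> sget γ x = sget δ x) -> γ = δ.
Proof.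
elim: γ δ => [|γ IH t] [|δ s] //= [sz] H.
congr scons; last by have := H _ (ltnSn _); rewrite sz eqxx.
apply: IH => // x lt; have := H x (ltnW lt).
by rewrite -sz ltn_eqF.
Qed.

Lemma pos_sub_sget B γ : ssize γ = csize (ctx_of B) ->
  pos_sub (fun k (p : Pos B k) => sget γ (pname p)) = γ.
Proof.
move=> sz; apply: sub_ext; rewrite ssize_pos_sub // size_ctx_of => x.
by move/pname_surj => [k [p <-]]; rewrite sget_pos_sub.
Qed.

Lemma height_sub A γ : ty_height (ty_sub A γ) = ty_height A.
Proof. by elim: A => //= A ->. Qed.

Lemma cty_parallel_inv V (phi : attaching V) nm n (a b : cell V n) :
  (forall n, injective (nm n)) -> cty phi nm a = cty phi nm b -> parallel phi a b.
Proof.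
move=> inj; case: n a b => //= n a b [_ e1 e2].
rewrite [LHS]surjective_pairing [RHS]surjective_pairing.
by congr pair; [exact: dec_inj e1|exact: dec_inj e2].
Qed.

(** A type-preserving bijection between generators and variables, which makes [C] a model of [R Γ].
    The properties of the decoding use nothing else about [R Γ]. *)
Record naming (Γ : ctx) (C : computad) (nm : forall n, gen C n -> nat) : Prop := {
  naming_ok : ctx_ok Γ;
  naming_inj : forall n m (v : gen C n) (w : gen C m), nm n v = nm m w ->
    existT (gen C) n v = existT (gen C) m w;
  naming_ty : forall n (v : gen C n), cget Γ (nm n v) = Some (cty (att C) nm (cvar v));
  naming_surj : forall x A, cget Γ x = Some A -> exists n (v : gen C n), nm n v = x }.
Arguments naming Γ C nm : clear implicits.

Lemma naming_pos B : naming (ctx_of B) (Free (Pos B)) (@pname B).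
Proof.
split; first exact: ctx_of_ok.
- by move=> n m p q /pname_inj.
- by move=> n p; apply: (@declares_pos n B).
- by move=> x A /cget_ctx_of_inv[n [p [-> _]]]; exists n, p.
Qed.

Section Good.
Variables (Γ : ctx) (C : computad) (nm : forall n, gen C n -> nat).
Hypothesis gG : naming Γ C nm.

Lemma naming_nm_inj n : injective (@nm n).
Proof. by move=> v w e; apply: inj_pair2 (naming_inj gG e). Qed.

Lemma naming_dec_inj n (c c' : cell (gen C) n) : dec nm c = dec nm c' -> c = c'.
Proof. exact/dec_inj/naming_nm_inj. Qed.

Lemma naming_dec_ok n (c : cell (gen C) n) : is_cell (att C) c ->
  tm_ok Γ (dec nm c) (cty (att C) nm c).
Proof.
apply: dec_ok; [exact: attP|exact: naming_ok gG|].
by move=> m v _; apply: naming_ty gG _ _.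
Qed.

Lemma naming_cty n (c : cell (gen C) n) A : is_cell (att C) c ->
  tm_ok Γ (dec nm c) A -> cty (att C) nm c = A.
Proof. by move/naming_dec_ok/inferE => <- /inferE. Qed.

End Good.

(** The hypothesis on [γ] is discharged below by surjectivity of [dec], in whose
    proof this lemma is itself needed. *)
Lemma sub_realize Γ C nm Δ D nmD γ :
  naming Γ C nm -> naming Δ D nmD -> sub_ok Δ γ Γ ->
  (forall x A, cget Γ x = Some A ->
     exists n (c : cell (gen D) n), is_cell (att D) c /\ dec nmD c = sget γ x) ->
  exists f : cmor C D, forall n v, dec nmD (cmap f v) = sget γ (nm n v).
Proof.
move=> gG gD γok surj.
have fEx k (v : gen C k) : exists c : cell (gen D) k,
    [/\ is_cell (att D) c, dec nmD c = sget γ (nm k v) &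
        cty (att D) nmD c = ty_sub (cty (att C) nm (cvar v)) γ].
  have vT := naming_ty gG v; have [l [c [cc cE]]] := surj _ _ vT.
  have := tm_ok_sget γok vT; rewrite -cE => /(naming_cty gD cc) cT.
  have kl : k = l by rewrite -(height_cty (att D) nmD c) cT height_sub height_cty.
  by subst l; exists c.
pose f k v := proj1_sig (constructive_indefinite_description _ (fEx k v)).
have fP k v : [/\ is_cell (att D) (f k v), dec nmD (f k v) = sget γ (nm k v) &
    cty (att D) nmD (f k v) = ty_sub (cty (att C) nm (cvar v)) γ].
  by rewrite /f; case: constructive_indefinite_description.
have fdec k (c : cell (gen C) k) : dec nmD (bind f c) = tm_sub (dec nm c) γ.
  by apply: dec_bind => l v; case: (fP l v).
have fcell k v : is_cell (att D) (f k v) by case: (fP k v).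
have fbd k (v : gen C k.+1) : bdry (att D) (f k.+1 v) = bind2 f (att C v).
  have [_ _ [_ e1 e2]] := fP _ v.
  rewrite [LHS]surjective_pairing; congr pair; apply: (naming_dec_inj gD).
    by rewrite fdec -e1.
  by rewrite fdec -e2.
by exists (CMor fcell fbd) => n v; case: (fP n v).
Qed.

(** For (coh), the tree comes from [pasting_ctx], the sphere from the induction hypotheses over
    [naming_pos], its fullness from the side condition, and the morphism from [sub_realize]. *)
Lemma dec_surj :
  (forall Γ, ctx_ok Γ -> True) /\
  (forall Γ A, ty_ok Γ A -> True) /\
  (forall Γ t A, tm_ok Γ t A -> forall C nm, naming Γ C nm ->
    exists n (c : cell (gen C) n), is_cell (att C) c /\ dec nm c = t) /\
  (forall Δ γ Γ, sub_ok Δ γ Γ -> forall C nm, naming Δ C nm ->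
    forall x A, cget Γ x = Some A ->
    exists n (c : cell (gen C) n), is_cell (att C) c /\ dec nm c = sget γ x).
Proof.
apply: judgement_ind => //.
- move=> Γ x A okG _ xA C nm gG; have [n [v <-]] := naming_surj gG xA.
  by exists n, (cvar v).
- move=> Γ Δ d A u v γ uok IHu vok IHv γok IHγ cond C nm gD.
  have [B eB] := pasting_ctx d; subst Γ.
  have gB := naming_pos B.
  have [n [a [ac aE]]] := IHu _ _ gB; have [m [b [bc bE]]] := IHv _ _ gB.
  have aT : cty (att (Free (Pos B))) (@pname B) a = A by apply: (naming_cty gB ac); rewrite aE.
  have bT : cty (att (Free (Pos B))) (@pname B) b = A by apply: (naming_cty gB bc); rewrite bE.
  have mn : m = n by rewrite -(height_cty (att (Free (Pos B))) (@pname B) a) aT -bT height_cty.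
  subst m; have ab : parallel (free_att (Pos B)) a b.
    by apply: (cty_parallel_inv (nm := @pname B)); [exact: naming_nm_inj gB
      |rewrite [LHS]aT [RHS]bT].
  have phiB := @free_attP (Pos B).
  have [dimB fab] : bat_dim B <= n.+1 /\ full a b.
    apply: (coh_cond_full (A := A) (u := u) (v := v) d ac bc ab _ _).1 cond => y.
      by rewrite -aE -aT; apply: vars_cty.
    by rewrite -bE -bT; apply: vars_cty.
  have [f fE] := sub_realize gB gD γok (IHγ _ _ gD).
  exists n.+1, (ccoh a b (cmap f)); split.
    by split=> // k p; [exact: cmap_cell|exact: cmap_bdry].
  rewrite /= aE bE (inferE uok); congr coh.
  have [_ sz] := ok_vars.2.2.2 _ _ _ γok; rewrite -[RHS](pos_sub_sget sz).
  by apply: eq_pos_sub => k p; apply: fE.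
- move=> Δ Γ γ A t γok IHγ okA _ tok IHt C nm gD x T /=.
  have [_ ->] := ok_vars.2.2.2 _ _ _ γok.
  by case: eqP => _ xT; [apply: IHt|apply: IHγ xT].
Qed.

Lemma naming_dec_surj Γ C nm t A : naming Γ C nm -> tm_ok Γ t A ->
  exists c : cell (gen C) (ty_height A),
    [/\ is_cell (att C) c, dec nm c = t & cty (att C) nm c = A].
Proof.
move=> gG tok; have [n [c [cc cE]]] := dec_surj.2.2.1 _ _ _ tok _ _ gG.
have cT : cty (att C) nm c = A by apply: (naming_cty gG cc); rewrite cE.
have nE : n = ty_height A by rewrite -cT height_cty.
by subst n; exists c.
Qed.

(** * Types, terms and morphisms *)

Section DecodeTypes.
Variables (C : computad) (nm : forall n, gen C n -> nat).

(** Only the two top cells of the sphere are read; they determine it by [sphere_mor_eq]. *)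
Definition sphere_ty n : cmor (Free (gsphere n)) C -> ty :=
  match n with
  | 0 => fun _ => star
  | m.+1 => fun f =>
    let c e : cell (gen C) m := cmap f (Face e (ltnSn m) : gsphere m.+1 m) in
    arr (cty (att C) nm (c false)) (dec nm (c false)) (dec nm (c true))
  end.

Definition dty (T : ctype C) : ty := sphere_ty (projT2 T).

Definition dtm (T : ctype C) (c : cterm T) : tm := dec nm (top_cell (sval c)).

Lemma height_dty T : ty_height (dty T) = projT1 T.
Proof. by case: T => -[|n] f //=; rewrite height_cty. Qed.

Lemma cty_top T (c : cterm T) : cty (att C) nm (top_cell (sval c)) = dty T.
Proof.
case: T c => -[|n] f [c cf] //=.
have faceE e : bdc e (att C) (top_cell c) =
    cmap f (Face e (ltnSn n) : gsphere n.+1 n).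
  rewrite /bdc /top_cell cmap_bdry -(congr1 (fun g => cmap g _) cf) /=.
  by case: e; rewrite (face_eq _ (top_lt _) (ltnSn n)).
by rewrite /dty /= !faceE.
Qed.

Lemma is_cell_top T (c : cterm T) : is_cell (att C) (top_cell (sval c)).
Proof. exact: cmap_cell. Qed.

Lemma top_carr T (c c' : cterm T) e :
  cmap (projT2 (carr c c')) (Face e (ltnSn _) : gsphere _ (projT1 T)) =
  @top_cell C (projT1 T) (if e then sval c' else sval c).
Proof.
rewrite /carr /= /top_cell; case: {-}_ / idP => [lt|ge]; first by have := lt; rewrite ltnn.
by rewrite (bool_irrelevance (face_top _ _) (eqxx _)); case: e.
Qed.

Lemma dty_carr T (c c' : cterm T) : dty (carr c c') = arr (dty T) (dtm c) (dtm c').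
Proof.
rewrite -(cty_top c) /dtm; congr arr.
- exact: (congr1 (@cty _ (att C) nm _) (top_carr c c' false)).
- exact: (congr1 (@dec _ nm _) (top_carr c c' false)).
- exact: (congr1 (@dec _ nm _) (top_carr c c' true)).
Qed.

End DecodeTypes.

Lemma mor_compat C D (f : cmor C D) : compat (att C) (att D) (cmap f).
Proof. by move=> n v; apply: cmap_bdry. Qed.

Section Naturality.
Variables (C D : computad).
Variables (nmC : forall n, gen C n -> nat) (nmD : forall n, gen D n -> nat).
Variables (f : cmor C D) (γ : sub).
Hypothesis fE : forall n (v : gen C n), sget γ (nmC v) = dec nmD (cmap f v).

Lemma dty_sub T : dty nmD (ctype_sub f T) = ty_sub (dty nmC T) γ.
Proof.
case: T => -[|n] g //=; rewrite /dty /=.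
by rewrite (cty_bind (mor_compat f) fE) !(dec_bind fE).
Qed.

Lemma dtm_sub T (c : cterm T) : dtm nmD (cterm_sub f c) = tm_sub (dtm nmC c) γ.
Proof. exact: dec_bind fE _ _. Qed.

End Naturality.

Lemma cget_ok Γ x A : ctx_ok Γ -> cget Γ x = Some A -> ty_ok Γ A.
Proof.
elim: Γ => //= Γ IH B ok; have okB : ty_ok Γ B by inversion ok.
case: eqP => [_ [<-]|_ xA]; apply: (weaken B).2.1 => //.
exact: IH (ty_ok_ctx okB) xA.
Qed.

Lemma tm_ok_ty :
  (forall Γ, ctx_ok Γ -> True) /\
  (forall Γ A, ty_ok Γ A -> True) /\
  (forall Γ t A, tm_ok Γ t A -> ty_ok Γ A) /\
  (forall Δ γ Γ, sub_ok Δ γ Γ -> True).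
Proof.
apply: judgement_ind => //; first by move=> Γ x A okG _; apply: cget_ok.
move=> Γ Δ d A u v γ uok okA vok _ γok _ _.
by apply: sub_typed.2.1 γok; constructor.
Qed.

Section GoodTypes.
Variables (Γ : ctx) (C : computad) (nm : forall n, gen C n -> nat).
Hypothesis gG : naming Γ C nm.

(** Descending induction on the dimension: each lower face is a source or target of a face one
    dimension up. *)
Lemma sphere_mor_eq n (f g : cmor (Free (gsphere n.+1)) C) :
  (forall e, cmap f (Face e (ltnSn n) : gsphere n.+1 n) =
             cmap g (Face e (ltnSn n) : gsphere n.+1 n)) -> f = g.
Proof.
move=> fg; apply: cmor_eq => k [e lt].
move: {2}(n - k) (erefl (n - k)) => j; elim: j k e lt => [|j IH] k e lt jE.
  have kn : k = n by lia.
  by subst k; rewrite (face_eq e lt (ltnSn n)).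
have lt' : k.+1 < n.+1 by lia.
have := IH k.+1 false lt' ltac:(lia) => /(congr1 (@bdc e _ (att C) k)).
by rewrite /bdc !cmap_bdry /=; case: e; rewrite (face_eq _ (ltnW lt') lt).
Qed.

Lemma dty_inj T T' : dty nm T = dty nm T' -> T = T'.
Proof.
move=> e; have := congr1 ty_height e; rewrite !height_dty.
case: T T' e => n f [n' f'] /= e en; subst n'; congr existT.
case: n f f' e => [|n] f f' e; first by apply: cmor_eq => k [].
case: e => _ e0 e1; apply: sphere_mor_eq => -[]; exact: (naming_dec_inj gG).
Qed.

Lemma cterm_eq (T : ctype C) (c c' : cterm T) : top_cell (sval c) = top_cell (sval c') -> c = c'.
Proof.
move=> e; apply: sig_eq; apply: cmor_eq => k [y|lt].
  have bdE (c0 : cterm T) : cmap (sval c0) (inl y : gdisk _ k) =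
      cmap (projT2 T) (y : gsphere _ k) by rewrite -[in RHS](svalP c0).
  by rewrite [LHS]bdE [RHS]bdE.
have kn := eqP lt; subst k; by rewrite (bool_irrelevance lt (eqxx _)).
Qed.

Lemma dtm_inj T (c c' : cterm T) : dtm nm c = dtm nm c' -> c = c'.
Proof. by move/(naming_dec_inj gG)/cterm_eq. Qed.

Lemma ctot_dec_eq T T' (c : cterm T) (c' : cterm T') :
  dty nm T = dty nm T' -> dtm nm c = dtm nm c' -> ctot c = ctot c'.
Proof. by move=> /dty_inj e; subst T' => /dtm_inj ->. Qed.

Lemma dtm_ok T (c : cterm T) : tm_ok Γ (dtm nm c) (dty nm T).
Proof. by rewrite -(cty_top nm c); apply: (naming_dec_ok gG); apply: is_cell_top. Qed.

Lemma cterm_of_cell (T : ctype C) (c : cell (gen C) (projT1 T)) :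
  is_cell (att C) c -> cty (att C) nm c = dty nm T ->
  exists d : cterm T, top_cell (sval d) = c.
Proof.
case: T c => n f /= c cc cT.
(* The extra cell of the disk exists only in dimension [n], where [c] is transported along its proof
   of [k = n]. *)
pose g k (x : gdisk n k) : cell (gen C) k :=
  match x with
  | inl y => cmap f y
  | inr e => eq_rect n (cell (gen C)) c k (esym (eqP e))
  end.
have gcell k (x : gdisk n k) : is_cell (att C) (g k x).
  case: x => [y|e]; first exact: cmap_cell.
  by have kn := eqP e; subst n; rewrite /g (eq_irrelevance (esym (eqP e)) erefl).
have gbd k (x : gdisk n k.+1) : bdry (att C) (g k.+1 x) = bind2 g (free_att (gdisk n) k x).
  case: x => [y|e]; first exact: cmap_bdry.
  have kn := eqP e; subst n.
  have -> : g k.+1 (inr e) = c by rewrite /g (eq_irrelevance (esym (eqP e)) erefl).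
  case: cT => _ e0 e1; rewrite [LHS]surjective_pairing; congr pair; apply: (naming_dec_inj gG).
    by rewrite [LHS]e0 /=; rewrite (face_eq _ (top_lt e) (ltnSn k)).
  by rewrite [LHS]e1 /=; rewrite (face_eq _ (top_lt e) (ltnSn k)).
pose d : cmor (Free (gdisk n)) C := @CMor (Free (gdisk n)) C g gcell gbd.
have dP : ccomp d (Free_map (giota n)) = f by apply: cmor_eq.
exists (exist _ d dP).
by rewrite /top_cell /= (eq_irrelevance (esym (eqP (eqxx n))) erefl).
Qed.

Lemma dtm_surj T t : tm_ok Γ t (dty nm T) -> exists c : cterm T, dtm nm c = t.
Proof.
move=> tok; have [c [cc cE cT]] := naming_dec_surj gG tok.
move: c cc cE cT; rewrite height_dty => c cc cE cT.
by have [d dE] := cterm_of_cell cc cT; exists d; rewrite /dtm dE.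
Qed.

Lemma dty_surj A : ty_ok Γ A -> exists T : ctype C, dty nm T = A.
Proof.
elim: A => [|A IH u v] okA; first by exists (cstar C).
have [okA' uok vok] : [/\ ty_ok Γ A, tm_ok Γ u A & tm_ok Γ v A] by inversion okA.
have [T TA] := IH okA'; rewrite -TA in uok vok.
have [c cE] := dtm_surj uok; have [c' cE'] := dtm_surj vok.
by exists (carr c c'); rewrite dty_carr TA cE cE'.
Qed.

Lemma dty_ok T : ty_ok Γ (dty nm T).
Proof.
case: T => -[|n] f; first by apply: ok_star; apply: naming_ok gG.
have fok e := naming_dec_ok gG (cmap_cell f (Face e (ltnSn n) : gsphere n.+1 n)).
have tyE : cty (att C) nm (cmap f (Face true (ltnSn n) : gsphere n.+1 n)) =
    cty (att C) nm (cmap f (Face false (ltnSn n) : gsphere n.+1 n)).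
  have [_ _] := @sphere_faces C (existT _ n.+1 f) n (ltnSn n).
  by move/cty_parallel => /= /(_ nm) ->.
constructor; [|exact: fok|by rewrite -tyE; apply: fok].
exact: tm_ok_ty.2.2.1 (fok false).
Qed.

End GoodTypes.

Definition nm_ext C (nm : forall n, gen C n -> nat) (T : ctype C) (m : nat) k
    (x : gen (cext T) k) : nat :=
  match x with inl v => nm k v | inr _ => m end.

Lemma nm_ext_proj Γ C (nm : forall n, gen C n -> nat) (T : ctype C) m n (v : gen C n) :
  sget (sid Γ) (nm n v) = dec (@nm_ext C nm T m) (cmap (ext_proj T) v).
Proof. by rewrite sget_sid. Qed.

Lemma naming_ext Γ C nm (T : ctype C) A : naming Γ C nm -> dty nm T = A ->
  naming (ccons Γ A) (cext T) (@nm_ext C nm T (csize Γ)).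
Proof.
move=> gG TA; have okA := dty_ok gG T; rewrite TA in okA.
have lt n (v : gen C n) : nm n v < csize Γ by apply: cget_lt (naming_ty gG v).
split; first by constructor.
- move=> n m [v|e] [w|e'] /= E.
  + exact: (congr1 (fun p : {n & gen C n} =>
      existT (gen (cext T)) (projT1 p) (inl (projT2 p))) (naming_inj gG E)).
  + by have := lt _ v; rewrite E ltnn.
  + by have := lt _ w; rewrite -E ltnn.
  + have en := eqP e; have em := eqP e'; subst n m.
    by rewrite (bool_irrelevance e e').
- move=> n [v|e] /=.
  + rewrite ltn_eqF ?lt // (naming_ty gG v).
    have := cty_bind (mor_compat (ext_proj T)) (nm_ext_proj Γ nm T (csize Γ)) (cvar v).
    by rewrite (sub_sid Γ).1 => <-.
  + rewrite eqxx; have en := eqP e; subst n; rewrite (bool_irrelevance e (eqxx _)).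
    have := cty_top (@nm_ext C nm T (csize Γ)) (ext_var T).
    rewrite {1}/top_cell /= => ->.
    by rewrite (dty_sub (nm_ext_proj Γ nm T (csize Γ))) (sub_sid Γ).1 TA.
- move=> x B /=; case: eqP => [-> _|_ /(naming_surj gG)[n [v <-]]].
    by exists (projT1 T), (inr (eqxx _)).
  by exists n, (inl v).
Qed.

Lemma cget_some Γ x : x < csize Γ -> exists A, cget Γ x = Some A.
Proof.
elim: Γ => //= Γ IH A; rewrite ltnS leq_eqVlt; case: eqP => /= [_ _|_ /IH //].
by exists A.
Qed.

Section Homs.
Variables (Γ Δ : ctx) (C D : computad).
Variables (nmC : forall n, gen C n -> nat) (nmD : forall n, gen D n -> nat).
Hypotheses (gC : naming Γ C nmC) (gD : naming Δ D nmD).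

(** The substitution goes from [Δ] to [Γ], opposite to [f], since [R] takes values in the opposite
    category. *)
Definition represents (f : cmor C D) (γ : sub) : Prop :=
  forall n (v : gen C n), sget γ (nmC v) = dec nmD (cmap f v).

Lemma mor_of_sub γ : sub_ok Δ γ Γ -> exists f, represents f γ.
Proof.
move=> γok; have [f fE] := sub_realize gC gD γok (dec_surj.2.2.2 _ _ _ γok _ _ gD).
by exists f => n v.
Qed.

Lemma sub_of_mor f : exists2 γ, sub_ok Δ γ Γ & represents f γ.
Proof.
(* Numbers that name no generator receive the arbitrary value [var 0]. *)
have tEx x : exists t, forall n (v : gen C n), nmC v = x -> t = dec nmD (cmap f v).
  have [[n [v vx]]|nv] := classic (exists n (v : gen C n), nmC v = x); last first.
    by exists (var 0) => n v vx; case: nv; exists n, v.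
  exists (dec nmD (cmap f v)) => m w; rewrite -vx => /(naming_inj gC).
  by move/(congr1 (fun p : {n & gen C n} => dec nmD (cmap f (projT2 p)))).
pose t x := proj1_sig (constructive_indefinite_description _ (tEx x)).
have tE n (v : gen C n) : t (nmC v) = dec nmD (cmap f v).
  by rewrite /t; case: constructive_indefinite_description => s /=; apply.
have lt n (v : gen C n) : nmC v < csize Γ by apply: cget_lt (naming_ty gC v).
have rep : represents f (mksub (mkseq t (csize Γ))).
  by move=> n v; rewrite sget_mksub nth_mkseq.
exists (mksub (mkseq t (csize Γ))) => //.
apply: sub_ok_intro; [exact: naming_ok gD|exact: naming_ok gC|by rewrite ssize_mksub size_mkseq|].
move=> x A xA; have [n [v vx]] := naming_surj gC xA; subst x.
move: xA; rewrite (naming_ty gC v) rep => -[<-].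
rewrite -(cty_bind (mor_compat f) rep); apply: (naming_dec_ok gD); exact: cmap_cell.
Qed.

Lemma represents_sub f γ γ' : sub_ok Δ γ Γ -> sub_ok Δ γ' Γ ->
  represents f γ -> represents f γ' -> γ = γ'.
Proof.
move=> /ok_vars.2.2.2[_ s] /ok_vars.2.2.2[_ s'] r r'; apply: sub_ext; first by rewrite s s'.
rewrite s => x /cget_some[A xA].
by have [n [v <-]] := naming_surj gC xA; rewrite r r'.
Qed.

Lemma represents_mor f g γ : represents f γ -> represents g γ -> f = g.
Proof.
by move=> rf rg; apply: cmor_eq => n v; apply: (naming_dec_inj gD); rewrite -rf -rg.
Qed.

End Homs.

Lemma represents_id Γ C nm : naming Γ C nm -> represents nm nm (cid C) (sid Γ).
Proof. by move=> gG n v; rewrite sget_sid. Qed.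

Lemma represents_comp Γ C (nmC : forall n, gen C n -> nat) D (nmD : forall n, gen D n -> nat)
    E (nmE : forall n, gen E n -> nat) (f : cmor C D) (g : cmor D E) γ δ :
  naming Γ C nmC -> ssize γ = csize Γ ->
  represents nmC nmD f γ -> represents nmD nmE g δ ->
  represents nmC nmE (ccomp g f) (sub_comp γ δ).
Proof.
move=> gC sz rf rg n v; rewrite sget_comp ?sz ?(cget_lt (naming_ty gC v)) //.
by rewrite rf -(dec_bind rg).
Qed.

Lemma naming_dec_sig_inj Γ C nm n m (c : cell (gen C) n) (c' : cell (gen C) m) :
  naming Γ C nm -> is_cell (att C) c -> is_cell (att C) c' -> dec nm c = dec nm c' ->
  existT (cell (gen C)) n c = existT (cell (gen C)) m c'.
Proof.
move=> gG cc cc' e; have := naming_dec_ok gG cc; rewrite e => /(naming_cty gG cc') cT.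
have nm' : n = m by rewrite -(height_cty (att C) nm c) -cT height_cty.
by subst m; rewrite (naming_dec_inj gG e).
Qed.

Definition ps_cell Θ (d : pasting Θ) n x (hx : has_dim Θ n x) : ps_gset d n :=
  exist (fun x => is_true (has_dim Θ n x)) x hx.

Lemma dec_var V (nm : forall n, V n -> nat) n (c : cell V n) y :
  dec nm c = var y -> exists2 w : V n, c = cvar w & nm n w = y.
Proof. by case: c => // m w [wy]; exists w. Qed.

(** * The coherence clause under the decoding *)

Section CohClause.
Variables (Θ : ctx) (C : computad) (nmC : forall n, gen C n -> nat).
Hypothesis gC : naming Θ C nmC.
Variables (d : pasting Θ) (k : cmor (Free (ps_gset d)) C) (k' : cmor C (Free (ps_gset d))).
Hypothesis k'k : ccomp k' k = cid _.
Hypothesis kE : forall n (x : ps_gset d n), dec nmC (cmap k x) = var (sval x).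
Variables (B : bat) (r : gmor (ps_gset d) (Pos B)) (r' : gmor (Pos B) (ps_gset d)).
Hypothesis rr' : ginverse r r'.

Lemma has_dimE n x : has_dim Θ n x <-> exists2 A, cget Θ x = Some A & ty_height A = n.
Proof.
rewrite /has_dim; split; last by case=> A -> /eqP.
by case: (cget Θ x) => // A /eqP hA; exists A.
Qed.

(** By rigidity, any tree whose positions are isomorphic to the variables of [Θ] is the tree of [Θ],
    and the isomorphism is the canonical naming. The existential choices in [R_coh_clause] are thus
    harmless. *)
Lemma pasting_names : Θ = ctx_of B /\ forall n (p : Pos B n), sval (r' n p) = pname p.
Proof.
have [B0 eB] := pasting_ctx d.
have inv x A : cget Θ x = Some A ->
    exists n (p : Pos B0 n), x = pname p /\ A = gty (@pname B0) star p.
  by rewrite eB; apply: cget_ctx_of_inv.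
have fwd n (p : Pos B0 n) : cget Θ (pname p) = Some (gty (@pname B0) star p).
  by rewrite eB; apply: cget_ctx_of.
have [|e0 nE] := @pos_rigid B B0 (fun n p q => sval (r' n p) = pname q); last first.
  subst B0; split=> // n p; have := svalP (r' n p).
  move/has_dimE => [A /inv[m [q [xq ->]]]].
  rewrite height_gty => mn; subst m; rewrite xq.
  by rewrite /pname (nE _ p q xq).
have r'inj n (p q : Pos B n) : sval (r' n p) = sval (r' n q) -> p = q.
  by move=> /sig_eq e; rewrite -(rr'.2 n p) e rr'.2.
split.
- move=> n p; have := svalP (r' n p); move/has_dimE => [A /inv[m [q [xq ->]]]].
  rewrite height_gty => mn; subst m.
  by exists q.
- move=> n q; have hq : has_dim Θ n (pname q).
    apply/has_dimE; exists (gty (@pname B0) star q); last exact: height_gty.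
    exact: fwd.
  by exists (r n (ps_cell d hq)); rewrite rr'.1.
- by move=> n p q q' e e'; apply: pname_inj_dim; rewrite -e -e'.
- by move=> n p p' q e e'; apply: r'inj; rewrite e e'.
- move=> e n p q pq.
  have -> : r' n (gbd e p) = gbd e (r' n.+1 p).
    by case: e; rewrite /= ?gmap_src ?gmap_tgt.
  case: e => /=; by rewrite /var_src /var_tgt pq fwd.
Qed.

(** Under the decoding [f] becomes the identity substitution, and [g] becomes [γ] evaluated at the
    names of positions. *)
Lemma coh_clause_dec Δ D (nmD : forall n, gen D n -> nat) (h : cmor C D) γ
    n (a b : cell (gen C) n) A u v :
  naming Δ D nmD -> ssize γ = csize Θ -> represents nmC nmD h γ ->
  dec nmC a = u -> dec nmC b = v -> tm_ok Θ u A ->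
  let f := ccomp (Free_map r) k' in
  let g := ccomp h (ccomp k (Free_map r')) in
  dec nmD (ccoh (B := B) (bind (cmap f) a) (bind (cmap f) b) (cmap g)) =
  coh Θ (arr A u v) γ.
Proof.
move=> gD sz rep au bv uok f g; have [eB nE] := pasting_names.
have kvar m (x : ps_gset d m) : exists2 w : gen C m, cmap k x = cvar w & nmC w = sval x.
  exact: dec_var (kE x).
have fE m (w : gen C m) : dec (@pname B) (cmap f w) = var (nmC w).
  have wd : has_dim Θ m (nmC w).
    apply/has_dimE; exists (cty (att C) nmC (cvar w)); last exact: height_cty.
    exact (naming_ty gC w).
  have [w' w'E w'n] := kvar m (ps_cell d wd).
  have ww : w' = w := naming_nm_inj gC w'n; subst w'.
  have k'w : cmap k' w = cvar (ps_cell d wd).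
    have := congr1 (fun F : cmor (Free (ps_gset d)) _ => cmap F (ps_cell d wd)) k'k.
    by rewrite /= w'E.
  by rewrite /= k'w /= -nE rr'.1.
have gE m (p : Pos B m) : dec nmD (cmap g p) = sget γ (pname p).
  rewrite /=; have [w -> wE] := kvar m (r' m p).
  by rewrite /= -rep wE nE.
have fdec m (c : cell (gen C) m) : dec (@pname B) (bind (cmap f) c) = dec nmC c.
  rewrite (dec_bind (γ := sid Θ) (nmU := nmC)); first exact: (sub_sid Θ).2.1.
  by move=> l w; rewrite sget_sid fE.
rewrite /= !fdec au bv -eB (inferE uok); congr coh.
rewrite -[RHS](@pos_sub_sget B) ?sz -?eB //; exact: eq_pos_sub.
Qed.

End CohClause.

(** * Existence of [R] *)

Record interp (Γ : ctx) := Interp {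
  icomp :> computad;
  inm : forall n, gen icomp n -> nat;
  inaming : naming Γ icomp inm }.
Arguments inm {Γ} i [n] v.

Definition witness (T : Type) (P : T -> Prop) (H : exists x, P x) : T :=
  proj1_sig (constructive_indefinite_description P H).

Lemma witnessP (T : Type) (P : T -> Prop) (H : exists x, P x) : P (witness H).
Proof. by rewrite /witness; case: constructive_indefinite_description. Qed.

Lemma naming_empty : naming cnil cempty (fun n (v : void) => 0).
Proof. by split; [exact: ok_cnil|move=> n m []|move=> n []|]. Qed.

(** Types, terms and substitutions are interpreted by choosing preimages under the decoding, which
    are unique. Only contexts then require recursion. *)
Definition interp_ty Γ (I : interp Γ) A (ok : ty_ok Γ A) : ctype I :=
  witness (dty_surj (inaming I) ok).

Lemma interp_tyE Γ (I : interp Γ) A (ok : ty_ok Γ A) :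
  dty (@inm _ I) (interp_ty I ok) = A.
Proof. exact: (witnessP (dty_surj (inaming I) ok)). Qed.

Definition interp_ext Γ (I : interp Γ) A (ok : ty_ok Γ A) : interp (ccons Γ A) :=
  Interp (naming_ext (inaming I) (interp_tyE I ok)).

Lemma ctx_ok_ty Γ A : ctx_ok (ccons Γ A) -> ty_ok Γ A.
Proof. by move=> ok; inversion ok. Qed.

Fixpoint interp_ctx Γ : ctx_ok Γ -> interp Γ :=
  match Γ return ctx_ok Γ -> interp Γ with
  | cnil => fun _ => Interp naming_empty
  | ccons Γ A => fun ok =>
    interp_ext (interp_ctx (ty_ok_ctx (ctx_ok_ty ok))) (ctx_ok_ty ok)
  end.

Definition interp_mor Δ Γ (J : interp Δ) (I : interp Γ) γ (ok : sub_ok Δ γ Γ) :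
  cmor I J := witness (mor_of_sub (inaming I) (inaming J) ok).

Lemma interp_morE Δ Γ (J : interp Δ) (I : interp Γ) γ (ok : sub_ok Δ γ Γ) :
  represents (@inm _ I) (@inm _ J) (interp_mor J I ok) γ.
Proof. exact: (witnessP (mor_of_sub (inaming I) (inaming J) ok)). Qed.

Arguments interp_morE {Δ Γ J I γ} ok.

Lemma tm_ok_interp Γ (I : interp Γ) A (ok : ty_ok Γ A) t :
  tm_ok Γ t A -> tm_ok Γ t (dty (@inm _ I) (interp_ty I ok)).
Proof. by rewrite interp_tyE. Qed.

Definition interp_tm Γ (I : interp Γ) A (ok : ty_ok Γ A) t (tok : tm_ok Γ t A) :
  cterm (interp_ty I ok) := witness (dtm_surj (inaming I) (tm_ok_interp I ok tok)).

Lemma interp_tmE Γ (I : interp Γ) A (ok : ty_ok Γ A) t (tok : tm_ok Γ t A) :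
  dtm (@inm _ I) (interp_tm I ok tok) = t.
Proof. exact: (witnessP (dtm_surj (inaming I) (tm_ok_interp I ok tok))). Qed.

Definition R_ob (Γ : ob SCaTT) : interp (sval Γ) := interp_ctx (svalP Γ).

Definition R_hom (Δ Γ : ob SCaTT) (γ : hom Δ Γ) : cmor (R_ob Γ) (R_ob Δ) :=
  interp_mor (R_ob Δ) (R_ob Γ) (svalP γ).

Definition R_ty (Γ : ob SCaTT) (A : Ty Γ) : ctype (R_ob Γ) :=
  interp_ty (R_ob Γ) (svalP A).

Definition R_tm (Γ : ob SCaTT) (A : Ty Γ) (t : Tm A) : cterm (R_ty A) :=
  interp_tm (R_ob Γ) (svalP A) (svalP t).

Lemma size_sub_ok Δ γ Γ : sub_ok Δ γ Γ -> ssize γ = csize Γ.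
Proof. by move/ok_vars.2.2.2 => []. Qed.

(** The interpretation of an extended context is [interp_ext] only up to the choice of validity
    proofs; taking it as a variable [J] with an equation allows rewriting inside the dependent
    pair. *)
Lemma interp_ext_eq Γ (I : interp Γ) A (ok : ty_ok Γ A) (okw : sub_ok (ccons Γ A) (sid Γ) Γ)
    (okA' : ty_ok (ccons Γ A) (ty_sub A (sid Γ)))
    (okv : tm_ok (ccons Γ A) (var (csize Γ)) (ty_sub A (sid Γ)))
    (J : interp (ccons Γ A)) : J = interp_ext I ok ->
  existT (fun D : ob CompOp => (@hom CompOp D I * {B : ctype D & cterm B})%type)
    (icomp J) (interp_mor J I okw, ctot (interp_tm J okA' okv)) =
  existT _ (cext (interp_ty I ok)) (ext_proj (interp_ty I ok), ctot (ext_var (interp_ty I ok))).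
Proof.
move=> ->; congr existT; congr pair.
  have rep := @interp_morE _ _ (interp_ext I ok) I _ okw.
  exact: (represents_mor (inaming (interp_ext I ok)) rep (@nm_ext_proj Γ I _ _ (csize Γ))).
apply: (ctot_dec_eq (inaming (interp_ext I ok))).
  by rewrite interp_tyE (dty_sub (nm_ext_proj Γ _ _ (csize Γ))) interp_tyE.
by rewrite interp_tmE.
Qed.

Definition R_mor : cwf_mor SCaTT CompOp.
Proof.
refine (@CwFMor SCaTT CompOp (fun Γ => icomp (R_ob Γ)) R_hom _ _ _ R_ty R_tm _ _ _).
- move=> Γ; apply: (represents_mor (inaming (R_ob Γ)) (interp_morE _)).
  exact: represents_id (inaming (R_ob Γ)).
- move=> Ξ Δ Γ γ δ; apply: (represents_mor (inaming (R_ob Ξ)) (interp_morE _)).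
  apply: (represents_comp (inaming (R_ob Γ)) _ (interp_morE _) (interp_morE _)).
  exact: size_sub_ok (svalP γ).
- by [].
- move=> Δ Γ γ A; apply: (dty_inj (inaming (R_ob Δ))).
  by rewrite interp_tyE [RHS](dty_sub (interp_morE (svalP γ))) interp_tyE.
- move=> Δ Γ γ A t; apply: (ctot_dec_eq (inaming (R_ob Δ))).
    by rewrite interp_tyE (dty_sub (interp_morE (svalP γ))) interp_tyE.
  by rewrite interp_tmE (dtm_sub (interp_morE (svalP γ))) interp_tmE.
- move=> Γ A; apply: interp_ext_eq.
  rewrite /R_ob /= /interp_ext.
  by rewrite (proof_irrelevance _ (ctx_ok_ty _) (svalP A))
    (proof_irrelevance _ (ty_ok_ctx _) (svalP Γ)).
Defined.

Lemma cterm_cell_eq Γ C nm (T : ctype C) (c : cterm T) n (c' : cell (gen C) n) :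
  naming Γ C nm -> ty_height (dty nm T) = n -> dtm nm c = dec nm c' ->
  cterm_cell c = existT _ n c'.
Proof.
rewrite height_dty => gG Tn; subst n => /(naming_dec_inj gG) <-.
by [].
Qed.

(** With [naming_iso] this yields the identification of [R Θ] with [Free (V Θ)], as both are named
    by [Θ]. *)
Lemma naming_free Θ C nm (d : pasting Θ) : naming Θ C nm ->
  naming Θ (Free (ps_gset d)) (fun n (x : ps_gset d n) => sval x).
Proof.
move=> gC.
have [B eB] := pasting_ctx d.
split; first exact: naming_ok gC.
- move=> n m x y xy; have /has_dimE[A xA hA] := svalP x.
  have /has_dimE[A' yA' hA'] := svalP y.
  have nm' : n = m by move: yA'; rewrite -xy xA -hA -hA' => -[->].
  by move: y xy {yA' hA'}; rewrite -nm' => y /sig_eq ->.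
- elim=> [|n IH] x.
    have /has_dimE[A xA hA] := svalP x; rewrite xA /=; by case: A hA {xA}.
  have [A [i [j [xE iA jA h]]]] := ps_var_bd d (svalP x).
  have sE : sval (gsrc x) = i by rewrite /= /var_src xE.
  have tE : sval (gtgt x) = j by rewrite /= /var_tgt xE.
  by move: iA; rewrite -sE (IH (gsrc x)) => -[AE]; rewrite xE -AE -sE -tE.
- move=> x A xA; exists (ty_height A).
  have hx : has_dim Θ (ty_height A) x by apply/has_dimE; exists A.
  by exists (ps_cell d hx).
Qed.

Lemma naming_iso Γ C D nmC nmD : naming Γ C nmC -> naming Γ D nmD ->
  exists (f : cmor C D) (g : cmor D C),
    [/\ ccomp g f = cid C, ccomp f g = cid D,
        represents nmC nmD f (sid Γ) & represents nmD nmC g (sid Γ)].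
Proof.
move=> gC gD; have idok := sub_ok_sid (naming_ok gC).
have [f rf] := mor_of_sub gC gD idok; have [g rg] := mor_of_sub gD gC idok.
have sz := size_sid Γ.
exists f, g; split=> //.
  apply: (represents_mor gC _ (represents_id gC)).
  by rewrite -[sid Γ](sub_sid Γ).2.2.2; apply: (represents_comp gC sz rf rg).
apply: (represents_mor gD _ (represents_id gD)).
by rewrite -[sid Γ](sub_sid Γ).2.2.2; apply: (represents_comp gD sz rg rf).
Qed.

Lemma ps_gset_iso Θ (d : pasting Θ) : exists (B : bat)
  (r : gmor (ps_gset d) (Pos B)) (r' : gmor (Pos B) (ps_gset d)), ginverse r r'.
Proof.
have [B eB] := pasting_ctx d; exists B.
have fwd n (p : Pos B n) : cget Θ (pname p) = Some (gty (@pname B) star p).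
  by rewrite eB; apply: cget_ctx_of.
have hd n (p : Pos B n) : has_dim Θ n (pname p).
  by apply/has_dimE; exists (gty (@pname B) star p) => //; apply: height_gty.
have rEx n (x : ps_gset d n) : exists p : Pos B n, pname p = sval x.
  have /has_dimE[A xA] := svalP x.
  have [m [p [xp ->]]] : exists m (p : Pos B m),
      sval x = pname p /\ A = gty (@pname B) star p.
    by apply: cget_ctx_of_inv; rewrite -eB.
  by rewrite height_gty => mn; subst m; exists p.
pose r n x := witness (rEx n x); pose r' n (p : Pos B n) := ps_cell d (hd n p).
have rE n x : pname (r n x) = sval x := witnessP (rEx n x).
have rs n (x : ps_gset d n.+1) : r n (gsrc x) = gsrc (r n.+1 x).
  by apply: pname_inj_dim; rewrite rE /= /var_src -rE fwd.
have rt n (x : ps_gset d n.+1) : r n (gtgt x) = gtgt (r n.+1 x).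
  by apply: pname_inj_dim; rewrite rE /= /var_tgt -rE fwd.
have r's n (p : Pos B n.+1) : r' n (gsrc p) = gsrc (r' n.+1 p).
  by apply: sig_eq; rewrite /= /var_src fwd.
have r't n (p : Pos B n.+1) : r' n (gtgt p) = gtgt (r' n.+1 p).
  by apply: sig_eq; rewrite /= /var_tgt fwd.
exists (GMor rs rt), (GMor r's r't); split=> n x /=.
  by apply: sig_eq; rewrite /= rE.
by apply: pname_inj_dim; rewrite rE.
Qed.

Lemma is_R_mor : is_R R_mor.
Proof.
split.
- move=> Γ T TE; apply: (dty_inj (inaming (R_ob Γ))).
  by rewrite [LHS]interp_tyE TE.
- move=> Γ A u v T TE; apply: (dty_inj (inaming (R_ob Γ))).
  rewrite [LHS]interp_tyE TE; apply/esym.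
  etransitivity; first exact: (dty_carr (@inm _ (R_ob Γ)) (R_tm u) (R_tm v)).
  by rewrite [dty _ _]interp_tyE !interp_tmE.
- move=> Δ Θ d A u v γ T t tE.
  have gD := inaming (R_ob Δ); have gT := inaming (R_ob Θ).
  have [k [k' [k'k kk' kE _]]] := naming_iso (naming_free d gT) gT.
  have [B [r [r' rr']]] := ps_gset_iso d.
  have kvar n (x : ps_gset d n) : dec (@inm _ (R_ob Θ)) (cmap k x) = var (sval x).
    by rewrite -kE sget_sid.
  exists k, k', B, r, r'; split=> //.
  + move=> n x X y yx; apply: (cterm_cell_eq gT); last by rewrite [LHS]interp_tmE yx kvar.
    rewrite [dty _ _]interp_tyE; have /has_dimE[A' xA' <-] := svalP x.
    by rewrite -(inferE (svalP y)) yx /= xA'.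
  + move=> f g; apply: (cterm_cell_eq gD).
      rewrite [dty _ _]interp_tyE -(inferE (svalP t)) tE /= height_sub.
      by rewrite -[sval A](interp_tyE (R_ob Θ) (svalP A)) height_dty.
    rewrite [LHS]interp_tmE tE; apply/esym; apply: (coh_clause_dec gT k'k kvar rr' gD).
    * exact: size_sub_ok (svalP γ).
    * exact: interp_morE (svalP γ).
    * exact: interp_tmE.
    * exact: interp_tmE.
    * exact: svalP u.
Qed.

(** * Morphisms satisfying the clauses of [R] *)

Section Uniqueness.
Variable R : cwf_mor SCaTT CompOp.
Hypothesis RP : is_R R.

Definition Rctx (Γ : ob SCaTT) : computad := fob R Γ.
Definition Rty (Γ : ob SCaTT) (A : Ty Γ) : ctype (Rctx Γ) := @fty SCaTT CompOp R Γ A.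
Definition Rtm (Γ : ob SCaTT) (A : Ty Γ) (t : Tm A) : cterm (Rty A) :=
  @ftm SCaTT CompOp R Γ A t.
Definition Rhom (Δ Γ : ob SCaTT) (γ : hom Δ Γ) : cmor (Rctx Γ) (Rctx Δ) :=
  @fhom SCaTT CompOp R Δ Γ γ.

Definition names (Γ : ob SCaTT) := forall n, gen (Rctx Γ) n -> nat.

(** Besides naming the generators of [R Γ], [nm] must agree with the action of [R] on variables. *)
Record Rnaming (Γ : ob SCaTT) (nm : names Γ) : Prop := {
  Rnaming_naming : naming (sval Γ) (Rctx Γ) nm;
  Rnaming_var : forall (X : Ty Γ) (y : Tm X) x, sval y = var x -> dtm nm (Rtm y) = var x }.

Lemma Rtm_sub Δ Γ (γ : hom Δ Γ) (A : Ty Γ) (t : Tm A) (nm : names Δ) :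
  dtm nm (Rtm (tmsub γ t)) = dtm nm (cterm_sub (Rhom γ) (Rtm t)).
Proof.
exact: (congr1 (fun p : {A : ctype (Rctx Δ) & cterm A} => dtm nm (projT2 p))
  (ftm_nat R γ t)).
Qed.

Lemma Rtm_tot Γ (A A' : Ty Γ) (t : Tm A) (t' : Tm A') (nm : names Γ) :
  sval A = sval A' -> sval t = sval t' -> dtm nm (Rtm t) = dtm nm (Rtm t').
Proof.
move=> eA et; have := tm_tot_eq eA et.
exact: (congr1 (fun p : {A : Ty Γ & Tm A} => dtm nm (Rtm (projT2 p)))).
Qed.

Lemma Rtm_sval Γ (A A' : Ty Γ) (t : Tm A) (t' : Tm A') (nm : names Γ) :
  sval t = sval t' -> dtm nm (Rtm t) = dtm nm (Rtm t').
Proof.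
move=> et; apply: Rtm_tot => //.
by rewrite -(inferE (svalP t)) -(inferE (svalP t')) et.
Qed.

Definition mk_ctx Γ (ok : ctx_ok Γ) : ob SCaTT := exist _ Γ ok.
Definition mk_ty (Γ : ob SCaTT) A (ok : ty_ok (sval Γ) A) : Ty Γ := exist _ A ok.
Definition mk_tm (Γ : ob SCaTT) (A : Ty Γ) t (ok : tm_ok (sval Γ) t (sval A)) : Tm A :=
  exist _ t ok.

(** Every generator of [R Γ] is the image of the variable it is named by, so naturality of [R] on
    terms computes [R γ] on it. *)
Lemma represents_Rhom Δ Γ (γ : hom Δ Γ) (nmD : names Δ) (nmG : names Γ) :
  Rnaming nmD -> Rnaming nmG ->
  (forall x (T : Ty Δ) (z : Tm T), x < csize (sval Γ) -> sval z = sget (sval γ) x ->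
     dtm nmD (Rtm z) = sget (sval γ) x) ->
  represents nmG nmD (Rhom γ) (sval γ).
Proof.
move=> gD gG H n v; have gG' := Rnaming_naming gG.
have vT := naming_ty gG' v.
have okT := cget_ok (naming_ok gG') vT.
have okv : tm_ok (sval Γ) (var (nmG n v)) (cty (att (Rctx Γ)) nmG (cvar v)).
  by constructor; [exact: naming_ok gG'|].
pose y := mk_tm (A := mk_ty okT) okv.
have lt := cget_lt vT.
rewrite -(H (nmG n v) _ (tmsub γ y)) // Rtm_sub.
have yv : dec nmG (top_cell (sval (Rtm y))) = dec nmG (cvar v) by apply: (Rnaming_var gG).
have yc : is_cell (att (Rctx Γ)) (top_cell (sval (Rtm y))) by apply: is_cell_top.
have := naming_dec_sig_inj gG' yc (c' := cvar v) I yv.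
exact: (congr1 (fun p : {n : nat & cell (gen (Rctx Γ)) n} =>
  dec nmD (bind (cmap (Rhom γ)) (projT2 p)))).
Qed.

Lemma Rnaming_empty (Γ : ob SCaTT) : sval Γ = cnil -> exists nm : names Γ, Rnaming nm.
Proof.
move=> eG; have -> : Γ = @emp SCaTT by apply: sig_eq.
have E : Rctx (@emp SCaTT) = cempty := fob_emp R.
have noget n : gen (Rctx (@emp SCaTT)) n -> False by rewrite E.
exists (fun n v => 0); split.
  split; [exact: ok_cnil|by move=> n m v; case: (noget _ v)| |by []].
  by move=> n v; case: (noget _ v).
by move=> X y x yx; have := svalP y; rewrite yx => H; inversion H.
Qed.

Lemma Rnaming_ext (Γ : ob SCaTT) (A : Ty Γ) (nm : names Γ) :
  Rnaming nm -> dty nm (Rty A) = sval A -> exists nm' : names (ext A), Rnaming nm'.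
Proof.
move=> gG TA; have gG' := Rnaming_naming gG.
have [nm' [gE wkE vzE]] : exists nm' : names (ext A),
    [/\ naming (ccons (sval Γ) (sval A)) (Rctx (ext A)) nm',
        represents nm nm' (Rhom (wk A)) (sid (sval Γ)) &
        dtm nm' (Rtm (vz A)) = var (csize (sval Γ))].
  have := fob_ext R A.
  rewrite /names /Rhom /Rctx /dtm /Rtm.
  (* Preservation of extensions equates two triples of computad, projection and generic term. As a
     predicate on triples, the claim can be transported from [cext]. *)
  pose Q (p : {Θ : computad & (cmor (Rctx Γ) Θ * {B : ctype Θ & cterm B})%type}) :=
    exists nm' : (forall n, gen (projT1 p) n -> nat),
    [/\ naming (ccons (sval Γ) (sval A)) (projT1 p) nm',
        represents nm nm' (projT2 p).1 (sid (sval Γ)) &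
        dtm nm' (projT2 (projT2 p).2) = var (csize (sval Γ))].
  move=> e; suff : Q (existT _ (cext (Rty A)) (ext_proj (Rty A), ctot (ext_var (Rty A)))).
    by move: e => /(congr1 Q) <-.
  exists (@nm_ext (Rctx Γ) nm (Rty A) (csize (sval Γ))); split=> //.
    exact: naming_ext gG' TA.
  exact: nm_ext_proj.
exists nm'; split=> // X y x yx.
have yok := svalP y; rewrite yx in yok.
have xX : cget (ccons (sval Γ) (sval A)) x = Some (sval X) by inversion yok.
move: (xX) => /=; case: eqP => [xs _|xs xX'].
  by rewrite (@Rtm_sval _ _ _ y (vz A)) ?vzE ?xs // yx xs.
(* An older variable is the weakening along [wk A] of the same variable of [Γ], so naturality of [R]
   reduces it to the naming of [Γ]. *)
have okX := cget_ok (naming_ok gG') xX'.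
have oky : tm_ok (sval Γ) (var x) (sval X) by constructor; [exact: naming_ok gG'|].
pose y0 := mk_tm (A := mk_ty okX) oky.
rewrite (@Rtm_sval _ _ _ y (tmsub (wk A) y0)); last by rewrite yx /= sget_sid.
by rewrite Rtm_sub (dtm_sub wkE) (Rnaming_var gG (y := y0) erefl) /= sget_sid.
Qed.

(** A morphism satisfying the clauses is a section of the decoding. Each judgement also delivers a
    naming of its ambient context, since the premise of context extension is only the validity of a
    type. *)
Lemma R_decodes :
  (forall Γ, ctx_ok Γ -> forall G : ob SCaTT, sval G = Γ -> exists nm : names G, Rnaming nm) /\
  (forall Γ A, ty_ok Γ A ->
     (forall G : ob SCaTT, sval G = Γ -> exists nm : names G, Rnaming nm) /\
     forall (G : ob SCaTT) (nm : names G) (T : Ty G), sval G = Γ -> Rnaming nm ->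
       sval T = A -> dty nm (Rty T) = A) /\
  (forall Γ t A, tm_ok Γ t A ->
     (forall G : ob SCaTT, sval G = Γ -> exists nm : names G, Rnaming nm) /\
     forall (G : ob SCaTT) (nm : names G) (T : Ty G) (y : Tm T), sval G = Γ -> Rnaming nm ->
       sval y = t -> dtm nm (Rtm y) = t) /\
  (forall Δ γ Γ, sub_ok Δ γ Γ ->
     (forall G : ob SCaTT, sval G = Δ -> exists nm : names G, Rnaming nm) /\
     forall (G : ob SCaTT) (nm : names G) x (T : Ty G) (y : Tm T), sval G = Δ -> Rnaming nm ->
       x < csize Γ -> sval y = sget γ x -> dtm nm (Rtm y) = sget γ x).
Proof.
apply: judgement_ind => //=.
- by move=> G; apply: Rnaming_empty.
- move=> Γ A okA [IHΓ IHA] G GE.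
  pose G0 := mk_ctx (ty_ok_ctx okA); pose A0 := mk_ty (Γ := G0) okA.
  have -> : G = ext A0 by apply: sig_eq.
  have [nm gG] := IHΓ G0 erefl.
  by apply: (Rnaming_ext gG); apply: IHA.
- move=> Γ okG IH; split=> // G nm T GE gG TE.
  by rewrite [Rty T](R_star RP TE).
- move=> Γ A u v okA [IHΓ IHA] uok [_ IHu] vok [_ IHv]; split=> // G nm T GE gG TE.
  subst Γ; pose A0 := mk_ty okA.
  have TE' : sval T = arr (sval A0) (sval (mk_tm (A := A0) uok)) (sval (mk_tm (A := A0) vok)) by [].
  rewrite [Rty T](R_arr RP TE'); etransitivity.
    exact: (dty_carr nm (Rtm (mk_tm (A := A0) uok)) (Rtm (mk_tm (A := A0) vok))).
  by rewrite (IHA _ nm A0) // IHu // IHv.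
- by move=> Γ x A okG IH xA; split=> // G nm T y GE gG /(Rnaming_var gG).
- move=> Θ Δ d A u v γ uok [IHΘ IHu] vok [_ IHv] γok [IHΔ IHγ] cond; split=> //.
  move=> G nm T y GE gG yE; subst Δ.
  have okΘ : ctx_ok Θ by case: (sub_ok_ctx γok).
  have [nmT gT] := IHΘ (mk_ctx okΘ) erefl; have gT' := Rnaming_naming gT.
  have okA := tm_ok_ty.2.2.1 _ _ _ uok.
  pose A0 := mk_ty (Γ := mk_ctx okΘ) okA.
  pose u0 := mk_tm (A := A0) uok; pose v0 := mk_tm (A := A0) vok.
  pose γ0 : @hom SCaTT G (mk_ctx okΘ) := exist _ γ γok.
  have rep : represents nmT nm (Rhom γ0) γ.
    by apply: (represents_Rhom gG gT) => x X z lt zx; apply: IHγ.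
  have yE' : sval y = coh (sval (mk_ctx okΘ)) (arr (sval A0) (sval u0) (sval v0)) (sval γ0) by [].
  have [k [k' [B [r [r' [[k'k kk'] kE rr' tE]]]]]] :=
    @R_coh R RP G (mk_ctx okΘ) d A0 u0 v0 γ0 T y yE'.
  have kvar n (x : ps_gset d n) : dec nmT (cmap k x) = var (sval x).
    have /has_dimE[X xX hX] := svalP x.
    have okx : tm_ok Θ (var (sval x)) X by constructor.
    pose z := mk_tm (Γ := mk_ctx okΘ) (A := mk_ty (Γ := mk_ctx okΘ) (cget_ok okΘ xX)) okx.
    have zk := kE n x _ z erefl; rewrite -(Rnaming_var gT (y := z) erefl).
    have /esym := congr1
      (fun p : {n : nat & cell (gen (Rctx (mk_ctx okΘ))) n} => dec nmT (projT2 p)) zk.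
    by [].
  have uE : dec nmT (top_cell (sval (Rtm u0))) = u by apply: IHu.
  have vE : dec nmT (top_cell (sval (Rtm v0))) = v by apply: IHv.
  have := congr1 (fun p : {n : nat & cell (gen (Rctx G)) n} => dec nm (projT2 p)) tE.
  rewrite [LHS]/= => yD; rewrite /dtm [LHS]yD.
  apply: (coh_clause_dec gT' k'k kvar rr' (Rnaming_naming gG) _ rep uE vE uok).
  exact: size_sub_ok γok.
- move=> Δ Γ γ A t γok [IHΔ IHγ] okA _ tok [_ IHt]; split=> //.
  move=> G nm x T y GE gG; rewrite (size_sub_ok γok) ltnS leq_eqVlt.
  case: eqP => /= [_ _|_]; first exact: IHt.
  by move=> lt; apply: IHγ.
Qed.

End Uniqueness.

(** * Essential image *)

Lemma inj_surj_bij (A B : Type) (f : A -> B) :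
  injective f -> (forall b, exists a, f a = b) -> bijective f.
Proof.
move=> inj surj; have fK b := witnessP (surj b).
by exists (fun b => witness (surj b)) => [a|//]; apply: inj.
Qed.

Lemma cvar_inj V n (v w : V n) : cvar v = cvar w -> v = w.
Proof. by case=> e; exact: (inj_pair2 _ _ _ _ _ e). Qed.

Lemma bind_eq_var V W (h : forall n, V n -> cell W n) n (c : cell V n) (v : W n) :
  bind h c = cvar v -> exists w : V n, c = cvar w /\ h n w = cvar v.
Proof. by case: c v => [m w|m B a b f] v //= hw; exists w. Qed.

(** Substitution into a coherence is again a coherence, so a cell that becomes a variable was one
    already. *)
Lemma iso_gen C D (f : cmor C D) (g : cmor D C) : ccomp g f = cid C ->
  forall n (v : gen C n), exists w : gen D n, cmap f v = cvar w /\ cmap g w = cvar v.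
Proof.
move=> gf n v; apply: bind_eq_var.
exact: (congr1 (fun h : cmor C C => cmap h v) gf).
Qed.

Lemma naming_finite Γ C nm D (f : cmor D C) (g : cmor C D) :
  naming Γ C nm -> ccomp g f = cid D -> ccomp f g = cid C -> finite_computad D.
Proof.
move=> gC gf fg.
have FEx (i : 'I_(csize Γ)) : exists s : {n : nat & gen D n},
    exists2 w : gen C (projT1 s), cmap f (projT2 s) = cvar w & nm _ w = i.
  have [A xA] := cget_some (ltn_ord i).
  have [n [w wi]] := naming_surj gC xA.
  have [v [gw fv]] := iso_gen fg w.
  by exists (existT _ n v), w.
pose F i := witness (FEx i).
have FE i := witnessP (FEx i).
exists (csize Γ), F; apply: inj_surj_bij.
  move=> i j; rewrite /F => ij; have [w fw wi] := FE i; have [w' fw' wj] := FE j.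
  apply: val_inj; rewrite /= -wi -wj; move: (witness _) (witness _) ij w fw w' fw' {wi wj FE}.
  by move=> s s' -> w -> w' e; rewrite (cvar_inj e).
move=> [n v]; have [w [fv gw]] := iso_gen gf v.
have lt : nm n w < csize Γ by apply: cget_lt (naming_ty gC w).
exists (Ordinal lt); have [w' fw'] := FE (Ordinal lt); rewrite /F.
move: (witness _) w' fw' => [m v'] /= w' fw' /(naming_inj gC) E.
have mn : m = n := congr1 (@projT1 _ _) E; subst m.
have ww := inj_pair2 _ _ _ _ _ E; subst w'.
have [w2 [fv2 gw2]] := iso_gen gf v'.
move: fv2; rewrite fw' => e; have ww := cvar_inj e; subst w2.
by move: gw2; rewrite gw => e'; rewrite (cvar_inj e').
Qed.

Section FiniteContext.
Variables (X : computad) (k : nat) (f : 'I_k -> {n : nat & gen X n}).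
Variable g : {n : nat & gen X n} -> 'I_k.
Hypotheses (fK : cancel f g) (gK : cancel g f).

Let dim (i : 'I_k) := projT1 (f i).
(** Listing the generators by dimension ensures that boundaries are declared beforehand. *)
Let s := sort (relpre dim leq) (enum 'I_k).

Let fin_name n (v : gen X n) : nat := index (g (existT _ n v)) s.
Let fin_ty (i : 'I_k) : ty := cty (att X) fin_name (cvar (projT2 (f i))).
Let fin_ctx j : ctx := foldl ccons cnil [seq fin_ty i | i <- take j s].

Lemma fin_mem i : i \in s. Proof. by rewrite mem_sort mem_enum. Qed.

Lemma fin_size : size s = k. Proof. by rewrite size_sort size_enum_ord. Qed.

Lemma fin_dim i j : index i s <= index j s -> dim i <= dim j.
Proof.
have tr : transitive (relpre dim leq) by move=> a b c; apply: leq_trans.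
have rf : reflexive (relpre dim leq) by move=> a; apply: leqnn.
have st : sorted (relpre dim leq) s by apply: sort_sorted => a b; apply: leq_total.
have ins a : index a s \in [pred n | n < size s] by rewrite inE index_mem fin_mem.
move=> /(sorted_leq_nth tr rf i st _ _ (ins i) (ins j)).
by rewrite !nth_index ?fin_mem.
Qed.

Lemma fin_size_ctx j : j <= k -> csize (fin_ctx j) = j.
Proof. by move=> le; rewrite csize_foldl size_map size_takel ?fin_size. Qed.

Lemma fin_get j n (v : gen X n) : fin_name v < j ->
  cget (fin_ctx j) (fin_name v) = Some (cty (att X) fin_name (cvar v)).
Proof.
move=> lt; have vs := fin_mem (g (existT _ n v)).
have lts : fin_name v < size s by rewrite index_mem.
rewrite cget_foldl // [_ - _]subn0 onthE -map_comp (nth_map (g (existT _ n v))); last first.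
  by rewrite size_take; case: ifP.
by rewrite nth_take //= nth_index // /fin_ty gK.
Qed.

Lemma fin_ctx_ok j : j <= k -> ctx_ok (fin_ctx j).
Proof.
elim: j => [|j IH] lt; first by rewrite /fin_ctx take0; exact: ok_cnil.
have okj := IH (ltnW lt); have i0 : 'I_k := Ordinal lt.
have -> : fin_ctx j.+1 = ccons (fin_ctx j) (fin_ty (nth i0 s j)).
  by rewrite /fin_ctx (take_nth i0) ?fin_size // map_rcons foldl_rcons.
constructor; rewrite /fin_ty; set i := nth i0 s j.
have ij : index i s = j.
  by rewrite index_uniq ?fin_size // sort_uniq enum_uniq.
have dimi : dim i = projT1 (f i) by [].
move: (f i) dimi => [[|n] v] /= dimi; first exact: ok_star.
(* The entry at [j] has dimension [n.+1], so all generators of dimension at most [n] precede it in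
   the sorted list. *)
have decl : declares n (fin_ctx j) (att X) fin_name.
  move=> m w le; apply: fin_get; rewrite ltnNge -{1}ij; apply/negP => /fin_dim.
  by rewrite dimi /dim gK /=; lia.
have [ac bc ab] := attP v.
have aok := dec_ok (attP (c := X)) okj decl ac.
have bok := dec_ok (attP (c := X)) okj decl bc.
rewrite -(cty_parallel _ ab) in bok.
by apply: ok_arr => //; apply: tm_ok_ty.2.2.1 aok.
Qed.

Lemma fin_good : naming (fin_ctx k) X fin_name.
Proof.
have lt n (v : gen X n) : fin_name v < k by rewrite -fin_size index_mem fin_mem.
split; first exact: fin_ctx_ok.
- move=> n m v w e; apply: (can_inj gK).
  have := congr1 (nth (g (existT _ n v)) s) e.
  by rewrite !nth_index ?fin_mem.
- by move=> n v; apply: fin_get.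
- move=> x A /cget_lt; rewrite fin_size_ctx // => ltx.
  pose i := nth (Ordinal ltx) s x; exists (projT1 (f i)), (projT2 (f i)).
  rewrite /fin_name -[existT _ _ _]/(existT (gen X) (projT1 (f i)) (projT2 (f i))).
  rewrite -sigT_eta fK index_uniq ?fin_size // sort_uniq enum_uniq //.
Qed.

End FiniteContext.

Lemma finite_good X : finite_computad X -> exists Γ nm, naming Γ X nm.
Proof.
case=> k [f [g fK gK]]; do 2!eexists; exact: fin_good fK gK.
Qed.

Lemma R_spec (R : cwf_mor SCaTT CompOp) (RP : is_R R) (Γ : ob SCaTT) :
  exists nm : names R Γ, [/\ Rnaming nm,
    forall A : Ty Γ, dty nm (Rty R A) = sval A &
    forall (A : Ty Γ) (t : Tm A), dtm nm (Rtm R t) = sval t].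
Proof.
have [nm gG] := (R_decodes RP).1 _ (svalP Γ) Γ erefl.
exists nm; split=> // [A|A t].
  by apply: ((R_decodes RP).2.1 _ _ (svalP A)).2.
by apply: ((R_decodes RP).2.2.1 _ _ _ (svalP t)).2.
Qed.

Theorem theorem6p1 :
  (exists R : cwf_mor SCaTT CompOp, is_R R) /\
  (forall R : cwf_mor SCaTT CompOp, is_R R ->
     [/\ fully_faithful R,
         (forall X : ob CompOp,
            in_essential_image R X <-> finite_computad X),
         (forall Γ : ob SCaTT, bijective (@fty SCaTT CompOp R Γ)) &
         (forall (Γ : ob SCaTT) (A : Ty Γ),
            bijective (@ftm SCaTT CompOp R Γ A))]).
Proof.
split; first by exists R_mor; exact: is_R_mor.
move=> R RP; split.
- move=> Δ Γ; have [nmG [gG _ _]] := R_spec RP Γ; have [nmD [gD _ tmD]] := R_spec RP Δ.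
  have gG' := Rnaming_naming gG; have gD' := Rnaming_naming gD.
  have rep (γ : hom Δ Γ) : represents nmG nmD (Rhom R γ) (sval γ).
    by apply: (represents_Rhom gD gG) => x T z _ <-.
  apply: inj_surj_bij => [γ γ' e|h].
    apply: sig_eq; apply: (represents_sub gG' (svalP γ) (svalP γ') (rep γ)).
    have := rep γ'; rewrite /Rhom -[fhom R γ']e; exact.
  have [γ γok rγ] := sub_of_mor gG' gD' h.
  pose γ0 : @hom SCaTT Δ Γ := exist _ γ γok.
  exists γ0; exact: (represents_mor gD' (rep γ0) rγ).
- move=> X; split.
    case=> Γ [f [g [gf fg]]]; have [nm [gG _ _]] := R_spec RP Γ.
    exact: (naming_finite (Rnaming_naming gG) fg gf).
  (* Both [X] and [R G] are named by the same context, which makes them isomorphic. *)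
  move=> /finite_good[Γ [nm gX]]; pose G := mk_ctx (naming_ok gX).
  have [nmG [gG _ _]] := R_spec RP G.
  have [f [g [gf fg _ _]]] := naming_iso gX (Rnaming_naming gG).
  by exists G, f, g.
- move=> Γ; have [nm [gG tyE _]] := R_spec RP Γ; have gG' := Rnaming_naming gG.
  apply: inj_surj_bij => [A A' e|T].
    by apply: sig_eq; rewrite -tyE -[RHS]tyE /Rty e.
  exists (exist _ (dty nm T) (dty_ok gG' T)).
  by apply: (dty_inj gG'); apply: tyE.
move=> Γ A; have [nm [gG tyE tmE]] := R_spec RP Γ; have gG' := Rnaming_naming gG.
apply: inj_surj_bij => [t t' e|c].
  by apply: sig_eq; rewrite -tmE -[RHS]tmE /Rtm e.
have cok := dtm_ok gG' c; rewrite [dty _ _]tyE in cok.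
by exists (exist _ (dtm nm c) cok); apply: (dtm_inj gG'); apply: tmE.
Qed.
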